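(* Let $G$ be a countable directed graph, let $N\in\mathbb{N}$, and suppose there is a vertex $v_0\in V(G)$ such that the set $Loop_{v_0}(G)=\{l_1,\dots,l_N\}$ of basic loops $l=v_0lv_0$ based at $v_0$ has exactly $N$ elements. Let $$S=\left\{\tfrac{1}{\sqrt2}\left(L_l+L_l^*\right): l\in Loop_{v_0}(G)\right\},\qquad L(S)=\overline{\mathbb{C}[S]}^{w}\subset W^*(G).$$ Then $(L(S),E|_{L(S)})=(L(F_N),\tau)$; that is, there is a $W^*$-algebra isomorphism from $L(S)$ onto the free group factor $L(F_N)$ carrying $E|_{L(S)}$, regarded as a linear functional via $\mathbb{C}L_{v_0}\cong\mathbb{C}$, to the canonical trace $\tau$.
   Context: Let $G$ be a countable directed graph with vertex set $V(G)$ and edge set $E(G)$. $\mathbb{F}^+(G)$ is the free semigroupoid of $G$: the set of all vertices (as units) and all admissible finite paths. A path $w$ with source $x$ and range $y$ is written $w=xwy$. The set of finite paths (non-vertices) is $FP(G)$. The graph Hilbert space is $H_G=l^2(\mathbb{F}^+(G))$ with orthonormal basis $\{\xi_w:w\in\mathbb{F}^+(G)\}$. The creation operator $L_w$ is multiplication by $\xi_w$: $L_w\xi_h=\xi_{wh}$ if $wh\in\mathbb{F}^+(G)$ and $0$ otherwise. Its adjoint satisfies $L_w^*\xi_{w'}=\xi_h$ if $w'=wh$ and $0$ otherwise. The paper calculates with the relations $L_w^*L_w=L_y$ and $L_wL_w^*=L_x$ for $w=xwy$, and $L_v=L_v^*=L_v^2$ for $v\in V(G)$. The graph $W^*$-algebra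 $W^*(G)$ is the weak closure in $B(H_G)$ of the algebra generated by all $L_w,L_w^*$. The diagonal subalgebra is $D_G=W^*(\{L_v:v\in V(G)\})$. Each $a\in W^*(G)$ is written in its Fourier expansion $a=\sum_{v\in V(G)}p_vL_v+\sum_{w\in FP(G),\,u_w\in\{1,*\}}p_w^{(u_w)}L_w^{u_w}$ with complex coefficients, and the canonical conditional expectation $E:W^*(G)\to D_G$ is $E(a)=\sum_{v}p_vL_v$. A basic loop based at $v_0$ is a loop-edge with source and range $v_0$. $\overline{\mathbb{C}[S]}^{w}$ is the weak closure of the complex algebra generated by $S$; its unit is $L_{v_0}$. $F_N$ is the free group on $N$ generators, $L(F_N)$ its group von Neumann algebra, and $\tau(\sum_g\alpha_g g)=\alpha_e$ its canonical trace.
   Formalization: E is taken with p_v = <a xi_v, xi_v>, since elements of L(S) such as (L_l+L_l^* )^2 have no Fourier expansion in L_v, L_w, L_w^* alone on H_G; the relation L_w L_w^* = L_x, false on H_G for paths w, is not imposed. *)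

(* Defs.v *)
(* The complex numbers are R[i] for R : realType. *)
From HB Require Import structures.
From mathcomp Require Import all_boot all_order all_algebra.
From mathcomp Require Import finmap.
From mathcomp Require Import mathcomp_extra boolp classical_sets functions.
From mathcomp Require Import cardinality fsbigop reals constructive_ereal.
From mathcomp Require Import ereal numfun esum.
From mathcomp Require Import complex ring.

Set Implicit Arguments.
Unset Strict Implicit.
Unset Printing Implicit Defensive.

Import Order.TTheory GRing.Theory Num.Theory.
Import Normc.

Local Open Scope classical_set_scope.
Local Open Scope ring_scope.

Section L2.
Variables (R : realType) (X : choiceType).
Implicit Types (f g : X -> R[i]).

Definition sqsum f : \bar R := \esum_(x in [set: X]) (normc (f x) ^+ 2)%:E.

Definition square_summable : {pred (X -> R[i])} := [pred f | `[< (sqsum f < +oo)%E >]].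

Lemma sqsum_ge0 f : (0 <= sqsum f)%E.
Proof. by apply: esum_ge0 => x _; rewrite lee_fin sqr_ge0. Qed.

Lemma normc_ge0 (z : R[i]) : 0 <= normc z.
Proof. by case: z => a b; exact: sqrtr_ge0. Qed.

Lemma sqnormcE (z : R[i]) :
  normc z ^+ 2 = complex.Re z ^+ 2 + complex.Im z ^+ 2.
Proof. by case: z => a b; rewrite /= sqr_sqrtr // addr_ge0 // sqr_ge0. Qed.

Lemma sqnormcD (z w : R[i]) :
  normc (z + w) ^+ 2 <= 2 * normc z ^+ 2 + 2 * normc w ^+ 2.
Proof.
rewrite !sqnormcE; case: z w => [a b] [c d] /=; rewrite -subr_ge0.
have -> : 2 * (a ^+ 2 + b ^+ 2) + 2 * (c ^+ 2 + d ^+ 2) -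
          ((a + c) ^+ 2 + (b + d) ^+ 2) = (a - c) ^+ 2 + (b - d) ^+ 2.
  by ring.
by rewrite addr_ge0 // sqr_ge0.
Qed.

Lemma esumZ (k : R) (a : X -> R) : 0 <= k -> (forall x, 0 <= a x) ->
  (\esum_(x in [set: X]) (k * a x)%:E <= k%:E * \esum_(x in [set: X]) (a x)%:E)%E.
Proof.
move=> k0 a0; apply: ge_ereal_sup => _ [F [finF FX] <-] /=.
rewrite (eq_fsbigr (fun x => k%:E * (a x)%:E)%E); last by move=> x _; rewrite EFinM.
rewrite -ge0_mule_fsumr; last by move=> x; rewrite lee_fin.
by apply: lee_wpmul2l; [rewrite lee_fin|apply: ereal_sup_ubound; exists F].
Qed.

Lemma sqsumD f g : (sqsum (f + g)%R <= 2%:E * sqsum f + 2%:E * sqsum g)%E.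
Proof.
apply: (@le_trans _ _ (\esum_(x in [set: X])
   ((2 * normc (f x) ^+ 2)%:E + (2 * normc (g x) ^+ 2)%:E)%E)).
  by apply: le_esum => x _; rewrite -EFinD lee_fin sqnormcD.
rewrite esumD; try by move=> x _; rewrite lee_fin mulr_ge0 // sqr_ge0.
by apply: leeD; apply: esumZ => // x; rewrite sqr_ge0.
Qed.

Lemma sqsumZ (c : R[i]) f : (sqsum (c *: f)%R <= (normc c ^+ 2)%:E * sqsum f)%E.
Proof.
have -> : sqsum (c *: f) =
    \esum_(x in [set: X]) (normc c ^+ 2 * normc (f x) ^+ 2)%:E.
  apply: eq_esum => x _.
  by rewrite -exprMn -normcM.
by apply: esumZ => [|x]; rewrite sqr_ge0.
Qed.

Lemma sqsum0 : sqsum 0 = 0%E.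
Proof. by apply: esum1 => x _; rewrite normc0 expr0n. Qed.

Lemma square_summable_submod : submod_closed square_summable.
Proof.
split; first by apply/asboolP; rewrite sqsum0.
move=> c f g /asboolP ff /asboolP gf; apply/asboolP.
apply: le_lt_trans (sqsumD _ _) _; rewrite lte_add_pinfty //.
  rewrite lte_mul_pinfty //.
  apply: le_lt_trans (sqsumZ _ _) _.
  by rewrite lte_mul_pinfty // ?lee_fin ?sqr_ge0.
by rewrite lte_mul_pinfty.
Qed.

HB.instance Definition _ :=
  GRing.isSubmodClosed.Build R[i] (X -> R[i]) square_summable
    square_summable_submod.

Record l2 := L2 { l2fun :> X -> R[i]; l2funP : l2fun \in square_summable }.

HB.instance Definition _ := [isSub for l2fun].
HB.instance Definition _ := [Choice of l2 by <:].
HB.instance Definition _ := [SubChoice_isSubLmodule of l2 by <:].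

End L2.

Section Hilbert.
Variables (R : realType) (X : choiceType).
Implicit Types (f g : l2 R X) (x : X).

Definition l2norm f : R := Num.sqrt (fine (sqsum f)).

(* The sum of an absolutely summable family, in R and in C. *)
Definition rsum (a : X -> R) : R :=
  fine (\esum_(x in [set: X]) (EFin \o a)^\+ x
        - \esum_(x in [set: X]) (EFin \o a)^\- x)%E.

Definition csum (a : X -> R[i]) : R[i] :=
  Complex (rsum (fun x => complex.Re (a x))) (rsum (fun x => complex.Im (a x))).

(* Linear in the first argument, antilinear in the second. *)
Definition l2dot f g : R[i] := csum (fun x => f x * (g x)^*%C).

Lemma l2P f g : f =1 g -> f = g.
Proof. by move=> fg; apply: val_inj; apply: funext. Qed.

Lemma sqsum_fin f : sqsum f \is a fin_num.
Proof.
rewrite ge0_fin_numE ?sqsum_ge0 //.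
by apply/asboolP; exact: (l2funP f).
Qed.

Lemma l2norm_ge0 f : 0 <= l2norm f.
Proof. exact: sqrtr_ge0. Qed.

Lemma l2norm_sq f : (l2norm f ^+ 2)%:E = sqsum f.
Proof. by rewrite sqr_sqrtr ?fine_ge0 ?sqsum_ge0 // fineK // sqsum_fin. Qed.

Lemma l2norm_coord f x : normc (f x) <= l2norm f.
Proof.
rewrite -ler_sqr ?nnegrE ?l2norm_ge0 ?normc_ge0 // -lee_fin l2norm_sq.
apply: esum_ge; exists [set x]; first by split.
by rewrite fsbig_set1.
Qed.

Lemma sqsum_delta x : sqsum (fun y => (y == x)%:R : R[i]) = 1%E.
Proof.
rewrite /sqsum (eq_esum (b := fun y => if y \in [set x] then 1%E else 0%E)).
  by rewrite -esum_mkcond esum_set1 // lee_fin.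
move=> y _; case: eqP => [->|nyx].
  by rewrite mem_set // normc1 expr1n.
by rewrite memNset // normc0 expr0n.
Qed.

Lemma delta_summable x :
  (fun y => (y == x)%:R : R[i]) \in @square_summable R X.
Proof. by apply/asboolP; rewrite sqsum_delta ltry. Qed.

(* xi_x *)
Definition delta x : l2 R X := L2 (delta_summable x).

Lemma l2norm_delta x : l2norm (delta x) = 1.
Proof. by rewrite /l2norm sqsum_delta sqrtr1. Qed.

Definition bounded (T : l2 R X -> l2 R X) :=
  exists M : R, forall f, l2norm (T f) <= M * l2norm f.

Lemma boundedP (T : l2 R X -> l2 R X) :
  bounded T <-> exists2 M : R, 0 <= M & forall f, (sqsum (T f) <= M%:E * sqsum f)%E.
Proof.
split=> [[M HM]|[M M0 HM]].
  exists (M ^+ 2); first exact: sqr_ge0.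
  move=> f; rewrite -(l2norm_sq f) -(l2norm_sq (T f)) -EFinM lee_fin -exprMn.
  by rewrite ler_sqr // nnegrE ?l2norm_ge0 // (le_trans (l2norm_ge0 _) (HM f)).
exists (Num.sqrt M) => f; rewrite -ler_sqr ?nnegrE ?mulr_ge0 ?sqrtr_ge0 //.
by rewrite exprMn (sqr_sqrtr M0) -lee_fin (EFinM M) !l2norm_sq.
Qed.

Lemma rsum_supp1 (a : X -> R) x : (forall y, y != x -> a y = 0) -> rsum a = a x.
Proof.
move=> a0.
have E (b : X -> \bar R) : (forall y, (0 <= b y)%E) ->
    (forall y, y != x -> b y = 0%E) -> \esum_(y in [set: X]) b y = b x.
  move=> b0 bx; rewrite -(esum_set1 (b0 x)) [RHS]esum_mkcond.
  apply: eq_esum => y _; case: (eqVneq y x) => [->|yx].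
    by rewrite mem_set.
  by rewrite memNset ?bx //; apply/eqP.
rewrite /rsum !E.
- by have /= <- := congr1 (@^~ x) (funeposneg (EFin \o a)).
- by move=> y; exact: funeneg_ge0.
- by move=> y yx; rewrite funenegE /= a0 // oppr0 maxxx.
- by move=> y; exact: funepos_ge0.
- by move=> y yx; rewrite funeposE /= a0 // maxxx.
Qed.

Lemma l2dot_delta f x : l2dot f (delta x) = f x.
Proof.
have E y : f y * (delta x y)^*%C = if y == x then f y else 0.
  by rewrite /=; case: eqP => _; rewrite ?conjc1 ?conjc0 ?mulr1 ?mulr0.
rewrite /l2dot /csum !(@rsum_supp1 _ x) => [|y yx|y yx].
- by rewrite E eqxx; case: (f x).
- by rewrite E (negPf yx).
- by rewrite E (negPf yx).
Qed.

End Hilbert.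

Section Operators.
Variables (R : realType) (X : choiceType).
Local Notation H := (l2 R X).

Definition bounded_linear : {pred (H -> H)} :=
  [pred T : H -> H | `[< linear T /\ bounded T >]].

Lemma bounded_linear_submod : submod_closed bounded_linear.
Proof.
split.
  apply/asboolP; split; first by move=> c f g; rewrite /= scaler0 addr0.
  apply/boundedP; exists 0 => // f; rewrite mul0e.
  by have -> : sqsum ((0 : H -> H) f) = 0%E by exact: sqsum0.
move=> c S T /asboolP[linS /boundedP[M M0 HM]] /asboolP[linT /boundedP[K K0 HK]].
apply/asboolP; split.
  move=> k f g /=; have E h : (c *: S + T) h = c *: S h + T h by [].
  rewrite !E linS linT !scalerDr !scalerA [k * c]mulrC.
  by rewrite -!addrA; congr (_ + _); rewrite addrCA.
apply/boundedP; exists (2 * (normc c ^+ 2 * M) + 2 * K).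
  by rewrite addr_ge0 // mulr_ge0 // mulr_ge0 // sqr_ge0.
move=> f; apply: le_trans (sqsumD _ _) _.
have -> : ((2 * (normc c ^+ 2 * M) + 2 * K)%:E * sqsum f =
    2%:E * ((normc c ^+ 2)%:E * (M%:E * sqsum f)) + 2%:E * (K%:E * sqsum f))%E.
  by rewrite -l2norm_sq -!EFinM -EFinD; congr EFin; ring.
apply: leeD; apply: lee_wpmul2l; rewrite ?lee_fin //; last exact: HK.
apply: le_trans (sqsumZ _ _) _.
by apply: lee_wpmul2l; [rewrite lee_fin sqr_ge0|exact: HM].
Qed.

HB.instance Definition _ :=
  GRing.isSubmodClosed.Build R[i] (H -> H) bounded_linear bounded_linear_submod.

(* B(l^2(X)) *)
Record bop := Bop { bopfun :> H -> H; bopfunP : bopfun \in bounded_linear }.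

HB.instance Definition _ := [isSub for bopfun].
HB.instance Definition _ := [Choice of bop by <:].
HB.instance Definition _ := [SubChoice_isSubLmodule of bop by <:].

Implicit Types (S T : bop).

Lemma bopP S T : S =1 T -> S = T.
Proof. by move=> ST; apply: val_inj; apply: funext. Qed.

Lemma bop_linear T : linear T.
Proof. by have /asboolP[] := bopfunP T. Qed.

Lemma bop_bounded T : bounded T.
Proof. by have /asboolP[] := bopfunP T. Qed.

HB.instance Definition _ T := GRing.isLinear.Build R[i] H H *:%R T (bop_linear T).

Lemma bop1_subproof : (id : H -> H) \in bounded_linear.
Proof. by apply/asboolP; split=> //; exists 1 => f; rewrite mul1r. Qed.

Definition bop1 : bop := Bop bop1_subproof.

Lemma bopM_subproof S T : S \o T \in bounded_linear.
Proof.
apply/asboolP; split; first by move=> c f g; rewrite /= !linearP.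
have /boundedP[M M0 HM] := bop_bounded S.
have /boundedP[K K0 HK] := bop_bounded T.
apply/boundedP; exists (M * K); first exact: mulr_ge0.
move=> f; apply: le_trans (HM _) _.
by rewrite EFinM -muleA; apply: lee_wpmul2l; rewrite ?lee_fin.
Qed.

Definition bopM S T : bop := Bop (bopM_subproof S T).

Lemma bopMA : associative bopM. Proof. by move=> S T U; exact: bopP. Qed.
Lemma bop1M : left_id bop1 bopM. Proof. by move=> S; exact: bopP. Qed.
Lemma bopM1 : right_id bop1 bopM. Proof. by move=> S; exact: bopP. Qed.
Lemma bopMDl : left_distributive bopM +%R.
Proof. by move=> S T U; exact: bopP. Qed.
Lemma bopMDr : right_distributive bopM +%R.
Proof. by move=> S T U; apply: bopP => f; rewrite /= linearD. Qed.

HB.instance Definition _ :=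
  GRing.Zmodule_isPzRing.Build bop bopMA bop1M bopM1 bopMDl bopMDr.

Definition is_adjoint S T := forall f g : H, l2dot (S f) g = l2dot f (T g).

(* The subalgebra generated by A. It need not contain the identity operator. *)
Definition alg_gen (A : set bop) : set bop :=
  \bigcap_(B in [set B : set bop | A `<=` B /\
     (forall S T, B S -> B T -> B (S + T)) /\
     (forall S T, B S -> B T -> B (S * T)) /\
     (forall (c : R[i]) S, B S -> B (c *: S))]) B.

(* Closure in the weak operator topology: the basic neighbourhoods of T
   constrain finitely many matrix coefficients. *)
Definition wot_closure (A : set bop) : set bop :=
  [set T | forall (s : seq (H * H)) (e : R), 0 < e ->
     exists2 S, A S & forall p, p \in s -> normc (l2dot ((T - S) p.1) p.2) < e].

(* f |-> (x |-> f (phi x)), extended by 0 where phi is undefined. *)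
Section Pullback.
Variable phi : X -> option X.
Hypothesis phi_inj : forall x x' y, phi x = Some y -> phi x' = Some y -> x = x'.

Definition pull_fun (f : X -> R[i]) x := if phi x is Some y then f y else 0.

Lemma sqsum_pull (f : X -> R[i]) : (sqsum (pull_fun f) <= sqsum f)%E.
Proof.
pose a (z : option X) : \bar R :=
  if z is Some y then (normc (f y) ^+ 2)%:E else 0%E.
have a0 z : (0 <= a z)%E by case: z => [y|] //=; rewrite lee_fin sqr_ge0.
have -> : sqsum f = \esum_(z in Some @` [set: X]) a z.
  by rewrite esum_image // => x y _ _ [].
have -> : sqsum (pull_fun f) = \esum_(x in [set x | phi x]) a (phi x).
  rewrite [RHS]esum_mkcond; apply: eq_esum => x _.
  rewrite /pull_fun /a; case e: (phi x) => [y|].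
    by rewrite mem_set //= e.
  by rewrite memNset ?normc0 ?expr0n //= e.
rewrite -(esum_image _ phi a); last first.
  move=> x x'; rewrite !inE /= => + _ e; rewrite /is_true.
  case ex: (phi x) => [y|] // _; apply: (phi_inj ex); rewrite -ex e //.
rewrite esum_mkcond [leRHS]esum_mkcond; apply: le_esum => -[y|] _.
  by rewrite [X in (_ <= if X then _ else _)%E]mem_set //; case: ifP.
by do 2 case: ifP.
Qed.

Lemma pull_summable (f : H) : pull_fun f \in @square_summable R X.
Proof.
apply/asboolP; apply: le_lt_trans (sqsum_pull _) _.
by apply/asboolP; exact: (l2funP f).
Qed.

Lemma pull_subproof : (fun f => L2 (pull_summable f)) \in bounded_linear.
Proof.
apply/asboolP; split.
  move=> c f g; apply: l2P => x.
  have E (u v : H) y : (c *: u + v) y = c * u y + v y by [].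
  rewrite E /pull_fun /=; case: (phi x) => [y|]; first exact: E.
  by rewrite mulr0 addr0.
by apply/boundedP; exists 1 => // f; rewrite mul1e; exact: sqsum_pull.
Qed.

Definition pull : bop := Bop pull_subproof.

Lemma pullE (f : H) x : pull f x = if phi x is Some y then f y else 0.
Proof. by []. Qed.

End Pullback.

Section PullbackAdjoint.
Variables phi psi : X -> option X.
Hypothesis phiK : forall x y, phi x = Some y <-> psi y = Some x.

Lemma phi_inj x x' y : phi x = Some y -> phi x' = Some y -> x = x'.
Proof. by move=> /phiK e /phiK; rewrite e => -[]. Qed.

Lemma psi_inj x x' y : psi x = Some y -> psi x' = Some y -> x = x'.
Proof. by move=> /phiK e /phiK; rewrite e => -[]. Qed.

Lemma esum_pull (b : X -> X -> \bar R) :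
  \esum_(x in [set: X]) (if phi x is Some y then b x y else 0%E) =
  \esum_(y in [set: X]) (if psi y is Some x then b x y else 0%E).
Proof.
have mk (chi : X -> option X) (c : X -> X -> \bar R) :
    \esum_(x in [set: X]) (if chi x is Some y then c x y else 0%E) =
    \esum_(x in [set x | chi x]) (if chi x is Some y then c x y else 0%E).
  rewrite [RHS]esum_mkcond; apply: eq_esum => x _.
  case e: (chi x) => [y|]; first by rewrite mem_set //= e.
  by case: ifP.
rewrite mk (mk psi (fun y x => b x y)).
rewrite [RHS](@reindex_esum _ _ _ [set x | phi x] _ (fun x => odflt x (phi x))).
  apply: eq_esum => x /=; case e: (phi x) => [y|] //= _.
  by move/phiK: e => ->.
split=> [x /=|x x'|y /=].
- by case e: (phi x) => [y|] // _ /=; move/phiK: e => ->.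
- rewrite !inE /=; case e: (phi x) => [y|] // _; case e': (phi x') => [y'|] // _.
  by move=> /= yy'; rewrite yy' in e; exact: phi_inj e e'.
case e: (psi y) => [x|] // _; exists x => /=; by move/phiK: e => ->.
Qed.

Lemma rsum_pull (b : X -> X -> R) :
  rsum (fun x => if phi x is Some y then b x y else 0) =
  rsum (fun y => if psi y is Some x then b x y else 0).
Proof.
pose F (chi : X -> option X) (c : X -> X -> R) x :=
  if chi x is Some y then c x y else 0.
have Fp chi c x : ((EFin \o F chi c)^\+ x =
    if chi x is Some y then (Num.max (c x y) 0)%:E else 0)%E.
  by rewrite funeposE /F /=; case: (chi x) => [y|]; rewrite -EFin_max ?maxxx.
have Fn chi c x : ((EFin \o F chi c)^\- x =
    if chi x is Some y then (Num.max (- c x y) 0)%:E else 0)%E.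
  rewrite funenegE /F /=; case: (chi x) => [y|] //.
    by rewrite -EFin_max.
  by rewrite oppr0 maxxx.
have bE : (fun y => if psi y is Some x then b x y else 0) = F psi (fun y x => b x y).
  by [].
rewrite /rsum bE -/(F phi b); congr (fine (_ - _)%E).
  rewrite (eq_esum (fun x _ => Fp phi b x)).
  rewrite (eq_esum (fun x _ => Fp psi (fun y x => b x y) x)).
  exact: (esum_pull (fun x y => (Num.max (b x y) 0)%:E)).
rewrite (eq_esum (fun x _ => Fn phi b x)).
rewrite (eq_esum (fun x _ => Fn psi (fun y x => b x y) x)).
exact: (esum_pull (fun x y => (Num.max (- b x y) 0)%:E)).
Qed.

Lemma pull_adjoint : is_adjoint (pull phi_inj) (pull psi_inj).
Proof.
move=> f g; rewrite /l2dot /csum.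
have D (p : R[i] -> R) : p 0 = 0 ->
    rsum (fun x => p (pull phi_inj f x * ((g x)^*)%C)) =
    rsum (fun x => p (f x * ((pull psi_inj g x)^*)%C)).
  move=> p0; transitivity
    (rsum (fun x => if phi x is Some y then p (f y * ((g x)^*)%C) else 0)).
    congr rsum; apply: funext => x; rewrite pullE.
    by case: (phi x) => // ; rewrite mul0r.
  rewrite rsum_pull; congr rsum; apply: funext => y; rewrite pullE.
  by case: (psi y) => //; rewrite conjc0 mulr0.
by congr Complex; apply: D.
Qed.

End PullbackAdjoint.

Section Multiplier.
Variable m : X -> R[i].
Hypothesis m_bounded : exists M : R, forall x, normc (m x) <= M.

Lemma sqsum_mul (M : R) (f : X -> R[i]) : (forall x, normc (m x) <= M) ->
  (sqsum (fun x => m x * f x)%R <= (M ^+ 2)%:E * sqsum f)%E.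
Proof.
move=> HM; apply: le_trans (esumZ (sqr_ge0 _) (fun x => sqr_ge0 _)).
apply: le_esum => x _; rewrite lee_fin normcM exprMn ler_wpM2r ?sqr_ge0 //.
by rewrite ler_sqr ?nnegrE ?normc_ge0 // (le_trans (normc_ge0 (m x)) (HM x)).
Qed.

Lemma mult_summable (f : H) : (fun x => m x * f x) \in @square_summable R X.
Proof.
have [M HM] := m_bounded; apply/asboolP; apply: le_lt_trans (sqsum_mul _ HM) _.
rewrite lte_mul_pinfty ?lee_fin ?sqr_ge0 //.
by apply/asboolP; exact: (l2funP f).
Qed.

Lemma mult_subproof : (fun f => L2 (mult_summable f)) \in bounded_linear.
Proof.
apply/asboolP; split.
  move=> c f g; apply: l2P => x.
  change (m x * (c * f x + g x) = c * (m x * f x) + m x * g x).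
  by rewrite mulrDr mulrCA.
have [M HM] := m_bounded; apply/boundedP; exists (M ^+ 2); first exact: sqr_ge0.
by move=> f; exact: sqsum_mul.
Qed.

Definition mult : bop := Bop mult_subproof.

End Multiplier.

End Operators.

(* A countable directed graph; loops and parallel edges are allowed. *)
Record digraph := Digraph {
  vertex : countType;
  edge : countType;
  esrc : edge -> vertex;
  erng : edge -> vertex }.

Section FreeSemigroupoid.
Variable G : digraph.

Fixpoint admissible (v : vertex G) (s : seq (edge G)) : bool :=
  if s is e :: s' then (esrc e == v) && admissible (erng e) s' else true.

(* The free semigroupoid of G: a path is its source together with its edges,
   so that the vertices are the paths without edges. *)
Record gpath := GPath {
  gpair : vertex G * seq (edge G);
  gpairP : admissible gpair.1 gpair.2 }.

HB.instance Definition _ := [isSub for gpair].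
HB.instance Definition _ := [Countable of gpath by <:].

Implicit Types (w h k : gpath).

Definition psrc w : vertex G := (gpair w).1.
Definition pedges w : seq (edge G) := (gpair w).2.
Definition prng w : vertex G := last (psrc w) (map (@erng G) (pedges w)).

Definition vpath (v : vertex G) : gpath := @GPath (v, [::]) isT.

Lemma epath_subproof (e : edge G) : admissible (esrc e) [:: e].
Proof. by rewrite /= eqxx. Qed.

Definition epath (e : edge G) : gpath := @GPath (esrc e, [:: e]) (epath_subproof e).

Definition pmul w h : option gpath :=
  if prng w == psrc h then insub (psrc w, pedges w ++ pedges h) else None.

(* The h such that k = w h, if there is one. *)
Definition lquo w k : option gpath :=
  if (psrc w == psrc k) && prefix (pedges w) (pedges k)
  then insub (prng w, drop (size (pedges w)) (pedges k)) else None.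

Lemma admissible_cat v s t : admissible v (s ++ t) =
  admissible v s && admissible (last v (map (@erng G) s)) t.
Proof. by elim: s v => [|e s IH] v //=; rewrite IH andbA. Qed.

Lemma gpathP w h : psrc w = psrc h -> pedges w = pedges h -> w = h.
Proof.
by case: w h => [[v s] ?] [[u t] ?] /= vu st; apply: val_inj; congr pair.
Qed.

Lemma pmulP w h k : pmul w h = Some k <->
  [/\ prng w = psrc h, psrc k = psrc w & pedges k = pedges w ++ pedges h].
Proof.
rewrite /pmul; split.
  by case: eqP => // -> ; case: insubP => // u _ e [<-]; rewrite /psrc /pedges e.
move=> [-> sk ek]; rewrite eqxx; case: insubP => [u _ e|].
  by congr Some; apply: gpathP; rewrite ?sk ?ek /psrc /pedges e.
by rewrite -sk -ek (gpairP k).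
Qed.

Lemma lquoP w k h : lquo w k = Some h <-> pmul w h = Some k.
Proof.
rewrite pmulP /lquo; split.
  case: eqP => //= sk; case: prefixP => // -[t ek].
  case: insubP => // u _ e [<-]; rewrite /psrc /pedges e /=; split=> //.
  by rewrite -/(pedges k) ek drop_size_cat.
move=> [rw sk ek]; rewrite sk eqxx /= ek prefix_prefix drop_size_cat // rw.
case: insubP => [u _ e|]; first by congr Some; apply: gpathP; rewrite /psrc /pedges e.
by rewrite (gpairP h).
Qed.

End FreeSemigroupoid.

Section GraphAlgebra.
Variables (R : realType) (G : digraph).
Local Notation B := (bop R (gpath G)).
Implicit Types (w h : gpath G) (v : vertex G) (a : B).

(* L_w and its adjoint: L_w f = \sum_h f(h) xi_(wh) and (L_w^* f)(h) = f(wh). *)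
Definition creation w : B := pull R (phi_inj (lquoP w)).
Definition annihilation w : B := pull R (psi_inj (lquoP w)).

Lemma creation_adjoint w : is_adjoint (creation w) (annihilation w).
Proof. exact: pull_adjoint. Qed.

Lemma creation_delta w h : creation w (delta R h) =
  if pmul w h is Some k then delta R k else 0.
Proof.
apply: l2P => k; rewrite /creation pullE.
case e: (lquo w k) => [h'|]; last first.
  case e': (pmul w h) => [k'|] //=; case: eqP => // kk'.
  by move/lquoP: e'; rewrite -kk' e.
have e1 := e; move/lquoP: e1 => e1 /=.
case: (eqVneq h' h) => [<-|nh]; first by rewrite e1 /= eqxx.
case e2: (pmul w h) => [k'|] //=; case: eqP => // kk'.
by move/lquoP: e2; rewrite -kk' e => -[] /eqP; rewrite (negPf nh).
Qed.

Lemma annihilation_delta w k : annihilation w (delta R k) =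
  if lquo w k is Some h then delta R h else 0.
Proof.
apply: l2P => h; rewrite /annihilation pullE.
case e: (pmul w h) => [k'|]; last first.
  case e': (lquo w k) => [h'|] //=; case: eqP => // hh'.
  by move/lquoP: e'; rewrite -hh' e.
have e1 := e; move/lquoP: e1 => e1 /=.
case: (eqVneq k' k) => [<-|nk]; first by rewrite e1 /= eqxx.
case e2: (lquo w k) => [h'|] //=; case: eqP => // hh'.
by move/lquoP: e2; rewrite -hh' e => -[] /eqP; rewrite (negPf nk).
Qed.

Definition graph_wstar : set B :=
  wot_closure (alg_gen (range creation `|` range annihilation)).

(* p_v = <a xi_v, xi_v>, the coefficient of L_v in the Fourier expansion of a:
   it is 1 on L_v and 0 on every other L_w and L_w^*. *)
Definition vcoef a v : R[i] := a (delta R (vpath v)) (vpath v).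

Lemma vcoef_creation w v : vcoef (creation w) v = (w == vpath v)%:R.
Proof.
rewrite /vcoef creation_delta; case e: (pmul w (vpath v)) => [k|].
  move/pmulP: e => [_ sk ek]; rewrite (_ : k = w) /= 1?eq_sym //.
  by apply: gpathP => //; rewrite ek cats0.
case: eqP => // wv; suff: pmul w (vpath v) = Some w by rewrite e.
by apply/pmulP; rewrite wv.
Qed.

Lemma vcoef_annihilation w v : vcoef (annihilation w) v = (w == vpath v)%:R.
Proof.
rewrite /vcoef annihilation_delta; case e: (lquo w (vpath v)) => [h|].
  move/lquoP/pmulP: e => [rw sw]; case ew: (pedges w) => [|//] /= eh.
  have -> : w = vpath v by apply: gpathP.
  rewrite (_ : h = vpath v) /= ?eqxx //; apply: gpathP => //.
  by rewrite -rw /prng ew /= -sw.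
case: eqP => // wv; suff: lquo w (vpath v) = Some w by rewrite e.
by apply/lquoP/pmulP; rewrite wv.
Qed.

Lemma vcoef_bounded a : exists M : R, forall h, normc (vcoef a (psrc h)) <= M.
Proof.
have [M HM] := bop_bounded a; exists M => h.
apply: le_trans (l2norm_coord _ _) _.
by apply: le_trans (HM _) _; rewrite l2norm_delta mulr1.
Qed.

(* E a = \sum_v p_v L_v; on xi_h only the term v = psrc h contributes,
   see cond_expE. *)
Definition cond_exp a : B := mult (vcoef_bounded a).

Lemma cond_expE a (f : l2 R (gpath G)) h :
  cond_exp a f h = \sum_(v \in [set: vertex G]) vcoef a v * creation (vpath v) f h.
Proof.
have E v : creation (vpath v) f h = if v == psrc h then f h else 0.
  rewrite /creation pullE; case e: (lquo (vpath v) h) => [k|].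
    move/lquoP/pmulP: e => [vk hv eh]; rewrite hv eqxx.
    by congr (f _); apply: gpathP => //; rewrite hv -vk.
  case: eqP => // vh; suff: lquo (vpath v) h = Some h by rewrite e.
  by apply/lquoP/pmulP; rewrite vh.
rewrite -(fsbig_widen [set psrc h]) //; last first.
  by move=> v /= [_ /eqP nv]; move: (E v); rewrite (negPf nv) /= => ->; rewrite mulr0.
by rewrite fsbig_set1 E eqxx.
Qed.

Definition loops v : set (edge G) := [set e | esrc e = v /\ erng e = v].

Definition loop_gen v : set B :=
  [set ((Num.sqrt (2 : R))^-1)%:C%C *:
         (creation (epath e) + annihilation (epath e)) | e in loops v].

(* The algebra generated by S has the unit L_v, not the identity of B(H_G). *)
Definition loop_alg v : set B :=
  wot_closure (alg_gen (creation (vpath v) |` loop_gen v)).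

Lemma loop_alg_sub v : loop_alg v `<=` graph_wstar.
Proof.
move=> T HT s e e0; have [S HS HSe] := HT s e e0; exists S => //.
apply: HS => /=; split; last by split; [|split] => [U V HU HV|U V HU HV|c U HU] D HD;
  have [_ [HA [HM HZ]]] := HD;
  [apply: HA; [exact: HU|exact: HV]|apply: HM; [exact: HU|exact: HV]|apply: HZ; exact: HU].
move=> _ [-> D [HD _]|[l _ <-] D [HD [HA [HM HZ]]]].
  by apply: HD; left; exists (vpath v).
by apply/HZ/HA; apply: HD; [left|right]; exists (epath l).
Qed.

End GraphAlgebra.

Arguments creation R {G} w.
Arguments annihilation R {G} w.
Arguments loop_gen R {G} v _.
Arguments loop_alg R {G} v _.

Section FreeGroup.
Variable N : nat.

(* (i, false) is the generator x_i and (i, true) its inverse. *)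
Definition letter : Type := ('I_N * bool)%type.
HB.instance Definition _ := Countable.on letter.

Implicit Types (a b : letter) (s t u : seq letter).

Definition linv a : letter := (a.1, ~~ a.2).

Definition reduced s : bool := sorted (fun a b => b != linv a) s.

Definition push a s : seq letter :=
  if s is b :: s' then (if b == linv a then s' else a :: s) else [:: a].

Definition word_mul s t := foldr push t s.

Definition word_inv s := rev (map linv s).

Lemma linvK : involutive linv.
Proof. by case=> i b; rewrite /linv /= negbK. Qed.

Lemma reduced_push a s : reduced s -> reduced (push a s).
Proof.
case: s => [|b s] //= rs; case: ifPn => [_|ba]; first exact: path_sorted rs.
by rewrite /= ba.
Qed.

Lemma reduced_mul s t : reduced t -> reduced (word_mul s t).
Proof. by move=> rt; elim: s => //= a s; exact: reduced_push. Qed.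

Lemma pushK a s : reduced s -> push a (push (linv a) s) = s.
Proof.
case: s => [|b s] /=; first by rewrite eqxx.
rewrite linvK; case: eqP => [->|_] rs /=; last by rewrite eqxx.
by case: s rs => [|c s] //= /andP[/negPf ->].
Qed.

Lemma push_mul a s t : reduced t -> word_mul (push a s) t = push a (word_mul s t).
Proof.
move=> rt; case: s => [|b s] //=; case: eqP => [->|_] //=.
by rewrite pushK // reduced_mul.
Qed.

Lemma word_mulA s t u : reduced u ->
  word_mul s (word_mul t u) = word_mul (word_mul s t) u.
Proof. by move=> ru; elim: s => //= a s ->; rewrite push_mul. Qed.

Lemma word_mul1 s : reduced s -> word_mul s [::] = s.
Proof.
elim: s => //= a s IH rs; rewrite IH; last exact: path_sorted rs.
by case: s rs {IH} => [|b s] //= /andP[/negPf ->].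
Qed.

Lemma reduced_inv s : reduced s -> reduced (word_inv s).
Proof.
rewrite /reduced /word_inv rev_sorted sorted_map; apply: sub_sorted => a b /=.
by rewrite linvK; apply: contraNneq => <-.
Qed.

Lemma word_mulV s : reduced s -> word_mul (word_inv s) s = [::].
Proof.
elim: s => //= a s IH rs.
rewrite /word_inv /= rev_cons -cats1 /word_mul foldr_cat /= linvK eqxx.
exact: IH (path_sorted rs).
Qed.

Lemma word_invK s : word_inv (word_inv s) = s.
Proof. by rewrite /word_inv map_rev revK -map_comp map_id_in // => a _; exact: linvK. Qed.

Record free_group := FreeWord { fword : seq letter; fwordP : reduced fword }.

HB.instance Definition _ := [isSub for fword].
HB.instance Definition _ := [Countable of free_group by <:].

Definition fone : free_group := @FreeWord [::] isT.
Definition fmul (g h : free_group) : free_group :=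
  FreeWord (reduced_mul (fword g) (fwordP h)).
Definition fginv (g : free_group) : free_group := FreeWord (reduced_inv (fwordP g)).

Lemma fmulA : associative fmul.
Proof. by move=> g h k; apply: val_inj; rewrite /= word_mulA ?fwordP. Qed.
Lemma fmul1 : left_id fone fmul.
Proof. by move=> g; apply: val_inj. Qed.
Lemma f1mul : right_id fone fmul.
Proof. by move=> g; apply: val_inj; rewrite /= word_mul1 ?fwordP. Qed.
Lemma fmulV : left_inverse fone fginv fmul.
Proof. by move=> g; apply: val_inj; rewrite /= word_mulV ?fwordP. Qed.
Lemma fVmul : right_inverse fone fginv fmul.
Proof.
move=> g; apply: val_inj => /=.
by rewrite -{1}(word_invK (fword g)) word_mulV ?reduced_inv ?fwordP.
Qed.

HB.instance Definition _ :=
  isGroup.Build free_group fmulA fmul1 f1mul fmulV fVmul.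

End FreeGroup.

Section GroupVN.
Variables (R : realType) (Gamma : groupType).
Local Notation B := (bop R Gamma).

Lemma ltrans_subproof (g h k : Gamma) :
  Some (g^-1 * h)%g = Some k <-> Some (g * k)%g = Some h.
Proof. by split=> -[<-]; rewrite (mulKg, mulVKg). Qed.

(* lambda_g, the left translation xi_k |-> xi_(g k) *)
Definition ltrans (g : Gamma) : B := pull R (phi_inj (ltrans_subproof g)).

Lemma ltrans_delta (g k : Gamma) : ltrans g (delta R k) = delta R (g * k)%g.
Proof.
apply: l2P => h; rewrite /ltrans pullE /=.
by congr (_%:R); congr nat_of_bool; apply/eqP/eqP => [<-|->]; rewrite (mulKg, mulVKg).
Qed.

Definition group_vN : set B := wot_closure (alg_gen (range ltrans)).

(* The coefficient at the unit of the expansion a = \sum_g alpha_g lambda_g,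
   where alpha_g = (a xi_1)(g). *)
Definition group_trace (a : B) : R[i] := a (delta R 1%g) 1%g.

End GroupVN.

Arguments ltrans R {Gamma} g.
Arguments group_vN : clear implicits.

(* A *-isomorphism between von Neumann algebras is automatically normal. *)
Definition star_isomorphism (R : realType) (X Y : choiceType)
    (A : set (bop R X)) (B : set (bop R Y)) (Phi : bop R X -> bop R Y) :=
  [/\ set_bij A B Phi,
      forall a b, A a -> A b -> Phi (a + b) = Phi a + Phi b,
      forall (c : R[i]) a, A a -> Phi (c *: a) = c *: Phi a,
      forall a b, A a -> A b -> Phi (a * b) = Phi a * Phi b &
      forall a b, A a -> A b -> is_adjoint a b -> is_adjoint (Phi a) (Phi b)].

(* Main.v *)
Require Import Defs.
From mathcomp Require Import all_boot all_order all_algebra.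
From mathcomp Require Import finmap boolp classical_sets functions cardinality.
From mathcomp Require Import fsbigop reals ereal numfun esum.
From mathcomp Require Import normedtype derive realfun trigo.
From mathcomp Require Import measure lebesgue_measure lebesgue_integral ftc.
From mathcomp Require Import complex ring lra.

Set Implicit Arguments.
Unset Strict Implicit.
Unset Printing Implicit Defensive.

Import Order.TTheory GRing.Theory Num.Theory.
Import Normc.
Import numFieldNormedType.Exports.

(** Write [s_i] for [L_l + L_l^*] with [l] the [i]-th loop at [v0], [p] for
    [L_v0] and [Om] for the vector [xi_v0].

    A path with source [v0] is, in exactly one way, [l^n t] with [t] not
    beginning with [l].  Along this decomposition [s_i] is an amplification of
    one operator on [l^2(nat)], the Jacobi operator [J] that sends [xi_n] to
    [xi_(n+1) + xi_(n-1)] ([amp_pow_jacobi]).  The Chebyshev polynomials carry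
    [l^2(nat)] to [L^2] of the semicircle law [(2/pi) sin^2 th dth] on
    [[0, pi]] and [J] to multiplication by [2 cos th].  The angle
    [2 th - sin (2 th)] is uniformly distributed on the circle, hence
    multiplication by its exponential is a unitary [u] on [l^2(nat)] whose
    nonzero powers have vacuum coefficient 0.  Both [J] and [u] generate a
    commutative *-algebra with cyclic vector [xi_0], and the commutant of such
    an algebra is commutative ([abelian_commutant]).  As [u] and [J] commute,
    an operator commutes with [J] if and only if it commutes with [u]
    ([haar_unitary]).

    Let [U_i] be the amplification of [u] along the same decomposition, a
    unitary of the corner [p B(H_G) p] which commutes with the same operators
    as [s_i].  Given a reduced word in the [U_i] and their inverses, restrict
    its value at [Om] to the paths [l^n t], where [l] belongs to the first
    letter and [t] is fixed: the restriction is a multiple of a nonzero power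
    of [u] applied to [xi_0] ([uvec_slice]).  Its coefficient at [Om] is
    therefore 0, so that the vectors [U_g Om], [g] in the free group, are
    orthonormal ([gvec_orthonormal]).  They define an isometry [D] from
    [l^2(F_N)] into [H_G] with [D lambda_g = U_g D], and the isomorphism is
    [a |-> D^* a D] ([compress]).

    The rest of the proof works with commutants, through the double commutant
    theorem ([bicommutant]).  The maps [S |-> D S D^*] and [W |-> D^* W D]
    exchange the commutant of the left translations and that of [p] and the
    [s_i]; it follows that [D^* a D] belongs to [L(F_N)].  The range of [D] is
    spanned by the words in the loops ([ran_proj_word]), and every path from
    [v0] is a loop word followed by a tail, on which [L(S)] does not act.
    Replacing one tail by another commutes with [L(S)], so that an element of
    [L(S)] is determined by its action on loop words ([compress_inj]).
    Conversely an element [b] of [L(F_N)] is the image of the amplification of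
    [D b D^*] over all tails ([compress_surj]).  The map is multiplicative
    because [D D^*] commutes with [L(S)], and it preserves the trace because
    [D] sends [xi_1] to [Om] ([compress_trace]). *)

Local Open Scope classical_set_scope.
Local Open Scope ring_scope.

(** * The inner product *)

Section AbsolutelySummable.
Variables (R : realType) (X : choiceType).
Implicit Types (a b f g : X -> R).

Definition abs_summable a := (\esum_(x in [set: X]) `|a x|%:E < +oo)%E.

Let S (a : X -> R) : \bar R := \esum_(x in [set: X]) (a x)%:E.

Lemma abs_summable_le a b : (forall x, `|a x| <= `|b x|) ->
  abs_summable b -> abs_summable a.
Proof. by move=> ab; apply: le_lt_trans; apply: le_esum => x _; rewrite lee_fin. Qed.

Lemma abs_summableD a b : abs_summable a -> abs_summable b ->
  abs_summable (fun x => a x + b x).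
Proof.
move=> sa sb; apply: (@le_lt_trans _ _ (\esum_(x in [set: X]) (`|a x|%:E + `|b x|%:E))%E).
  by apply: le_esum => x _; rewrite -EFinD lee_fin ler_normD.
by rewrite esumD ?lte_add_pinfty // => x _; rewrite lee_fin.
Qed.

Lemma abs_summableZ (c : R) a : abs_summable a -> abs_summable (fun x => c * a x).
Proof.
move=> sa; rewrite /abs_summable.
under eq_esum => x _ do rewrite normrM.
by apply: le_lt_trans (esumZ (normr_ge0 _) _) _ => //; rewrite lte_mul_pinfty ?lee_fin.
Qed.

Let S_fin a : (forall x, 0 <= a x) -> abs_summable a -> S a \is a fin_num.
Proof.
move=> a0 sa; rewrite ge0_fin_numE; last by apply: esum_ge0 => x _; rewrite lee_fin.
by move: sa; rewrite /abs_summable; under eq_esum => x _ do rewrite ger0_norm //.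
Qed.

(** The sum is defined through positive and negative parts; this makes it
    computable from any difference of nonnegative summable families, which is
    what additivity needs. *)
Lemma rsum_diff a f g : (forall x, 0 <= f x) -> (forall x, 0 <= g x) ->
  abs_summable f -> abs_summable g -> (forall x, a x = f x - g x) ->
  rsum a = fine (S f) - fine (S g).
Proof.
move=> f0 g0 sf sg afg; rewrite -fineB ?S_fin //.
rewrite /rsum (_ : EFin \o a = ((EFin \o f) \- (EFin \o g))%E); last first.
  by apply: funext => x /=; rewrite afg EFinB.
by rewrite esumB // => x _ /=; rewrite lee_fin.
Qed.

Let pos a x : R := Num.max (a x) 0.
Let neg a x : R := Num.max (- a x) 0.

Let pos_ge0 a x : 0 <= pos a x. Proof. by rewrite le_max lexx orbT. Qed.
Let neg_ge0 a x : 0 <= neg a x. Proof. by rewrite le_max lexx orbT. Qed.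

Let posneg a x : a x = pos a x - neg a x.
Proof.
rewrite /pos /neg; have [a0|/ltW a0] := leP 0 (a x).
  by rewrite max_r ?subr0 // oppr_le0.
by rewrite max_l ?sub0r ?opprK // oppr_ge0.
Qed.

Let pos_summable a : abs_summable a -> abs_summable (pos a).
Proof.
apply: abs_summable_le => x; rewrite (ger0_norm (pos_ge0 _ _)) /pos.
by rewrite ge_max normr_ge0 andbT ler_norm.
Qed.

Let neg_summable a : abs_summable a -> abs_summable (neg a).
Proof.
apply: abs_summable_le => x; rewrite (ger0_norm (neg_ge0 _ _)) /neg.
by rewrite ge_max normr_ge0 andbT -normrN ler_norm.
Qed.

Lemma rsumD a b : abs_summable a -> abs_summable b ->
  rsum (fun x => a x + b x) = rsum a + rsum b.
Proof.
move=> sa sb; rewrite (@rsum_diff _ (fun x => pos a x + pos b x) (fun x => neg a x + neg b x)).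
- rewrite (rsum_diff (pos_ge0 a) (neg_ge0 a) (pos_summable sa) (neg_summable sa) (posneg a)).
  rewrite (rsum_diff (pos_ge0 b) (neg_ge0 b) (pos_summable sb) (neg_summable sb) (posneg b)).
  have SD (f g : X -> R) : (forall x, 0 <= f x) -> (forall x, 0 <= g x) ->
      S (fun x => f x + g x) = (S f + S g)%E.
    move=> f0 g0; rewrite /S; under eq_esum => x _ do rewrite EFinD.
    by rewrite esumD // => x _; rewrite lee_fin.
  rewrite !SD // !fineD ?S_fin //; do ?[exact: pos_summable|exact: neg_summable].
  by ring.
- by move=> x; rewrite addr_ge0.
- by move=> x; rewrite addr_ge0.
- by apply: abs_summableD; apply: pos_summable.
- by apply: abs_summableD; apply: neg_summable.
- by move=> x; rewrite {1}(posneg a) {1}(posneg b); ring.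
Qed.

Lemma rsum_ge0E a : (forall x, 0 <= a x) -> rsum a = fine (S a).
Proof.
move=> a0; rewrite /rsum.
have -> : (\esum_(x in [set: X]) (EFin \o a)^\+ x = S a)%E.
  by apply: eq_esum => x _; rewrite funeposE /= -EFin_max max_l.
rewrite [X in (_ - X)%E](_ : _ = 0%E) ?sube0 //.
by apply: esum1 => x _; rewrite funenegE /= -EFin_max max_r // oppr_le0.
Qed.

Lemma rsum0 : rsum (fun _ : X => 0 : R) = 0.
Proof. by rewrite rsum_ge0E // /S esum1. Qed.

Lemma rsumN a : abs_summable a -> rsum (fun x => - a x) = - rsum a.
Proof.
move=> sa; apply/eqP; rewrite eq_sym eqr_oppLR -subr_eq0 opprK -rsumD //.
  by rewrite (_ : (fun _ => _) = fun=> 0) ?rsum0 //; apply: funext => x; rewrite subrr.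
by apply: abs_summable_le sa => x; rewrite normrN.
Qed.

Lemma rsumZ (c : R) a : abs_summable a -> rsum (fun x => c * a x) = c * rsum a.
Proof.
move=> sa.
have pZ k (f : X -> R) : 0 <= k -> (forall x, 0 <= f x) ->
    fine (S (fun x => k * f x)) = k * fine (S f).
  move=> k0 f0.
  have [->|kN0] := eqVneq k 0.
    by rewrite mul0r /S esum1 // => x _; rewrite mul0r.
  have kp : 0 < k by rewrite lt0r kN0.
  suff -> : S (fun x => k * f x) = (k%:E * S f)%E.
    case e: (S f) => [r| |]//.
    - by rewrite gt0_muley ?lte_fin //= mulr0.
    - by rewrite gt0_muleNy ?lte_fin //= mulr0.
  apply/eqP; rewrite eq_le; apply/andP; split; first exact: esumZ.
  rewrite -[X in (_ <= X)%E]mul1e -(divff kN0) EFinM -muleA.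
  apply: lee_wpmul2l; first by rewrite lee_fin.
  rewrite (_ : S f = \esum_(x in [set: X]) (k^-1 * (k * f x))%:E).
    by apply: esumZ; rewrite ?invr_ge0 // => x; rewrite mulr_ge0.
  by apply: eq_esum => x _; rewrite mulrA mulVf ?mul1r.
have main k : 0 <= k -> rsum (fun x => k * a x) = k * rsum a.
  move=> k0; rewrite (@rsum_diff _ (fun x => k * pos a x) (fun x => k * neg a x)).
  - rewrite (rsum_diff (pos_ge0 a) (neg_ge0 a) (pos_summable sa) (neg_summable sa) (posneg a)).
    by rewrite mulrBr; congr (_ - _); apply: pZ.
  - by move=> x; rewrite mulr_ge0.
  - by move=> x; rewrite mulr_ge0.
  - exact/abs_summableZ/pos_summable.
  - exact/abs_summableZ/neg_summable.
  - by move=> x; rewrite {1}(posneg a) mulrBr.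
have [|c0] := leP 0 c; first exact: main.
rewrite -[RHS]opprK -mulNr -main ?oppr_ge0 ?ltW // -rsumN; last exact: abs_summableZ.
by congr rsum; apply: funext => x; rewrite mulNr opprK.
Qed.

End AbsolutelySummable.

Section InnerProduct.
Variables (R : realType) (X : choiceType).
Local Notation H := (l2 R X).
Implicit Types (f g h : H) (c : R[i]).

Definition csummable (a : X -> R[i]) :=
  abs_summable (fun x => complex.Re (a x)) /\ abs_summable (fun x => complex.Im (a x)).

Lemma csummable_le (a : X -> R[i]) (b : X -> R) : (forall x, normc (a x) <= b x) ->
  abs_summable b -> csummable a.
Proof.
move=> ab sb; have nE z : normc z = Num.sqrt (complex.Re z ^+ 2 + complex.Im z ^+ 2) :> R.
  by case: z.
split; apply: abs_summable_le sb => x; apply: le_trans (ler_norm _);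
  apply: le_trans (ab x); rewrite nE -[X in X <= _]sqrtr_sqr ler_wsqrtr // ?lerDl ?lerDr ?sqr_ge0 //.
Qed.

Lemma csumD (a b : X -> R[i]) : csummable a -> csummable b ->
  csum (fun x => a x + b x) = csum a + csum b.
Proof.
move=> [sa ta] [sb tb]; rewrite /csum; apply/eqP; rewrite eq_complex /=; apply/andP; split;
  apply/eqP; rewrite -rsumD //; congr rsum; apply: funext => x; by case: (a x) (b x) => [? ?] [].
Qed.

Lemma csumZ c (a : X -> R[i]) : csummable a -> csum (fun x => c * a x) = c * csum a.
Proof.
case: c => u v [sa ta]; rewrite /csum; apply/eqP; rewrite eq_complex /=; apply/andP; split; apply/eqP.
  rewrite -!rsumZ // -rsumN; last exact: abs_summableZ.
  rewrite -rsumD; [|exact: abs_summableZ|by apply: abs_summable_le (abs_summableZ v ta) => x; rewrite normrN].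
  by congr rsum; apply: funext => x; case: (a x).
rewrite -!rsumZ // -rsumD; [|exact: abs_summableZ|exact: abs_summableZ].
by congr rsum; apply: funext => x; case: (a x) => p q /=; ring.
Qed.

Lemma normc_conj (z : R[i]) : normc z^*%C = normc z.
Proof. by case: z => a b /=; rewrite sqrrN. Qed.

Lemma dot_summable f g : csummable (fun x => f x * (g x)^*%C).
Proof.
apply: (@csummable_le _ (fun x => normc (f x) ^+ 2 + normc (g x) ^+ 2)).
  move=> x; rewrite normcM normc_conj.
  have := normc_ge0 (f x); have := normc_ge0 (g x); nra.
have s h : abs_summable (fun x => normc (h x) ^+ 2).
  rewrite /abs_summable; under eq_esum => x _ do rewrite ger0_norm ?sqr_ge0 //.
  by have /asboolP := l2funP h.
exact: abs_summableD.
Qed.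

Lemma l2DE f g x : (f + g) x = f x + g x. Proof. by []. Qed.
Lemma l2ZE c f x : (c *: f) x = c * f x. Proof. by []. Qed.

Lemma l2dotDl f g h : l2dot (f + g) h = l2dot f h + l2dot g h.
Proof.
rewrite /l2dot -csumD; [|exact: dot_summable|exact: dot_summable].
by congr csum; apply: funext => x; rewrite l2DE mulrDl.
Qed.

Lemma l2dotZl c f h : l2dot (c *: f) h = c * l2dot f h.
Proof.
rewrite /l2dot -csumZ; last exact: dot_summable.
by congr csum; apply: funext => x; rewrite l2ZE mulrA.
Qed.

Lemma l2dotC f g : l2dot g f = (l2dot f g)^*%C.
Proof.
have [sr si] := dot_summable f g.
rewrite /l2dot /csum /=; congr Complex.
  by congr rsum; apply: funext => x; case: (f x) (g x) => [a b] [c d] /=; ring.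
by rewrite -rsumN //; congr rsum; apply: funext => x; case: (f x) (g x) => [a b] [c d] /=; ring.
Qed.

Lemma l2dotDr f g h : l2dot f (g + h) = l2dot f g + l2dot f h.
Proof. by rewrite l2dotC l2dotDl rmorphD; congr (_ + _); rewrite [RHS]l2dotC. Qed.

Lemma l2dotZr c f h : l2dot f (c *: h) = c^*%C * l2dot f h.
Proof. by rewrite l2dotC l2dotZl rmorphM; congr (_ * _); rewrite [RHS]l2dotC. Qed.

Lemma l2dot0l h : l2dot 0 h = 0.
Proof. by rewrite -(scale0r (0 : H)) l2dotZl mul0r. Qed.
Lemma l2dot0r h : l2dot h 0 = 0.
Proof. by rewrite l2dotC l2dot0l conjc0. Qed.
Lemma l2dotNl f h : l2dot (- f) h = - l2dot f h.
Proof. by rewrite -scaleN1r l2dotZl mulN1r. Qed.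
Lemma l2dotNr f h : l2dot f (- h) = - l2dot f h.
Proof. by rewrite l2dotC l2dotNl rmorphN [in RHS]l2dotC. Qed.
Lemma l2dotBl f g h : l2dot (f - g) h = l2dot f h - l2dot g h.
Proof. by rewrite l2dotDl l2dotNl. Qed.
Lemma l2dotBr f g h : l2dot f (g - h) = l2dot f g - l2dot f h.
Proof. by rewrite l2dotDr l2dotNr. Qed.

Lemma l2dot_suml (I : Type) (s : seq I) (F : I -> H) h :
  l2dot (\sum_(i <- s) F i) h = \sum_(i <- s) l2dot (F i) h.
Proof.
by elim: s => [|i s IH]; rewrite ?big_nil ?l2dot0l // !big_cons l2dotDl IH.
Qed.

Lemma l2dot_sumr (I : Type) (s : seq I) (F : I -> H) h :
  l2dot h (\sum_(i <- s) F i) = \sum_(i <- s) l2dot h (F i).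
Proof.
by elim: s => [|i s IH]; rewrite ?big_nil ?l2dot0r // !big_cons l2dotDr IH.
Qed.

Lemma mulc_conj (z : R[i]) : z * z^*%C = (normc z ^+ 2)%:C%C.
Proof. by rewrite sqnormcE; case: z => a b /=; congr Complex; ring. Qed.

Lemma l2dotff f : l2dot f f = (l2norm f ^+ 2)%:C%C.
Proof.
rewrite /l2dot (_ : (fun x => _) = fun x => (normc (f x) ^+ 2)%:C%C); last first.
  by apply: funext => x; rewrite mulc_conj.
rewrite /csum /= rsum0 rsum_ge0E; last by move=> x; rewrite sqr_ge0.
by congr Complex; rewrite -[LHS]/(fine (sqsum f)) -l2norm_sq.
Qed.

Lemma l2dot_nondeg f : (forall g, l2dot f g = 0) -> f = 0.
Proof. by move=> f0; apply: l2P => x; rewrite -l2dot_delta f0. Qed.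

Lemma l2norm_eq0 f : l2norm f = 0 -> f = 0.
Proof.
move=> f0; apply: l2P => x; apply: eq0_normc; apply/eqP; rewrite eq_le normc_ge0 andbT.
by rewrite (le_trans (l2norm_coord _ _)) // f0.
Qed.

Lemma l2norm0 : l2norm (0 : H) = 0.
Proof. by rewrite /l2norm (_ : sqsum _ = 0%E) ?sqrtr0 //; exact: sqsum0. Qed.

Lemma l2dot_delta_l f x : l2dot (delta R x) f = (f x)^*%C.
Proof. by rewrite l2dotC l2dot_delta. Qed.

Lemma normc_real (r : R) : normc r%:C%C = `|r|.
Proof. by rewrite /= expr0n addr0 sqrtr_sqr. Qed.

Lemma l2normZ c f : l2norm (c *: f) = normc c * l2norm f.
Proof.
apply/eqP; rewrite -(@eqrXn2 _ 2) ?l2norm_ge0 ?mulr_ge0 ?normc_ge0 ?l2norm_ge0 //.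
apply/eqP; apply: complexI; rewrite -l2dotff l2dotZl l2dotZr l2dotff mulrA mulc_conj.
by rewrite exprMn [RHS]rmorphM.
Qed.

Lemma l2normN f : l2norm (- f) = l2norm f.
Proof. by rewrite -scaleN1r l2normZ normcN normc1 mul1r. Qed.

Lemma l2normD_sq f g :
  l2norm (f + g) ^+ 2 = l2norm f ^+ 2 + l2norm g ^+ 2 + 2 * complex.Re (l2dot f g).
Proof.
have := congr1 (@complex.Re R) (l2dotff (f + g)).
rewrite l2dotDl !l2dotDr !l2dotff [l2dot g f]l2dotC.
by case: (l2dot f g) => a b /= <-; ring.
Qed.

Lemma pythagoras f g : l2dot f g = 0 -> l2norm (f + g) ^+ 2 = l2norm f ^+ 2 + l2norm g ^+ 2.
Proof. by move=> fg; rewrite l2normD_sq fg /= mulr0 addr0. Qed.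

Lemma cauchy_schwarz f g : normc (l2dot f g) <= l2norm f * l2norm g.
Proof.
have [g0|gN0] := eqVneq (l2norm g) 0.
  by rewrite (l2norm_eq0 g0) l2dot0r normc0 l2norm0 mulr0.
have gp : 0 < l2norm g by rewrite lt0r gN0 l2norm_ge0.
pose c := l2dot f g / (l2norm g ^+ 2)%:C%C.
have gc : (l2norm g ^+ 2)%:C%C != 0.
  by apply/eqP => /complexI /eqP; rewrite sqrf_eq0 (negPf gN0).
have o : l2dot (f - c *: g) (c *: g) = 0.
  by rewrite l2dotZr l2dotBl l2dotZl l2dotff divfK // subrr mulr0.
have := pythagoras o; rewrite subrK => e.
have : l2norm (c *: g) ^+ 2 <= l2norm f ^+ 2 by rewrite e lerDr sqr_ge0.
rewrite ler_sqr ?nnegrE ?l2norm_ge0 // l2normZ /c normcM normcV normc_real ger0_norm ?sqr_ge0 //.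
by rewrite expr2 invfM mulrA -mulrA mulVf ?mulr1 // ler_pdivrMr.
Qed.

Lemma Re_le_normc (z : R[i]) : complex.Re z <= normc z.
Proof.
case: z => a b /=; apply: le_trans (ler_norm _) _.
by rewrite -sqrtr_sqr ler_wsqrtr // lerDl sqr_ge0.
Qed.

Lemma l2normD f g : l2norm (f + g) <= l2norm f + l2norm g.
Proof.
rewrite -ler_sqr ?nnegrE ?addr_ge0 ?l2norm_ge0 // l2normD_sq sqrrD.
have := le_trans (Re_le_normc _) (cauchy_schwarz f g).
by rewrite mulr2n; lra.
Qed.

Lemma l2normB f g : l2norm (f - g) <= l2norm f + l2norm g.
Proof. by rewrite -[l2norm g]l2normN l2normD. Qed.

Lemma l2distD h f g : l2norm (f - g) <= l2norm (f - h) + l2norm (h - g).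
Proof. by rewrite -[f - g](subrKA h) l2normD. Qed.

Lemma l2distC f g : l2norm (f - g) = l2norm (g - f).
Proof. by rewrite -l2normN opprB. Qed.

End InnerProduct.

(** * Adjoints and orthonormal families *)

Section Adjoints.
Variables (R : realType).
Implicit Types (X Y : choiceType).

(** [bnd] and [adj] extend [bounded] and [is_adjoint] to maps between different
    Hilbert spaces; the isometry of the main proof is such a map. *)
Definition bnd X Y (T : l2 R X -> l2 R Y) :=
  exists2 M : R, 0 <= M & forall f, l2norm (T f) <= M * l2norm f.

Definition adj X Y (T : l2 R X -> l2 R Y) (T' : l2 R Y -> l2 R X) :=
  forall f g, l2dot (T f) g = l2dot f (T' g).

Lemma adj_sym X Y (T : l2 R X -> l2 R Y) T' : adj T T' -> adj T' T.
Proof. by move=> TT f g; rewrite l2dotC -TT -l2dotC. Qed.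

Lemma l2dot_inj X (f f' : l2 R X) : (forall g, l2dot f g = l2dot f' g) -> f = f'.
Proof.
by move=> ff; apply/eqP; rewrite -subr_eq0; apply/eqP/l2dot_nondeg => g; rewrite l2dotBl ff subrr.
Qed.

Lemma l2dot_injr X (f f' : l2 R X) : (forall g, l2dot g f = l2dot g f') -> f = f'.
Proof. by move=> ff; apply: l2dot_inj => g; rewrite l2dotC ff -l2dotC. Qed.

Lemma adj_linear X Y (T : l2 R X -> l2 R Y) T' : adj T T' -> linear T.
Proof.
by move=> TT c f g; apply: l2dot_inj => h; rewrite TT l2dotDl l2dotZl l2dotDl l2dotZl !TT.
Qed.

(** Infinite square sums are controlled through finite ones, so that the norm
    estimates below only involve finite linear combinations. *)
Lemma fin_sqsum_le Y (a : Y -> R[i]) (M : R) :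
  (forall s : seq Y, uniq s -> \sum_(y <- s) normc (a y) ^+ 2 <= M) -> (sqsum a <= M%:E)%E.
Proof.
move=> HM; apply: ge_ereal_sup => _ [F [finF _] <-].
by rewrite fsbig_finite // sumEFin lee_fin HM.
Qed.

Lemma fin_sqsum_approx X (f : l2 R X) (e : R) : 0 < e ->
  exists2 s : seq X, uniq s & l2norm f ^+ 2 - e < \sum_(x <- s) normc (f x) ^+ 2.
Proof.
move=> e0; have := @ub_ereal_sup_adherent _ _ e e0 (sqsum_fin f).
case=> _ [F [finF _] <-]; rewrite (_ : ereal_sup _ = (l2norm f ^+ 2)%:E); last exact/esym/l2norm_sq.
rewrite fsbig_finite // sumEFin -EFinB lte_fin.
by exists (fset_set F).
Qed.

Definition orthonormal X Y (b : Y -> l2 R X) :=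
  forall y y', l2dot (b y) (b y') = (y == y')%:R.

Lemma orthonormal_delta X : orthonormal (delta R (X := X)).
Proof. by move=> y y'; rewrite l2dot_delta /= eq_sym. Qed.

Lemma bessel_identity X Y (b : Y -> l2 R X) (s : seq Y) f : orthonormal b -> uniq s ->
  l2norm (f - \sum_(y <- s) l2dot f (b y) *: b y) ^+ 2 =
  l2norm f ^+ 2 - \sum_(y <- s) normc (l2dot f (b y)) ^+ 2.
Proof.
move=> ob us; set g := \sum_(y <- s) _.
have gb y : y \in s -> l2dot g (b y) = l2dot f (b y).
  move=> ys; rewrite /g l2dot_suml (bigD1_seq y) //= l2dotZl ob eqxx mulr1 big1 ?addr0 // => i iy.
  by rewrite l2dotZl ob (negPf iy) mulr0.
have fg : l2dot (f - g) g = 0.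
  rewrite {2}/g l2dot_sumr big_seq big1 // => y ys.
  by rewrite l2dotZr l2dotBl gb // subrr mulr0.
have gg : l2norm g ^+ 2 = \sum_(y <- s) normc (l2dot f (b y)) ^+ 2.
  apply: complexI; rewrite -l2dotff {2}/g l2dot_sumr rmorph_sum /=.
  by apply: eq_big_seq => y ys; rewrite l2dotZr gb // mulrC mulc_conj.
by have := pythagoras fg; rewrite subrK => ->; rewrite gg addrK.
Qed.

Lemma bessel X Y (b : Y -> l2 R X) f : orthonormal b ->
  (sqsum (fun y => l2dot f (b y)) <= (l2norm f ^+ 2)%:E)%E.
Proof.
move=> ob; apply: fin_sqsum_le => s us.
by rewrite -subr_ge0 -(bessel_identity f ob us) sqr_ge0.
Qed.

Lemma l2_approx X (f : l2 R X) (e : R) : 0 < e ->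
  exists s : seq X, l2norm (f - \sum_(x <- s) f x *: delta R x) < e.
Proof.
move=> e0; have [s us sf] := fin_sqsum_approx f (exprn_gt0 2 e0); exists s.
rewrite -ltr_sqr ?nnegrE ?l2norm_ge0 ?ltW //.
have := bessel_identity f (@orthonormal_delta X) us.
under eq_bigr => x _ do rewrite l2dot_delta.
under [in RHS]eq_bigr => x _ do rewrite l2dot_delta.
by move=> ->; lra.
Qed.

Lemma eps_eq0 (z : R[i]) (M : R) : (forall e : R, 0 < e -> normc z <= M * e) -> z = 0.
Proof.
move=> He; apply: eq0_normc; apply/eqP; rewrite eq_le normc_ge0 andbT leNgt; apply/negP => z0.
have M0 : 0 < M.
  by have := lt_le_trans z0 (He 1 ltr01); rewrite mulr1.
have := He (normc z / (2 * M)); rewrite divr_gt0 ?mulr_gt0 // => /(_ isT).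
rewrite invfM mulrCA [M * _]mulrCA divff ?gt_eqF // mulr1; lra.
Qed.

Lemma bndB_small X Y (T : l2 R X -> l2 R Y) f : linear T -> bnd T ->
  exists2 M : R, 0 <= M & forall g, l2norm (T f - T g) <= M * l2norm (f - g).
Proof.
move=> lT [M M0 HM]; exists M => // g.
suff -> : T f - T g = T (f - g) by exact: HM.
by rewrite addrC -scaleN1r -lT scaleN1r addrC.
Qed.

Lemma lin_sum X Y (T : l2 R X -> l2 R Y) (I : Type) (s : seq I) (c : I -> R[i]) (F : I -> l2 R X) :
  linear T -> T (\sum_(i <- s) c i *: F i) = \sum_(i <- s) c i *: T (F i).
Proof.
move=> lT; have T0 : T 0 = 0.
  by have := lT (-1) 0 0; rewrite scaler0 addr0 scaleN1r addNr.
by elim: s => [|i s IH]; rewrite ?big_nil // !big_cons lT IH.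
Qed.

(** The adjoint is given by its coordinates [<g, T xi_x>].  They are square
    summable: testing [T] on [h = \sum_(x <- s) <g, T xi_x> xi_x] gives
    [|h|^2 = <g, T h> <= M |g| |h|] for every finite [s].  The adjoint identity
    then holds on finite combinations, and in general by density. *)
Lemma adjoint_exists X Y (T : l2 R X -> l2 R Y) : linear T -> bnd T ->
  exists2 T', adj T T' & bnd T'.
Proof.
move=> lT [M M0 HM].
have key g : (sqsum (fun x => l2dot g (T (delta R x))) <= (M ^+ 2 * l2norm g ^+ 2)%:E)%E.
  apply: fin_sqsum_le => s us; set S := \sum_(x <- s) _.
  pose h := \sum_(x <- s) l2dot g (T (delta R x)) *: delta R x.
  have hx x : x \in s -> l2dot h (delta R x) = l2dot g (T (delta R x)).
    move=> xs; rewrite /h l2dot_suml (bigD1_seq x) //= l2dotZl orthonormal_delta eqxx mulr1.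
    by rewrite big1 ?addr0 // => i ix; rewrite l2dotZl orthonormal_delta (negPf ix) mulr0.
  have hh : l2norm h ^+ 2 = S.
    have E : \sum_(x <- s) l2dot h (delta R x) *: delta R x = h.
      by rewrite {2}/h; apply: eq_big_seq => x xs; rewrite hx.
    have := bessel_identity h (@orthonormal_delta X) us; rewrite E subrr l2norm0 expr2 mulr0.
    by move/esym/eqP; rewrite subr_eq0 => /eqP ->; apply: eq_big_seq => x xs; rewrite hx.
  have gT : l2dot g (T h) = S%:C%C.
    rewrite /h (lin_sum _ _ _ lT) l2dot_sumr /S rmorph_sum /=; apply: eq_bigr => x _.
    by rewrite l2dotZr mulrC mulc_conj.
  have S0 : 0 <= S by rewrite -hh sqr_ge0.
  have : S <= l2norm g * (M * l2norm h).
    rewrite -[S]ger0_norm // -normc_real -gT (le_trans (cauchy_schwarz _ _)) //.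
    by rewrite ler_wpM2l ?l2norm_ge0.
  rewrite -hh expr2 mulrA => H.
  have [->|hN0] := eqVneq (l2norm h) 0; first by rewrite mulr0 mulr_ge0 ?sqr_ge0.
  have hp : 0 < l2norm h by rewrite lt0r hN0 l2norm_ge0.
  move: H; rewrite ler_pM2r // => H.
  by rewrite -expr2 -exprMn ler_sqr ?nnegrE ?mulr_ge0 ?l2norm_ge0 // mulrC.
have sq g : (fun x => l2dot g (T (delta R x))) \in @square_summable R X.
  by apply/asboolP; apply: le_lt_trans (key g) _; rewrite ltry.
pose T' g := L2 (sq g).
have bT' g : l2norm (T' g) <= M * l2norm g.
  rewrite -ler_sqr ?nnegrE ?mulr_ge0 ?l2norm_ge0 // -lee_fin l2norm_sq exprMn; exact: key.
exists T'; last by exists M.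
move=> f g; apply/eqP; rewrite -subr_eq0; apply/eqP.
apply: (@eps_eq0 _ (2 * M * l2norm g)) => e e0.
have [s sf] := l2_approx f e0; set fs := \sum_(x <- s) _ in sf.
have E : l2dot (T fs) g = l2dot fs (T' g).
  rewrite /fs (lin_sum _ _ _ lT) !l2dot_suml; apply: eq_bigr => x _.
  by rewrite !l2dotZl l2dot_delta_l; congr (_ * _); exact: l2dotC.
have -> : l2dot (T f) g - l2dot f (T' g) = l2dot (T (f - fs)) g - l2dot (f - fs) (T' g).
  have -> : T (f - fs) = T f - T fs by rewrite addrC -scaleN1r lT scaleN1r addrC.
  by rewrite !l2dotBl E; ring.
apply: le_trans (le_normcD _ _) _; rewrite normcN.
have N0 := l2norm_ge0 g.
have H1 := le_trans (cauchy_schwarz (T (f - fs)) g) (ler_wpM2r N0 (HM (f - fs))).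
have H2 := le_trans (cauchy_schwarz (f - fs) (T' g)) (ler_wpM2l (l2norm_ge0 _) (bT' g)).
have H3 : M * l2norm g * l2norm (f - fs) <= M * l2norm g * e.
  by apply: ler_wpM2l; [exact: mulr_ge0|exact: ltW].
apply: le_trans (lerD H1 H2) _.
rewrite (_ : _ + _ = 2 * (M * l2norm g * l2norm (f - fs))); last by ring.
by rewrite -!mulrA ler_pM2l ?ltr0n // !mulrA.
Qed.

(** Only adjointness is used, not boundedness: two maps that agree on the basis
    have adjoints with the same coordinates. *)
Lemma adj_eq_delta X Y (T T1 : l2 R X -> l2 R Y) T' T1' : adj T T' -> adj T1 T1' ->
  (forall x, T (delta R x) = T1 (delta R x)) -> T =1 T1.
Proof.
move=> TT TT1 E; have E' : T' =1 T1'.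
  by move=> g; apply: l2P => x; rewrite -!l2dot_delta (adj_sym TT) (adj_sym TT1) E.
by move=> f; apply: l2dot_inj => g; rewrite TT TT1 E'.
Qed.

Section OrthonormalFamily.
Variables (X Y : choiceType) (b : Y -> l2 R X).
Hypothesis ob : orthonormal b.

Lemma coords_summable f : (fun y => l2dot f (b y)) \in @square_summable R Y.
Proof. by apply/asboolP; apply: le_lt_trans (bessel f ob) _; rewrite ltry. Qed.

(** [coords] and its adjoint [synth] are the two halves of every construction
    from an orthonormal family: [synth] is the isometry sending [xi_y] to [b y],
    and [synth \o coords] is the projection onto the closed span. *)
Definition coords f : l2 R Y := L2 (coords_summable f).

Lemma coords_linear : linear coords.
Proof. by move=> c f g; apply: l2P => y; rewrite l2DE l2ZE /= l2dotDl l2dotZl. Qed.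

Lemma coords_le f : l2norm (coords f) <= l2norm f.
Proof.
by rewrite -ler_sqr ?nnegrE ?l2norm_ge0 // -lee_fin l2norm_sq; exact: bessel.
Qed.

Lemma coords_bnd : bnd coords.
Proof. by exists 1 => // f; rewrite mul1r coords_le. Qed.

Lemma synth_subproof : exists S, adj coords S /\ bnd S.
Proof. by have [S ? ?] := adjoint_exists coords_linear coords_bnd; exists S. Qed.

Definition synth : l2 R Y -> l2 R X := projT1 (cid synth_subproof).

Lemma coords_synth_adj : adj coords synth.
Proof. by rewrite /synth; case: cid => S []. Qed.

Lemma synth_bnd : bnd synth.
Proof. by rewrite /synth; case: cid => S []. Qed.

Lemma synth_linear : linear synth.
Proof. exact: adj_linear (adj_sym coords_synth_adj). Qed.

Lemma synth_delta y : synth (delta R y) = b y.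
Proof.
apply: l2dot_injr => f; rewrite -coords_synth_adj l2dot_delta //.
Qed.

Lemma coordsb y : coords (b y) = delta R y.
Proof. by apply: l2P => y'; rewrite /= ob eq_sym. Qed.

Lemma synthK : cancel synth coords.
Proof.
by move=> g; apply: l2P => y; rewrite /= (adj_sym coords_synth_adj) coordsb l2dot_delta.
Qed.

End OrthonormalFamily.

End Adjoints.

Section OperatorBasics.
Variables (R : realType) (X : choiceType).
Local Notation H := (l2 R X).
Implicit Types (S T : bop R X).

Lemma bop_bnd T : bnd T.
Proof.
have [M HM] := bop_bounded T; exists `|M| => // f.
by apply: le_trans (HM f) _; rewrite ler_wpM2r ?l2norm_ge0 // ler_norm.
Qed.

Lemma mk_bop (T : H -> H) : linear T -> bnd T -> {B : bop R X | B =1 T}.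
Proof.
move=> lT bT; have P : T \in @bounded_linear R X.
  by apply/asboolP; split => //; case: bT => M _ HM; exists M.
by exists (Bop P).
Qed.

Lemma bop_adjoint T : exists T' : bop R X, is_adjoint T T'.
Proof.
have [T' TT bT] := adjoint_exists (bop_linear T) (bop_bnd T).
have [B HB] := mk_bop (adj_linear (adj_sym TT)) bT.
by exists B => f g; rewrite TT HB.
Qed.

Lemma bop_eq_delta S T : (forall x, S (delta R x) = T (delta R x)) -> S = T.
Proof.
move=> ST; have [S' SS] := bop_adjoint S; have [T' TT] := bop_adjoint T.
apply: bopP; exact: adj_eq_delta SS TT ST.
Qed.

Lemma bopME S T f : (S * T) f = S (T f). Proof. by []. Qed.
Lemma bopDE S T f : (S + T) f = S f + T f. Proof. by []. Qed.
Lemma bopZE c T f : (c *: T) f = c *: T f. Proof. by []. Qed.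
Lemma bopNE T f : (- T) f = - T f. Proof. by []. Qed.
Lemma bop_1E f : (1 : bop R X) f = f. Proof. by []. Qed.

Lemma commE S T : S * T = T * S -> forall f, S (T f) = T (S f).
Proof. by move=> e f; rewrite -!bopME e. Qed.

Lemma is_adjoint_sym S T : is_adjoint S T -> is_adjoint T S.
Proof. exact: adj_sym. Qed.

Lemma is_adjointM S S' T T' : is_adjoint S S' -> is_adjoint T T' -> is_adjoint (S * T) (T' * S').
Proof. by move=> SS TT f g; rewrite !bopME SS TT. Qed.

Lemma is_adjointD S S' T T' : is_adjoint S S' -> is_adjoint T T' -> is_adjoint (S + T) (S' + T').
Proof. by move=> SS TT f g; rewrite !bopDE l2dotDl l2dotDr SS TT. Qed.

Lemma is_adjointZ c S S' : is_adjoint S S' -> is_adjoint (c *: S) (c^*%C *: S').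
Proof. by move=> SS f g; rewrite !bopZE l2dotZl l2dotZr conjcK SS. Qed.

Lemma is_adjoint_inj S T T' : is_adjoint S T -> is_adjoint S T' -> T = T'.
Proof. by move=> ST ST'; apply: bopP => f; apply: l2dot_injr => g; rewrite -ST -ST'. Qed.

End OperatorBasics.

(** * Amplification of an operator *)

(** The injective family [em y x] cuts [l^2(Z)] into one copy of [l^2(X)] for each
    [y], and a remainder supported off the range of [em].  [slice y] and [embed y]
    are the coordinate maps of the copy of index [y]. *)
Section Amplification.
Variables (R : realType) (X Y Z : choiceType) (em : Y -> X -> Z).
Hypothesis em_inj : forall y x y' x', em y x = em y' x' -> y = y' /\ x = x'.
Implicit Types (T S : bop R X) (f : l2 R Z) (g : l2 R X).

Lemma orthonormal_em y : orthonormal (fun x => delta R (em y x)).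
Proof.
move=> x x'; rewrite orthonormal_delta (_ : (em y x == em y x') = (x == x')) //.
by apply/eqP/eqP => [/em_inj[_ ->]|->].
Qed.

Definition slice y : l2 R Z -> l2 R X := coords (@orthonormal_em y).
Definition embed y : l2 R X -> l2 R Z := synth (@orthonormal_em y).

Lemma sliceE y f x : slice y f x = f (em y x).
Proof. exact: l2dot_delta. Qed.

Lemma slice_embed_adj y : adj (slice y) (embed y).
Proof. exact: coords_synth_adj. Qed.

Lemma embed_delta y x : embed y (delta R x) = delta R (em y x).
Proof. exact: synth_delta. Qed.

Lemma embedE y g y' x : embed y g (em y' x) = if y' == y then g x else 0.
Proof.
rewrite -l2dot_delta (adj_sym (slice_embed_adj y)).
rewrite (_ : slice y _ = (y' == y)%:R *: delta R x).
  by case: eqP => _; rewrite l2dotZr ?conjc1 ?conjc0 ?mul1r ?mul0r ?l2dot_delta.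
apply: l2P => x'; rewrite sliceE l2ZE /=; case: eqP => [/em_inj[<- <-]|n].
  by rewrite !eqxx mulr1.
case: eqP => [e|_]; last by rewrite mul0r.
by rewrite mul1r; case: eqP => // e'; case: n; rewrite e e'.
Qed.

Lemma embed_off y g z : (forall y x, em y x <> z) -> embed y g z = 0.
Proof.
move=> zoff; rewrite -l2dot_delta (adj_sym (slice_embed_adj y)).
rewrite (_ : slice y _ = 0) ?l2dot0r //; apply: l2P => x.
by rewrite sliceE /=; case: eqP => // /zoff.
Qed.

Lemma slice_embed y y' g : slice y (embed y' g) = if y == y' then g else 0.
Proof. by apply: l2P => x; rewrite sliceE embedE; case: eqP. Qed.

(** The inverse of [em]; it lets functions on [Z] be defined by cases on whether
    a point is in the range of [em]. *)
Definition em_inv (z : Z) : option (Y * X) :=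
  if pselect (exists p : Y * X, em p.1 p.2 = z) is left P then Some (projT1 (cid P)) else None.

Lemma em_invK y x : em_inv (em y x) = Some (y, x).
Proof.
rewrite /em_inv; case: pselect => [P|[]]; last by exists (y, x).
by case: cid => -[y' x'] /= /em_inj[-> ->].
Qed.

Lemma em_invP z : (exists y x, z = em y x) \/ (em_inv z = None /\ forall y x, em y x <> z).
Proof.
case: (pselect (exists p : Y * X, em p.1 p.2 = z)) => [[[y x] <-]|n]; first by left; exists y, x.
right; split=> [|y x e]; last by apply: n; exists (y, x).
by rewrite /em_inv; case: pselect.
Qed.

Lemma esum_em (a : Z -> \bar R) : (forall z, 0 <= a z)%E ->
  \esum_(y in [set: Y]) \esum_(x in [set: X]) a (em y x) =
  \esum_(z in [set: Z]) (if em_inv z then a z else 0%E).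
Proof.
move=> a0; rewrite esum_esum //.
pose e (p : Y * X) := em p.1 p.2.
rewrite -(@esum_image _ _ _ _ e a); last first.
  by move=> [y x] [y' x'] _ _ /em_inj /= [-> ->].
rewrite esum_mkcond; apply: eq_esum => z _.
case: (em_invP z) => [[y [x ->]]|[-> n]].
  by rewrite em_invK mem_set //; exists (y, x).
by rewrite memNset // => -[[y x] _ /n].
Qed.

Lemma sqsum_slices f :
  (\esum_(y in [set: Y]) sqsum (slice y f) <= sqsum f)%E.
Proof.
rewrite /sqsum.
under eq_esum => y _ do under eq_esum => x _ do rewrite sliceE.
rewrite (@esum_em (fun z => (normc (f z) ^+ 2)%:E)); last by move=> z; rewrite lee_fin sqr_ge0.
by apply: le_esum => z _; case: em_inv => [p|] //=; rewrite lee_fin sqr_ge0.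
Qed.

Definition amp_fun T f z := if em_inv z is Some (y, x) then T (slice y f) x else 0.

Lemma sqsum_amp T : exists2 M : R, 0 <= M &
  forall f, (sqsum (amp_fun T f) <= (M ^+ 2)%:E * sqsum f)%E.
Proof.
have [M M0 HM] := bop_bnd T; exists M => // f.
have -> : sqsum (amp_fun T f) = \esum_(y in [set: Y]) sqsum (T (slice y f)).
  rewrite /sqsum.
  rewrite (eq_esum (b := fun z => if em_inv z then (normc (amp_fun T f z) ^+ 2)%:E else 0%E)).
    rewrite -esum_em; last by move=> z; rewrite lee_fin sqr_ge0.
    by apply: eq_esum => y _; apply: eq_esum => x _; rewrite /amp_fun em_invK.
  by move=> z _; rewrite /amp_fun; case: em_inv => [[y x]|] //; rewrite normc0 expr0n.
apply: (@le_trans _ _ (\esum_(y in [set: Y]) (M ^+ 2 * l2norm (slice y f) ^+ 2)%:E)).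
  apply: le_esum => y _; rewrite -l2norm_sq lee_fin -exprMn ler_sqr ?nnegrE ?l2norm_ge0 //.
  by rewrite mulr_ge0 ?l2norm_ge0.
apply: le_trans (esumZ (sqr_ge0 _) (fun y => sqr_ge0 _)) _.
apply: lee_wpmul2l; first by rewrite lee_fin sqr_ge0.
apply: le_trans (sqsum_slices f); apply: le_esum => y _; by rewrite -l2norm_sq lexx.
Qed.

Lemma amp_summable T f : amp_fun T f \in @square_summable R Z.
Proof.
have [M M0 HM] := sqsum_amp T; apply/asboolP; apply: le_lt_trans (HM f) _.
by rewrite -l2norm_sq -EFinM ltry.
Qed.

Lemma amp_exists T : exists A : bop R Z, forall f, A f =1 amp_fun T f.
Proof.
have l : linear (fun f => L2 (amp_summable T f)).
  move=> c f g; apply: l2P => z; rewrite l2DE l2ZE /= /amp_fun.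
  case: em_inv => [[y x]|]; last by rewrite mulr0 addr0.
  by rewrite /slice coords_linear linearP.
have b : bnd (fun f => L2 (amp_summable T f)).
  have [M M0 HM] := sqsum_amp T; exists M => // f.
  rewrite -ler_sqr ?nnegrE ?mulr_ge0 ?l2norm_ge0 // exprMn -lee_fin.
  by rewrite (EFinM (M ^+ 2)) (l2norm_sq f) (l2norm_sq (L2 _)) HM.
by have [A HA] := mk_bop l b; exists A => f z; rewrite HA.
Qed.

(** [T] on every slice and 0 on the remainder. In particular [amp 1] is the
    projection onto the span of the range of [em], not the identity. *)
Definition amp T : bop R Z := projT1 (cid (amp_exists T)).

Lemma ampE T f y x : amp T f (em y x) = T (slice y f) x.
Proof. by rewrite /amp; case: cid => A /= ->; rewrite /amp_fun em_invK. Qed.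

Lemma amp_off T f z : (forall y x, em y x <> z) -> amp T f z = 0.
Proof.
move=> n; rewrite /amp; case: cid => A /= ->; rewrite /amp_fun.
by case: (em_invP z) => [[y [x e]]|[-> //]]; case: (n y x).
Qed.

Lemma l2_em_eq f f' : (forall y, slice y f = slice y f') ->
  (forall z, (forall y x, em y x <> z) -> f z = f' z) -> f = f'.
Proof.
move=> e e'; apply: l2P => z; case: (em_invP z) => [[y [x ->]]|[_ n]]; last exact: e'.
by rewrite -!sliceE e.
Qed.

Lemma slice_amp T y f : slice y (amp T f) = T (slice y f).
Proof. by apply: l2P => x; rewrite sliceE ampE. Qed.

Lemma bop0 (W : choiceType) (T : bop R W) : T 0 = 0.
Proof. exact: linear0. Qed.

Lemma amp_embed T y g : amp T (embed y g) = embed y (T g).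
Proof.
apply: l2_em_eq => [y'|z n]; last by rewrite amp_off // embed_off.
by rewrite slice_amp !slice_embed; case: eqP => // _; rewrite bop0.
Qed.

Lemma ampM S T : amp (S * T) = amp S * amp T.
Proof.
apply: bopP => f; apply: l2_em_eq => [y|z n]; first by rewrite bopME !slice_amp.
by rewrite bopME !amp_off.
Qed.

Lemma ampZ c T : amp (c *: T) = c *: amp T.
Proof.
apply: bopP => f; apply: l2_em_eq => [y|z n].
  by apply: l2P => x; rewrite sliceE ampE bopZE sliceE !bopZE !l2ZE ampE.
by rewrite bopZE l2ZE !amp_off ?mulr0.
Qed.

Lemma ampD S T : amp (S + T) = amp S + amp T.
Proof.
apply: bopP => f; apply: l2_em_eq => [y|z n].
  by apply: l2P => x; rewrite sliceE ampE bopDE sliceE !bopDE !l2DE !ampE.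
by rewrite bopDE l2DE !amp_off ?addr0.
Qed.

Lemma delta_off z : (forall y x, em y x <> z) -> forall T, amp T (delta R z) = 0.
Proof.
move=> n T; apply: l2_em_eq => [y|z' n']; last by rewrite amp_off.
rewrite slice_amp (_ : slice y _ = 0) ?bop0; apply: l2P => x; rewrite !sliceE //=.
by case: eqP => // /n.
Qed.

Lemma is_adjoint_amp S T : is_adjoint S T -> is_adjoint (amp S) (amp T).
Proof.
move=> ST; have [A HA] := bop_adjoint (amp S).
suff -> : amp T = A by [].
apply: bopP => f; apply: l2_em_eq => [y|z n].
  rewrite slice_amp; apply: l2dot_injr => g.
  by rewrite -ST -[in RHS](adj_sym (slice_embed_adj y)) -HA amp_embed (adj_sym (slice_embed_adj y)).
by rewrite amp_off // -l2dot_delta l2dotC -HA delta_off // l2dot0l conjc0.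
Qed.

Section Blocks.
Variable S : bop R Z.

Lemma block_exists y y' : exists B : bop R X, forall g, B g = slice y (S (embed y' g)).
Proof.
have l : linear (fun g => slice y (S (embed y' g))).
  by move=> c f g; rewrite /embed synth_linear linearP /slice coords_linear.
have b : bnd (fun g => slice y (S (embed y' g))).
  have [M M0 HM] := bop_bnd S.
  have [K K0 HK] := synth_bnd (orthonormal_em y').
  exists (M * K) => [|g]; first exact: mulr_ge0.
  apply: le_trans (coords_le _ _) _; apply: le_trans (HM _) _.
  by rewrite -mulrA; apply: ler_wpM2l => //; exact: HK.
by have [B HB] := mk_bop l b; exists B => g; rewrite HB.
Qed.

Definition block y y' : bop R X := projT1 (cid (block_exists y y')).

Lemma blockE y y' g : block y y' g = slice y (S (embed y' g)).
Proof. by rewrite /block; case: cid. Qed.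

Lemma block_comm T y y' : S * amp T = amp T * S -> block y y' * T = T * block y y'.
Proof.
move=> ST; apply: bopP => g; rewrite !bopME !blockE -amp_embed (commE ST) slice_amp //.
Qed.

(** An operator that respects the remainder commutes with [amp T] as soon as each
    of its matrix blocks commutes with [T]. *)
Lemma comm_block T : S * amp 1 = amp 1 * S ->
  (forall y y', block y y' * T = T * block y y') -> S * amp T = amp T * S.
Proof.
move=> S1 ST; have T1 : amp T = amp 1 * amp T by rewrite -ampM mul1r.
have T1' : amp T = amp T * amp 1 by rewrite -ampM mulr1.
apply: bop_eq_delta => z; rewrite !bopME.
case: (em_invP z) => [[y' [x ->]]|[_ n]]; last first.
  by rewrite delta_off // bop0 T1' bopME -(commE S1) delta_off // !bop0.
apply: l2_em_eq => [y|z' n]; last first.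
  by rewrite amp_off // T1 bopME (commE S1) amp_off.
rewrite -embed_delta amp_embed slice_amp -!blockE.
by have := ST y y' => /(commE (S := _)) ->.
Qed.

End Blocks.

(** If [T'] is in the bicommutant of [T], then [amp T'] is in that of [amp T] and
    [amp 1]. *)
Lemma amp_bicomm T T' (S : bop R Z) : (forall B : bop R X, B * T = T * B -> B * T' = T' * B) ->
  S * amp 1 = amp 1 * S -> S * amp T = amp T * S -> S * amp T' = amp T' * S.
Proof.
by move=> TT S1 ST; apply: comm_block => // y y'; apply: TT; exact: block_comm.
Qed.

End Amplification.

(** * Orthogonal projections *)

Section ClosedSubspaces.
Variables (R : realType) (X : choiceType).
Local Notation H := (l2 R X).
Implicit Types (C : set H) (f g h : H).

Definition subspace C := [/\ C 0, forall f g, C f -> C g -> C (f + g) &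
  forall (c : R[i]) f, C f -> C (c *: f)].

Definition cl C : set H :=
  [set f | forall e : R, 0 < e -> exists2 g, C g & l2norm (f - g) < e].

Lemma sub_cl C f : C f -> cl C f.
Proof. by move=> Cf e e0; exists f; rewrite // subrr l2norm0. Qed.

Lemma subspace_cl C : subspace C -> subspace (cl C).
Proof.
move=> [C0 CD CZ]; split; first exact: sub_cl.
  move=> f g Cf Cg e e0.
  have [f' Cf' ff] := Cf (e / 2) (divr_gt0 e0 (ltr0Sn _ 1)).
  have [g' Cg' gg] := Cg (e / 2) (divr_gt0 e0 (ltr0Sn _ 1)).
  exists (f' + g'); first exact: CD.
  rewrite opprD addrACA; apply: le_lt_trans (l2normD _ _) _; lra.
move=> c f Cf e e0.
have [|f' Cf' ff] := Cf (e / (normc c + 1)).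
  by rewrite divr_gt0 // ltr_wpDl ?normc_ge0.
exists (c *: f'); first exact: CZ.
rewrite -scalerBr l2normZ; apply: le_lt_trans (_ : (normc c + 1) * l2norm (f - f') < e).
  by rewrite ler_wpM2r ?l2norm_ge0 // lerDl.
by rewrite mulrC -ltr_pdivlMr // ltr_wpDl ?normc_ge0.
Qed.

Lemma subspace_sum C (I : Type) (s : seq I) (c : I -> R[i]) (F : I -> H) :
  subspace C -> (forall i, C (F i)) -> C (\sum_(i <- s) c i *: F i).
Proof.
move=> [C0 CD CZ] CF; elim: s => [|i s IH]; first by rewrite big_nil.
by rewrite big_cons; apply: CD => //; apply: CZ.
Qed.

Lemma subspaceB C f g : subspace C -> C f -> C g -> C (f - g).
Proof. by move=> [_ CD CZ] Cf Cg; rewrite -scaleN1r; apply: (CD _ _ Cf); exact: CZ. Qed.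

Lemma cl_cl C f : cl (cl C) f -> cl C f.
Proof.
move=> Cf e e0.
have [g Cg fg] := Cf (e / 2) (divr_gt0 e0 (ltr0Sn _ 1)).
have [h Ch gh] := Cg (e / 2) (divr_gt0 e0 (ltr0Sn _ 1)).
by exists h => //; apply: le_lt_trans (l2distD g _ _) _; lra.
Qed.

End ClosedSubspaces.

Section ClosedSubspaces2.
Variables (R : realType) (X Y : choiceType).

Lemma bnd_cl (C : set (l2 R X)) (D : set (l2 R Y)) (T : l2 R X -> l2 R Y) :
  linear T -> bnd T -> (forall f, C f -> cl D (T f)) -> forall f, cl C f -> cl D (T f).
Proof.
move=> lT bT CD f Cf; apply: cl_cl => e e0.
have [M M0 HM] := bndB_small f lT bT.
have [|g Cg fg] := Cf (e / (M + 1)); first by rewrite divr_gt0 // ltr_wpDl.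
exists (T g); first exact: CD.
apply: le_lt_trans (HM g) _; apply: le_lt_trans (_ : (M + 1) * l2norm (f - g) < e).
  by rewrite ler_wpM2r ?l2norm_ge0 // lerDl.
by rewrite mulrC -ltr_pdivlMr // ltr_wpDl.
Qed.

Lemma cl_delta (D : set (l2 R Y)) (T : l2 R X -> l2 R Y) : subspace D ->
  linear T -> bnd T -> (forall x, cl D (T (delta R x))) -> forall f, cl D (T f).
Proof.
move=> sD lT bT Dd f.
pose C : set (l2 R X) := [set g | cl D (T g)].
apply: (@bnd_cl C D T) => // e e0.
have [s sf] := l2_approx f e0; eexists; last exact: sf.
rewrite /C [X in X _](_ : _ = (fun g => cl D (T g))) // (lin_sum _ _ _ lT).
by apply: (subspace_sum _ _ (subspace_cl sD)); exact: Dd.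
Qed.

End ClosedSubspaces2.

Section Projections.
Variables (R : realType) (X : choiceType).
Local Notation H := (l2 R X).
Implicit Types (C : set H) (f g h : H).

Let orthoset C := forall f g, C f -> C g -> l2dot f g = (f == g)%:R.

(** Zorn's lemma.  The set [C] is arbitrary, so the maximality of [E] is stated
    with a vector that may leave [C] when it is normalised; for a subspace this
    leaves only [f = 0]. *)
Lemma max_orthoset C : exists E : set H, [/\ E `<=` C, orthoset E &
  forall f, C f -> (forall g, E g -> l2dot f g = 0) -> f = 0 \/ ~ C ((l2norm f)^-1%:C%C *: f)].
Proof.
have [|E [[EC oE] Emax]] := @Zorn_bigcup H (fun E => E `<=` C /\ orthoset E).
  move=> F FP tF; split=> [f [E FE Ef]|f g [E FE Ef] [E' FE' Eg]].
    by have [EC _] := FP _ FE; exact: EC.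
  have [EE|EE] := tF _ _ FE FE'.
    by have [_ o] := FP _ FE'; apply: o => //; exact: EE.
  by have [_ o] := FP _ FE; apply: o => //; exact: EE.
exists E; split=> // f Cf fE.
have [f0|fN0] := eqVneq (l2norm f) 0; first by left; exact: l2norm_eq0.
right=> Ch; set h := _ *: f in Ch.
have hh : l2dot h h = 1.
  rewrite l2dotff /h l2normZ normc_real ger0_norm ?invr_ge0 ?l2norm_ge0 // mulVf //.
  by rewrite expr1n.
have hE g : E g -> l2dot h g = 0 by move=> Eg; rewrite l2dotZl fE // mulr0.
have nEh : ~ E h by move=> /hE; rewrite hh => /eqP; rewrite oner_eq0.
apply: (Emax (E `|` [set h])).
  split; first by move=> g; left.
  by move=> s; apply: nEh; apply: s; right.
split=> [g [/EC//|->//]|g g' [Eg|->] [Eg'|->]].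
- exact: oE.
- rewrite l2dotC hE // conjc0; case: eqP => // gh; by rewrite gh in Eg.
- rewrite hE //; case: eqP => // gh; by rewrite -gh in Eg'.
- by rewrite eqxx.
Qed.

(** A maximal orthonormal subset of the closure is an orthonormal basis of it,
    because a vector minus its expansion is orthogonal to the subset. *)
Lemma projection_exists C : subspace C -> exists P : bop R X,
  [/\ is_adjoint P P, forall f, cl C (P f) & forall f, cl C f -> P f = f].
Proof.
move=> sC; have sD := subspace_cl sC; set D := cl C in sD *.
have [E [ED oE Emax]] := max_orthoset D.
pose b (y : E) : H := set_val y.
have ob : orthonormal b.
  move=> y y'; rewrite oE; [by rewrite (inj_eq val_inj)|exact: set_valP|exact: set_valP].
pose P0 f := synth ob (coords ob f).
have lP : linear P0 by move=> c f g; rewrite /P0 coords_linear synth_linear.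
have bP : bnd P0.
  have [M M0 HM] := synth_bnd ob; exists M => // f.
  apply: le_trans (HM _) _; rewrite ler_wpM2l //; exact: coords_le.
have [P HP] := mk_bop lP bP.
have aP : is_adjoint P P.
  move=> f g; rewrite !HP /P0 (adj_sym (coords_synth_adj ob)).
  by rewrite -(coords_synth_adj ob).
have PD f : D (P f).
  rewrite HP /P0; apply: (cl_delta sC (synth_linear ob) (synth_bnd ob)) => y.
  by rewrite synth_delta; apply: ED; exact: set_valP.
exists P; split => // f Df.
have [D0 DD DZ] := sD.
have Dh : D (f - P f) by apply: (subspaceB sD Df); exact: PD.
have [|/eqP|] := Emax _ Dh.
- move=> g Eg; have [y ->] : exists y : E, g = b y by exists (SigSub (mem_set Eg)).
  rewrite l2dotBl HP /P0 (adj_sym (coords_synth_adj ob)) coordsb l2dot_delta /= subrr //.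
- by rewrite subr_eq0 => /eqP.
- by case; exact: DZ.
Qed.

(** If [a] and its adjoint both preserve a subspace, then [a] commutes with the
    projection onto the closure: [P a P = a P], [P a' P = a' P], and the adjoint
    of the second identity is [P a P = P a]. *)
Lemma projection_comm C (P a a' : bop R X) : is_adjoint P P ->
  (forall f, cl C (P f)) -> (forall f, cl C f -> P f = f) -> is_adjoint a a' ->
  (forall f, C f -> C (a f)) -> (forall f, C f -> C (a' f)) -> P * a = a * P.
Proof.
move=> PP PC Pid aa aC a'C.
have inv (b : bop R X) : (forall f, C f -> C (b f)) -> forall f, P (b (P f)) = b (P f).
  move=> bC f; apply: Pid; apply: (@bnd_cl _ _ _ C C b (bop_linear b) (bop_bnd b)) => // g Cg.
  by apply: sub_cl; exact: bC.
apply: bopP => f; rewrite !bopME; apply: l2dot_inj => g.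
by rewrite PP aa -(inv _ a'C) -PP -aa -PP (inv _ aC).
Qed.

End Projections.

(** * Commutants and weak closures *)

Section GeneratedAlgebra.
Variables (R : realType) (X : choiceType).
Local Notation B := (bop R X).
Implicit Types (A : set B) (S T e a b c p D : B).

Lemma alg_gen_ind A (P : set B) : A `<=` P -> (forall S T, P S -> P T -> P (S + T)) ->
  (forall S T, P S -> P T -> P (S * T)) -> (forall (c : R[i]) S, P S -> P (c *: S)) ->
  alg_gen A `<=` P.
Proof. by move=> AP PD PM PZ T; apply. Qed.

Lemma sub_alg_gen A : A `<=` alg_gen A.
Proof. by move=> T AT D [AD _]; exact: AD. Qed.

Lemma alg_genD A S T : alg_gen A S -> alg_gen A T -> alg_gen A (S + T).
Proof.
move=> AS AT D HD; have [_ [HA _]] := HD; apply: HA; [exact: AS|exact: AT].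
Qed.

Lemma alg_genM A S T : alg_gen A S -> alg_gen A T -> alg_gen A (S * T).
Proof.
move=> AS AT D HD; have [_ [_ [HA _]]] := HD; apply: HA; [exact: AS|exact: AT].
Qed.

Lemma alg_genZ A (c : R[i]) S : alg_gen A S -> alg_gen A (c *: S).
Proof. by move=> AS D HD; have [_ [_ [_ HA]]] := HD; apply: HA; exact: AS. Qed.

Lemma alg_gen_star A : (forall a, A a -> exists2 a', A a' & is_adjoint a a') ->
  forall S, alg_gen A S -> exists2 S', alg_gen A S' & is_adjoint S S'.
Proof.
move=> As; apply: alg_gen_ind.
- by move=> a Aa; have [a' Aa' aa] := As a Aa; exists a' => //; exact: sub_alg_gen.
- move=> S T [S' AS' SS] [T' AT' TT]; exists (S' + T'); [exact: alg_genD|exact: is_adjointD].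
- move=> S T [S' AS' SS] [T' AT' TT]; exists (T' * S'); [exact: alg_genM|exact: is_adjointM].
- move=> c S [S' AS' SS]; exists (c^*%C *: S'); [exact: alg_genZ|exact: is_adjointZ].
Qed.

Lemma bopMZr S (c : R[i]) T : S * (c *: T) = c *: (S * T).
Proof. by apply: bopP => f; rewrite bopME !bopZE linearZ. Qed.

Lemma bopMZl S (c : R[i]) T : (c *: S) * T = c *: (S * T).
Proof. by apply: bopP => f. Qed.

Lemma alg_gen_comm A S : (forall a, A a -> S * a = a * S) ->
  forall T, alg_gen A T -> S * T = T * S.
Proof.
move=> SA; apply: alg_gen_ind => //.
- by move=> T U ST SU; rewrite mulrDr mulrDl ST SU.
- by move=> T U ST SU; rewrite mulrA ST -mulrA SU mulrA.
- by move=> c T ST; rewrite bopMZr bopMZl ST.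
Qed.

Lemma alg_gen_unitl A e : (forall a, A a -> e * a = a) -> forall T, alg_gen A T -> e * T = T.
Proof.
move=> eA; apply: alg_gen_ind => //.
- by move=> T U eT eU; rewrite mulrDr eT eU.
- by move=> T U eT eU; rewrite mulrA eT.
- by move=> c T eT; rewrite bopMZr eT.
Qed.

Lemma alg_gen_unitr A e : (forall a, A a -> a * e = a) -> forall T, alg_gen A T -> T * e = T.
Proof.
move=> eA; apply: alg_gen_ind => //.
- by move=> T U eT eU; rewrite mulrDl eT eU.
- by move=> T U eT eU; rewrite -mulrA eU.
- by move=> c T eT; rewrite bopMZl eT.
Qed.

(** An equation [P1 S Q1 = P2 S Q2] passes to weak limits, since each matrix
    coefficient of its sides is a matrix coefficient of [S]. *)
Lemma wot_eq A P1 Q1 P2 Q2 : (forall S, A S -> P1 * S * Q1 = P2 * S * Q2) ->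
  forall T, wot_closure A T -> P1 * T * Q1 = P2 * T * Q2.
Proof.
move=> HA T AT; apply: bopP => f; apply: l2dot_inj => g.
have [P1' a1] := bop_adjoint P1; have [P2' a2] := bop_adjoint P2.
apply/eqP; rewrite -subr_eq0; apply/eqP; apply: (@eps_eq0 _ _ 2) => e e0.
have [S AS HS] := AT [:: (Q1 f, P1' g); (Q2 f, P2' g)] e e0.
have E : l2dot ((P1 * S * Q1) f) g = l2dot ((P2 * S * Q2) f) g by rewrite HA.
have h1 : normc (l2dot ((T - S) (Q1 f)) (P1' g)) < e.
  exact: (HS (Q1 f, P1' g) (mem_head _ _)).
have h2 : normc (l2dot ((T - S) (Q2 f)) (P2' g)) < e.
  by apply: (HS (Q2 f, P2' g)); rewrite inE mem_head orbT.
have -> : l2dot ((P1 * T * Q1) f) g - l2dot ((P2 * T * Q2) f) g =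
   l2dot ((T - S) (Q1 f)) (P1' g) - l2dot ((T - S) (Q2 f)) (P2' g).
  rewrite !bopDE !bopNE !l2dotBl -!a1 -!a2.
  by move: E; rewrite !bopME => ->; ring.
apply: le_trans (le_normcD _ _) _; rewrite normcN; lra.
Qed.

Lemma wot_comm A S : (forall a, A a -> S * a = a * S) ->
  forall T, wot_closure (alg_gen A) T -> S * T = T * S.
Proof.
move=> SA T /(@wot_eq _ S 1 1 S); rewrite mulr1 mul1r; apply => U AU.
by rewrite mulr1 mul1r; exact: alg_gen_comm AU.
Qed.

Lemma wot_unitl A e : (forall a, A a -> e * a = a) ->
  forall T, wot_closure (alg_gen A) T -> e * T = T.
Proof.
move=> eA T /(@wot_eq _ e 1 1 1); rewrite !mulr1 mul1r; apply => U AU.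
by rewrite !mulr1 mul1r; exact: alg_gen_unitl AU.
Qed.

Lemma wot_unitr A e : (forall a, A a -> a * e = a) ->
  forall T, wot_closure (alg_gen A) T -> T * e = T.
Proof.
move=> eA T /(@wot_eq _ 1 e 1 1); rewrite !mulr1 !mul1r; apply => U AU.
by rewrite !mulr1 !mul1r; exact: alg_gen_unitr AU.
Qed.

Lemma pair_em_inj (y : nat) (x : X) y' x' : (y, x) = (y', x') -> y = y' /\ x = x'.
Proof. by case. Qed.

(** Von Neumann's double commutant theorem for a *-closed set whose unit [e] may
    differ from the identity operator.  To approximate [T] at finitely many
    vectors [x_j], let [A] act diagonally on the direct sum of copies of the
    space and take [xi] with components [e x_j].  The projection onto the closure
    of the orbit of [xi] commutes with the diagonal action of [A]; its blocks
    thus commute with [A], hence with [T].  So [T xi] lies in the closure of the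
    orbit.  The hypothesis [T * e = T] lets [T] be evaluated at [x_j] rather than
    at [e x_j]. *)
Lemma bicommutant A e : A e -> (forall a, A a -> e * a = a /\ a * e = a) ->
  (forall a, A a -> exists2 a', A a' & is_adjoint a a') ->
  forall T, T * e = T -> (forall S, (forall a, A a -> S * a = a * S) -> S * T = T * S) ->
  wot_closure (alg_gen A) T.
Proof.
move=> Ae eA As T Te TA s eps eps0.
pose v j : l2 R X := e (nth (0, 0) s j).1.
pose E := embed (R:=R) pair_em_inj. pose F := slice (R:=R) pair_em_inj.
pose am (S : B) := amp pair_em_inj S.
pose xi := \sum_(j <- iota 0 (size s)) (1 : R[i]) *: E j (v j).
have FE k j g : F k (E j g) = if k == j then g else 0 := slice_embed pair_em_inj k j g.
have Fxi k : (k < size s)%N -> F k xi = v k.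
  move=> ks; transitivity (\sum_(j <- iota 0 (size s)) (1 : R[i]) *: F k (E j (v j))).
    exact: lin_sum (coords_linear _).
  rewrite (bigD1_seq k) ?iota_uniq ?mem_iota //= FE eqxx scale1r big1 ?addr0 //.
  by move=> i /negPf ik; rewrite FE eq_sym ik scaler0.
have exi : am e xi = xi.
  rewrite {1}/xi (lin_sum _ _ _ (bop_linear _)); apply: eq_bigr => j _.
  by rewrite /am /E amp_embed /v -bopME (eA e Ae).1.
pose M : set (l2 R (nat * X)%type) := [set am S xi | S in alg_gen A].
have sM : subspace M.
  split.
  - by exists (0 *: e); [by apply: alg_genZ; exact: sub_alg_gen|rewrite /am ampZ bopZE scale0r].
  - move=> _ _ [S AS <-] [S' AS' <-]; exists (S + S'); first exact: alg_genD.
    by rewrite /am ampD bopDE.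
  - by move=> c _ [S AS <-]; exists (c *: S); [exact: alg_genZ|rewrite /am ampZ bopZE].
have [P [PP PM Pid]] := projection_exists sM.
have aM a : A a -> forall f, M f -> M (am a f).
  move=> Aa _ [S AS <-]; exists (a * S); first by apply: alg_genM => //; exact: sub_alg_gen.
  by rewrite /am ampM bopME.
have Pa a : A a -> P * am a = am a * P.
  move=> Aa; have [a' Aa' aa] := As a Aa.
  apply: (projection_comm PP PM Pid (a' := am a')); [exact: is_adjoint_amp|exact: aM|exact: aM].
have am1 : am 1 = 1.
  apply: bopP => f; apply: l2P => -[j x].
  by rewrite (ampE pair_em_inj) bop_1E sliceE.
have PT : P * am T = am T * P.
  apply: comm_block; first by rewrite -/(am 1) am1 mulr1 mul1r.
  by move=> y y'; apply: TA => a Aa; apply: block_comm; exact: Pa.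
have Mxi : M xi by exists e => //; exact: sub_alg_gen.
have Txi : cl M (am T xi).
  have -> : am T xi = P (am T xi) by rewrite [RHS](commE PT) Pid //; exact: sub_cl.
  exact: PM.
pose K := 1 + \sum_(p <- s) l2norm p.2.
have K1 : 1 <= K by rewrite lerDl; apply: sumr_ge0 => p _; exact: l2norm_ge0.
have K0 : 0 < K by apply: lt_le_trans K1.
have [_ [S AS <-] HS] := Txi (eps / K) (divr_gt0 eps0 K0).
exists S => // p ps.
have Se : S * e = S by apply: (alg_gen_unitr _ AS) => a /eA[].
pose j := index p s; have js : (j < size s)%N by rewrite index_mem.
have E1 : (T - S) p.1 = F j (am T xi - am S xi).
  have Fam U f : F j (am U f) = U (F j f) := slice_amp pair_em_inj U j f.
  have FB f f' : F j (f - f') = F j f - F j f'.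
    rewrite -scaleN1r addrC -[RHS]addrC -[- F j f']scaleN1r; exact: coords_linear.
  by rewrite FB !Fam Fxi // /v nth_index // -!bopME Te Se.
apply: le_lt_trans (cauchy_schwarz _ _) _; rewrite E1.
apply: le_lt_trans (_ : l2norm (am T xi - am S xi) * K < eps); last by rewrite -ltr_pdivlMr.
apply: ler_pM; rewrite ?l2norm_ge0 //; first exact: coords_le.
apply: le_trans (_ : \sum_(p <- s) l2norm p.2 <= K); last by rewrite lerDr.
by rewrite (big_rem p) //= lerDl; apply: sumr_ge0 => q _; exact: l2norm_ge0.
Qed.

(** A commutative *-closed family with a cyclic vector has a commutative
    commutant. *)
Section AbelianCommutant.
Variables (A : set B) (Om : l2 R X).
Hypothesis A_comm : forall a b, A a -> A b -> a * b = b * a.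
Hypothesis A_star : forall a, A a -> exists2 a', A a' & is_adjoint a a'.
Hypothesis A_cyclic : forall f, cl [set a Om | a in alg_gen A] f.

Let alg_comm a b : alg_gen A a -> alg_gen A b -> a * b = b * a.
Proof.
move=> Aa Ab; apply: alg_gen_comm Ab => b' Ab'.
by apply/esym; apply: alg_gen_comm Aa => a' Aa'; exact: A_comm.
Qed.

(** For [a] in the algebra [<D' Om, a Om> = <a' Om, D Om>], and [a Om] and
    [a' Om] have the same norm because [a] is normal.  Let [a Om] tend to
    [D' Om]. *)
Lemma commutant_adj_le D D' : is_adjoint D D' -> (forall a, A a -> D * a = a * D) ->
  l2norm (D' Om) <= l2norm (D Om).
Proof.
move=> DD DA; set x := l2norm (D' Om); set y := l2norm (D Om).
have [y0 x0] : 0 <= y /\ 0 <= x by split; exact: l2norm_ge0.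
suff H (e : R) : 0 < e -> x ^+ 2 <= x * e + (x + e) * y.
  rewrite leNgt; apply/negP => yx.
  have xy : 0 < x - y by rewrite subr_gt0.
  have := H ((x - y) / 2) (divr_gt0 xy (ltr0Sn _ 1)); nra.
move=> e0; have [_ [a Aa <-] Ha] := A_cyclic (D' Om) e0.
have [a' Aa' aa] := alg_gen_star A_star Aa.
have norm_a : l2norm (a' Om) = l2norm (a Om).
  apply/eqP; rewrite -(@eqrXn2 _ 2) ?l2norm_ge0 //; apply/eqP; apply: complexI.
  by rewrite -!l2dotff (is_adjoint_sym aa) aa -!bopME alg_comm.
have aOm : l2norm (a Om) <= x + e.
  have := l2normD (a Om - D' Om) (D' Om); rewrite subrK l2distC => h.
  by apply: le_trans h _; rewrite addrC lerD2l ltW.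
have E : l2dot (D' Om) (D' Om) = l2dot (D' Om) (D' Om - a Om) + l2dot (a' Om) (D Om).
  have -> : l2dot (a' Om) (D Om) = l2dot (D' Om) (a Om).
    rewrite (is_adjoint_sym aa) -bopME -(alg_gen_comm DA Aa) bopME.
    by rewrite -(is_adjoint_sym DD).
  by rewrite l2dotBr subrK.
have : normc (l2dot (D' Om) (D' Om)) = x ^+ 2.
  by rewrite l2dotff normc_real ger0_norm // sqr_ge0.
rewrite E => <-; apply: le_trans (le_normcD _ _) _; apply: lerD.
  apply: le_trans (cauchy_schwarz _ _) _; rewrite ler_wpM2l ?l2norm_ge0 // ltW //.
apply: le_trans (cauchy_schwarz _ _) _; rewrite ler_wpM2r ?l2norm_ge0 // norm_a //.
Qed.

(** By the previous bound applied to [T - a], if [a Om] tends to [T Om] then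
    [a' Om] tends to [T' Om].  Hence the identity between matrix coefficients
    that holds for [a] in the algebra, where [S] commutes with [a], holds for
    [T]. *)
Lemma abelian_commutant S T : (forall a, A a -> S * a = a * S) ->
  (forall a, A a -> T * a = a * T) -> S * T = T * S.
Proof.
move=> SA TA.
have [S' SS] := bop_adjoint S; have [T' TT] := bop_adjoint T.
have adjA D D' : is_adjoint D D' -> (forall a, A a -> D * a = a * D) ->
    forall a, A a -> D' * a = a * D'.
  move=> DD DA a Aa; have [a' Aa' aa] := A_star Aa.
  apply: (is_adjoint_inj (S := a' * D)).
    by apply: is_adjointM => //; exact: is_adjoint_sym.
  by rewrite -DA //; apply: is_adjointM => //; exact: is_adjoint_sym.
have S'A := adjA _ _ SS SA; have T'A := adjA _ _ TT TA.
(* [S T] and [T S] have the same matrix coefficients on the orbit of [Om]. *)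
have key c : alg_gen A c -> l2dot (c (T Om)) (S' Om) = l2dot (c (S Om)) (T' Om).
  move=> Ac; apply/eqP; rewrite -subr_eq0; apply/eqP.
  have [M M0 HM] := bop_bnd c.
  apply: (@eps_eq0 _ _ (M * l2norm (S' Om) + l2norm (c (S Om)))) => e e0.
  have [_ [p Ap <-] Hp] := A_cyclic (T Om) e0.
  have [p' Ap' pp] := alg_gen_star A_star Ap.
  have E1 : l2dot (c (p Om)) (S' Om) = l2dot (c (S Om)) (p' Om).
    have Ee : S * (c * p) = p * (c * S).
      by rewrite (alg_gen_comm SA (alg_genM Ac Ap)) (alg_comm Ac Ap) mulrA.
    rewrite -(SS (c (p Om)) Om) -(pp (c (S Om)) Om).
    exact: (congr1 (fun b : B => l2dot (b Om) Om) Ee).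
  have E2 : l2norm (T' Om - p' Om) <= e.
    apply: le_trans (_ : l2norm ((T - p) Om) <= e); last by apply: ltW; exact: Hp.
    have -> : T' Om - p' Om = (T' - p') Om by [].
    apply: commutant_adj_le.
      by move=> f g; rewrite !bopDE !bopNE l2dotBl l2dotBr TT pp.
    by move=> a Aa; rewrite mulrBl mulrBr TA // (alg_comm Ap (sub_alg_gen Aa)).
  have -> : l2dot (c (T Om)) (S' Om) - l2dot (c (S Om)) (T' Om) =
      l2dot (c (T Om - p Om)) (S' Om) - l2dot (c (S Om)) (T' Om - p' Om).
    by rewrite linearB l2dotBl l2dotBr E1; ring.
  apply: le_trans (le_normcD _ _) _; rewrite normcN mulrDl; apply: lerD.
    apply: le_trans (cauchy_schwarz _ _) _.
    rewrite mulrAC; apply: ler_wpM2r; first exact: l2norm_ge0.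
    by apply: le_trans (HM _) _; apply: ler_wpM2l => //; exact: ltW.
  by apply: le_trans (cauchy_schwarz _ _) _; apply: ler_wpM2l => //; exact: l2norm_ge0.
apply: bopP => f; apply/eqP; rewrite -subr_eq0; apply/eqP.
pose W := S * T - T * S.
suff W0 a : alg_gen A a -> W (a Om) = 0.
  have /(_ f) : forall g, cl [set 0] (W g).
    move=> g; apply: (@bnd_cl _ _ _ [set a Om | a in alg_gen A] _ _ (bop_linear W) (bop_bnd W)) => //.
    by move=> _ [a Aa <-]; apply: sub_cl; rewrite W0.
  rewrite /W bopDE bopNE => Wf.
  apply: l2norm_eq0; apply/eqP; rewrite eq_le l2norm_ge0 andbT leNgt; apply/negP => h.
  by have [_ -> ] := Wf _ h; rewrite subr0 ltxx.
move=> Aa; apply: l2dot_nondeg => g; apply/eqP.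
have [W' WW] := bop_adjoint W.
suff W0 b : alg_gen A b -> l2dot (W (a Om)) (b Om) = 0.
  apply/eqP; apply: (@eps_eq0 _ _ (l2norm (W (a Om)))) => e e0.
  have [_ [b Ab <-] Hb] := A_cyclic g e0.
  rewrite -[g](subrK (b Om)) l2dotDr W0 // addr0.
  by apply: le_trans (cauchy_schwarz _ _) _; apply: ler_wpM2l; [exact: l2norm_ge0|exact: ltW].
move=> Ab; have [b' Ab' bb] := alg_gen_star A_star Ab.
have K := key _ (alg_genM Ab' Aa); move: K; rewrite -SS -TT.
rewrite /W bopDE bopNE l2dotBl !bopME => K.
apply/eqP; rewrite subr_eq0; apply/eqP.
have move_b f' : l2dot f' (b Om) = l2dot (b' f') Om by rewrite (is_adjoint_sym bb).
rewrite !move_b.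
have ES : b' * (S * (T * a)) = S * ((b' * a) * T).
  by rewrite (alg_gen_comm TA Aa) mulrA -(alg_gen_comm SA Ab') !mulrA.
have ET : b' * (T * (S * a)) = T * ((b' * a) * S).
  by rewrite (alg_gen_comm SA Aa) mulrA -(alg_gen_comm TA Ab') !mulrA.
pose ev (U : B) := l2dot (U Om) Om.
exact: etrans (congr1 ev ES) (etrans K (esym (congr1 ev ET))).
Qed.

End AbelianCommutant.

End GeneratedAlgebra.

(** * Uniform approximation by polynomials *)

Section Bernstein.
Variable R : realType.
Implicit Types (phi psi : nat -> R) (x : R).

(** The Bernstein polynomial [\sum_j phi j 'C(n, j) x^j (1-x)^(n-j)], the
    expectation of [phi] at a sum of [n] independent trials of probability [x].
    Conditioning on one trial gives this recursion and the formulas below by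
    induction. *)
Fixpoint bernstein n phi : {poly R} :=
  if n is n'.+1 then 'X * bernstein n' (phi \o S) + (1 - 'X) * bernstein n' phi
  else (phi 0%N)%:P.

Lemma bernsteinE n phi x : (bernstein n.+1 phi).[x] =
  x * (bernstein n (phi \o S)).[x] + (1 - x) * (bernstein n phi).[x].
Proof. by rewrite /= !hornerE. Qed.

Lemma bernstein0E phi x : (bernstein 0 phi).[x] = phi 0%N.
Proof. by rewrite /= hornerE. Qed.

Lemma bernstein_le n phi psi x : 0 <= x <= 1 -> (forall j, (j <= n)%N -> phi j <= psi j) ->
  (bernstein n phi).[x] <= (bernstein n psi).[x].
Proof.
move=> /andP[x0 x1]; elim: n phi psi => [|n IH] phi psi H.
  by rewrite !bernstein0E H.
rewrite !bernsteinE; apply: lerD; apply: ler_wpM2l; rewrite ?subr_ge0 //; apply: IH => j jn /=.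
  exact: H.
by apply: H; rewrite (leq_trans jn).
Qed.

Lemma bernsteinD n phi psi x : (bernstein n (fun j => phi j + psi j)).[x] =
  (bernstein n phi).[x] + (bernstein n psi).[x].
Proof.
elim: n phi psi => [|n IH] phi psi; first by rewrite !bernstein0E.
by rewrite !bernsteinE (IH (phi \o S) (psi \o S)) IH; ring.
Qed.

Lemma bernsteinZ n c phi x : (bernstein n (fun j => c * phi j)).[x] = c * (bernstein n phi).[x].
Proof.
elim: n phi => [|n IH] phi; first by rewrite !bernstein0E.
by rewrite !bernsteinE (IH (phi \o S)) IH; ring.
Qed.

Lemma bernstein_cst n c x : (bernstein n (fun=> c)).[x] = c.
Proof.
elim: n => [|n IH]; first by rewrite bernstein0E.
by rewrite bernsteinE (_ : (fun=> c) \o S = fun=> c) // IH; ring.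
Qed.

Lemma bernstein2 n a x : (bernstein n (fun j => (j%:R - a) ^+ 2)).[x] =
  n%:R * (x * (1 - x)) + (n%:R * x - a) ^+ 2.
Proof.
elim: n a => [|n IH] a; first by rewrite bernstein0E; ring.
rewrite bernsteinE (_ : _ \o S = fun j => (j%:R - (a - 1)) ^+ 2); last first.
  by apply: funext => j /=; rewrite -natr1; ring.
by rewrite !IH -natr1; ring.
Qed.

Lemma bernstein_variance n x : (0 < n)%N ->
  (bernstein n (fun j => (j%:R / n%:R - x) ^+ 2)).[x] = x * (1 - x) / n%:R.
Proof.
move=> n0; have nN0 : n%:R != 0 :> R by rewrite pnatr_eq0 -lt0n.
rewrite (_ : (fun j => _) = fun j => (n%:R ^- 2) * (j%:R - n%:R * x) ^+ 2).
  by rewrite bernsteinZ bernstein2; field.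
by apply: funext => j; field.
Qed.

End Bernstein.

Section Korovkin.
Variable R : realType.

(** Apply the Bernstein operator, in the second variable, to the pointwise bound
    of [m th - m th'].  The operator is positive and preserves constants, so the
    quadratic term becomes [C] times a variance, at most [C / n].  Since only this
    bound is used, [m] and [c] may be defined on any set [D]. *)
Lemma korovkin (D : set R) (m c : R -> R) (eps : R) : 0 < eps ->
  (forall th, D th -> 0 <= c th <= 1) ->
  (forall x, 0 <= x <= 1 -> exists2 th, D th & c th = x) ->
  (exists2 C, 0 <= C & forall th th', D th -> D th' ->
     `|m th - m th'| <= eps + C * (c th - c th') ^+ 2) ->
  exists p : {poly R}, forall th, D th -> `|m th - p.[c th]| <= 2 * eps.
Proof.
move=> e0 c01 csurj [C C0 HC].
have [n nC] : exists n : nat, C / eps < n.+1%:R.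
  eexists; apply: lt_le_trans (archi_boundP (divr_ge0 C0 (ltW e0))) _.
  by rewrite ler_nat.
pose N := n.+1; have N0 : 0 < N%:R :> R by rewrite ltr0n.
have nodes j : (j <= N)%N -> {th | D th & c th = j%:R / N%:R}.
  move=> jN; apply: cid2; apply: csurj.
  by rewrite divr_ge0 ?ler0n // ler_pdivrMr // mul1r ler_nat.
pose phi j := if pselect (j <= N)%N is left P then m (s2val (nodes j P)) else 0.
have phiP j : (j <= N)%N -> exists th, [/\ D th, c th = j%:R / N%:R & phi j = m th].
  move=> jN; rewrite /phi; case: pselect => // P.
  by case: (nodes j P) => th Dth cth /=; exists th.
exists (bernstein N phi) => th Dth; set x := c th.
have x01 : 0 <= x <= 1 by exact: c01.
have var : C * (x * (1 - x) / N%:R) <= eps.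
  have xx : x * (1 - x) <= 1 by move/andP: x01 => [? ?]; nra.
  have xx0 : 0 <= x * (1 - x) by move/andP: x01 => [? ?]; nra.
  rewrite mulrA ler_pdivrMr //; apply: le_trans (_ : C <= _); first by rewrite ler_piMr.
  by move: nC; rewrite ltr_pdivrMr // mulrC => /ltW.
have B (s : R) : (bernstein N (fun j => s * m th + (eps + C * (j%:R / N%:R - x) ^+ 2))).[x] =
    s * m th + (eps + C * (x * (1 - x) / N%:R)).
  rewrite bernsteinD bernstein_cst bernsteinD bernstein_cst.
  by rewrite (bernsteinZ N C (fun j => (j%:R / N%:R - x) ^+ 2)) bernstein_variance.
rewrite ler_norml; apply/andP; split.
  have : (bernstein N phi).[x] <= (bernstein N (fun j => 1 * m th + (eps + C * (j%:R / N%:R - x) ^+ 2))).[x].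
    apply: bernstein_le => // j jN; have [th' [Dt <- ->]] := phiP j jN.
    have := HC th th' Dth Dt; rewrite -/x -(sqrrN (x - _)) opprB => /ler_normlP[]; lra.
  by rewrite B; lra.
have : (bernstein N (fun j => - phi j)).[x] <=
    (bernstein N (fun j => (-1) * m th + (eps + C * (j%:R / N%:R - x) ^+ 2))).[x].
  apply: bernstein_le => // j jN; have [th' [Dt <- ->]] := phiP j jN.
  have := HC th th' Dth Dt; rewrite -/x -(sqrrN (x - _)) opprB => /ler_normlP[]; lra.
rewrite B (_ : (fun j => - phi j) = fun j => (-1) * phi j); last by apply: funext => j; rewrite mulN1r.
by rewrite bernsteinZ; lra.
Qed.

(** On the compact square the function [(c th - c th')^2 + 2 max(t, 0)], with
    [t = eps - |m th - m th'|], is positive: where the first term vanishes so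
    does [m th - m th'].  Its minimum bounds [(c th - c th')^2] from below
    wherever [|m th - m th'| > eps]. *)
Lemma modulus (a b : R) (m c : R -> R) (eps : R) : 0 < eps -> a <= b ->
  continuous m -> continuous c ->
  (forall th th', a <= th <= b -> a <= th' <= b -> c th = c th' -> m th = m th') ->
  exists2 C, 0 <= C & forall th th', a <= th <= b -> a <= th' <= b ->
     `|m th - m th'| <= eps + C * (c th - c th') ^+ 2.
Proof.
move=> e0 ab cm cc mc.
pose I : set R := `[a, b]%classic; pose K : set (R * R) := I `*` I.
have cK : compact K by apply: compact_setX; exact: segment_compact.
have inI th : a <= th <= b <-> I th by rewrite /I /= in_itv.
have K0 : K !=set0 by exists (a, a); split; rewrite /I /= in_itv /= lexx.
pose t (p : R * R) : R := eps - `|m p.1 - m p.2|.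
pose F (p : R * R) : R := (c p.1 - c p.2) ^+ 2 + (t p + `|t p|).
have c1 (h : R -> R) : continuous h -> continuous (fun p : R * R => h p.1).
  by move=> ch p; apply: continuous_comp; [exact: cvg_fst|exact: ch].
have c2 (h : R -> R) : continuous h -> continuous (fun p : R * R => h p.2).
  by move=> ch p; apply: continuous_comp; [exact: cvg_snd|exact: ch].
have ct : continuous t.
  move=> p; apply: cvgB; first exact: cvg_cst.
  by apply: cvg_norm; apply: cvgB; [exact: c1|exact: c2].
have cF : continuous F.
  move=> p; apply: cvgD.
    rewrite /=; under eq_fun do rewrite expr2.
    by rewrite expr2; apply: cvgM; apply: cvgB; do ?[exact: c1|exact: c2].
  by apply: cvgD; [exact: ct|apply: cvg_norm; exact: ct].
have [|p0 Kp0 Fmin] := compact_EVT_min K0 cK (f := F).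
  exact: continuous_subspaceT.
have t0 p : 0 <= t p + `|t p| by have := ler_norm (- t p); rewrite normrN; lra.
have F0 : 0 < F p0.
  rewrite lt_neqAle eq_sym addr_ge0 ?sqr_ge0 // andbT; apply/negP => /eqP F0.
  move: Kp0; rewrite inE => -[/inI K1 /inI K2].
  have s0 : (c p0.1 - c p0.2) ^+ 2 = 0.
    by apply/eqP; rewrite eq_le sqr_ge0 andbT -F0 lerDl.
  have cE : c p0.1 = c p0.2 by move/eqP: s0; rewrite sqrf_eq0 subr_eq0 => /eqP.
  move: F0; rewrite /F s0 add0r /t (mc _ _ K1 K2 cE) subrr normr0 subr0 ger0_norm ?ltW //.
  by move=> F0; lra.
have [|q Kq Mmax] := compact_EVT_max K0 cK (f := fun p => `|m p.1 - m p.2|).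
  by apply: continuous_subspaceT => p; apply: cvg_norm; apply: cvgB; [exact: c1|exact: c2].
set M := `|m q.1 - m q.2| in Mmax.
have MF : 0 <= M / F p0 by apply: divr_ge0; [exact: normr_ge0|exact: ltW].
exists (M / F p0) => //.
move=> th th' /inI It /inI It'.
have Kp : (th, th') \in K by rewrite inE.
have := Fmin _ Kp; have := Mmax _ Kp; rewrite /F /t /= -/(F p0) => h1 h2.
have [small|big] := lerP `|m th - m th'| eps.
  by rewrite (le_trans small) // lerDl mulr_ge0 ?sqr_ge0.
have h3 : F p0 <= (c th - c th') ^+ 2.
  have e3 : `|eps - `|m th - m th'| | = `|m th - m th'| - eps.
    by rewrite ler0_norm ?opprB // subr_le0 ltW.
  by move: h2; rewrite e3; lra.
apply: le_trans h1 _; apply: le_trans (_ : M / F p0 * F p0 <= _).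
  by rewrite divfK // gt_eqF.
apply: le_trans (_ : M / F p0 * (c th - c th') ^+ 2 <= _).
  by rewrite ler_wpM2l.
by rewrite lerDr ltW.
Qed.

(** Weierstrass' theorem for functions of [th] that factor through [c th]; the
    quotient function need not be constructed. *)
Lemma weierstrass (a b : R) (m c : R -> R) (eps : R) : 0 < eps -> a <= b ->
  continuous m -> continuous c ->
  (forall th, a <= th <= b -> 0 <= c th <= 1) ->
  (forall x, 0 <= x <= 1 -> exists2 th, a <= th <= b & c th = x) ->
  (forall th th', a <= th <= b -> a <= th' <= b -> c th = c th' -> m th = m th') ->
  exists p : {poly R}, forall th, a <= th <= b -> `|m th - p.[c th]| <= eps.
Proof.
move=> e0 ab cm cc c01 cs mc; have e2 : 0 < eps / 2 by rewrite divr_gt0.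
have [p Hp] := @korovkin [set th | a <= th <= b] m c (eps / 2) e2 c01 cs
  (modulus e2 ab cm cc mc).
by exists p => th /Hp; rewrite mulrC divfK.
Qed.

End Korovkin.

(** * The semicircle law *)

Section SemicircleIntegral.
Variable R : realType.
Implicit Types (f g h : R -> R) (x th : R).
Local Notation mu := (@lebesgue_measure R).

Lemma pi_neq0 : pi != 0 :> R. Proof. by rewrite gt_eqF // pi_gt0. Qed.

(** Integration against the semicircle law on [[-2, 2]] in the variable
    [x = 2 cos th]. *)
Definition sc h : R := 2 / pi * (\int[mu]_(th in `[0, pi]) (h th * sin th ^+ 2)).

Lemma scaleR1 (c : R) : c%:A = c.
Proof. by rewrite /GRing.scale /= mulr1. Qed.

Lemma cont_sin2 h : continuous h -> continuous (fun th => h th * sin th ^+ 2).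
Proof.
move=> ch x; apply: cvgM; first exact: ch.
under eq_fun do rewrite expr2.
by rewrite expr2; apply: cvgM; exact: continuous_sin.
Qed.

Lemma integrable_sin2 h : continuous h ->
  mu.-integrable `[0, pi] (EFin \o (fun th => h th * sin th ^+ 2)).
Proof.
move=> ch; apply: continuous_compact_integrable; first exact: segment_compact.
by apply: continuous_subspaceT; exact: cont_sin2.
Qed.

Lemma sc_ext f g : f =1 g -> sc f = sc g.
Proof. by move=> fg; congr sc; exact: funext. Qed.

Lemma scD f g : continuous f -> continuous g -> sc (fun th => f th + g th) = sc f + sc g.
Proof.
move=> cf cg; rewrite /sc -mulrDr; congr (_ * _).
rewrite -RintegralD //; do ?exact: integrable_sin2.
by apply: eq_Rintegral => x _; rewrite mulrDl.
Qed.

Lemma scZ (c : R) f : continuous f -> sc (fun th => c * f th) = c * sc f.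
Proof.
move=> cf; rewrite /sc mulrCA; congr (_ * _).
rewrite -RintegralZl //; last exact: integrable_sin2.
by apply: eq_Rintegral => x _; rewrite mulrA.
Qed.

Lemma sc_le f g : continuous f -> continuous g ->
  (forall th, 0 <= th <= pi -> f th * sin th ^+ 2 <= g th * sin th ^+ 2) -> sc f <= sc g.
Proof.
move=> cf cg fg; rewrite /sc ler_pM2l ?divr_gt0 ?pi_gt0 //.
apply: le_Rintegral => //; do ?exact: integrable_sin2.
Qed.

Lemma sc_le_cst f (K : R) : continuous f ->
  (forall th, 0 <= th <= pi -> f th * sin th ^+ 2 <= K) -> sc f <= 2 * K.
Proof.
move=> cf fK.
have -> : 2 * K = 2 / pi * (\int[mu]_(th in `[0, pi]) K).
  have E : lebesgue_measure (`[0, pi]%classic : set R) = pi%:E.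
    by rewrite lebesgue_measure_itv /= lte_fin pi_gt0 oppr0 adde0.
  rewrite Rintegral_cst // (congr1 fine E) /=.
  by move: (pi : R) pi_neq0 => q q0; field.
rewrite /sc ler_pM2l ?divr_gt0 ?pi_gt0 //; apply: le_Rintegral => //.
  exact: integrable_sin2.
apply: continuous_compact_integrable; first exact: segment_compact.
by apply: continuous_subspaceT => x; exact: cvg_cst.
Qed.

Lemma sc_FTC h F : continuous h -> (forall x, is_derive x 1 F (h x * sin x ^+ 2)) ->
  sc h = 2 / pi * (F pi - F 0).
Proof.
move=> ch dF; rewrite /sc; congr (_ * _).
have cF : continuous F.
  move=> x; apply: differentiable_continuous; apply/derivable1_diffP.
  by have [] := dF x.
rewrite /Rintegral (@continuous_FTC2 _ (fun th => h th * sin th ^+ 2) F) ?pi_gt0 //.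
- by apply: continuous_subspaceT; exact: cont_sin2.
- split=> [x _||]; first by have [] := dF x.
    exact/cvg_at_right_filter/cF.
  exact/cvg_at_left_filter/cF.
- by move=> x _; rewrite derive1E; have [_ ->] := dF x.
Qed.

(** [ang th] is [2 pi] times the mass of [[0, th]] under
    [(2/pi) sin^2 th dth], so [ang] is uniformly distributed on [[0, 2 pi]].
    The trigonometric functions of its integer multiples are thus orthogonal. *)
Definition ang th : R := 2 * th - sin (2 * th).

Lemma cos2 th : cos (2 * th) = 1 - 2 * sin th ^+ 2.
Proof. by rewrite mulr_natl mulr2n cosD -!expr2 cos2sin2; ring. Qed.

Lemma sin2x th : sin (2 * th) = 2 * (sin th * cos th).
Proof. by rewrite mulr_natl mulr2n sinD; ring. Qed.

Lemma is_derive_ang x : is_derive x 1 ang (4 * sin x ^+ 2).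
Proof. by apply: is_derive_eq; rewrite scaleR1 cos2; ring. Qed.

Lemma continuous_ang : continuous ang.
Proof.
move=> x; apply: differentiable_continuous; apply/derivable1_diffP.
by have [] := is_derive_ang x.
Qed.

Lemma sin_2pi : sin (2 * pi) = 0 :> R. Proof. by rewrite mulr_natl sin2pi. Qed.
Lemma cos_2pi : cos (2 * pi) = 1 :> R. Proof. by rewrite mulr_natl cos2pi. Qed.

Lemma ang0 : ang 0 = 0. Proof. by rewrite /ang mulr0 sin0 subrr. Qed.
Lemma angpi : ang pi = 2 * pi.
Proof. by rewrite /ang sin_2pi subr0. Qed.

Lemma ang_sym th : ang (pi - th) = 2 * pi - ang th.
Proof.
by rewrite /ang mulrBr sinB cos_2pi sin_2pi; ring.
Qed.

Lemma cont_cosang (c : R) : continuous (fun th => cos (c * ang th)).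
Proof.
move=> x; apply: continuous_comp; last exact: continuous_cos.
by apply: cvgM; [exact: cvg_cst|exact: continuous_ang].
Qed.

Lemma cont_sinang (c : R) : continuous (fun th => sin (c * ang th)).
Proof.
move=> x; apply: continuous_comp; last exact: continuous_sin.
by apply: cvgM; [exact: cvg_cst|exact: continuous_ang].
Qed.

Lemma cos_int (n : int) : cos (n%:~R * (2 * pi)) = 1 :> R.
Proof.
have H (m : nat) : cos (m%:R * (2 * pi)) = 1 :> R.
  elim: m => [|m IH]; first by rewrite mul0r cos0.
  by rewrite -natr1 mulrDl mul1r cosD cos_2pi sin_2pi IH mulr1 mulr0 subr0.
case: n => m; first exact: H.
by rewrite NegzE rmorphN /= mulNr cosN; exact: H.
Qed.

Lemma sin_int (n : int) : sin (n%:~R * (2 * pi)) = 0 :> R.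
Proof. by apply: cos1sin0; rewrite cos_int normr1. Qed.

Lemma sc_cosang (n : int) : sc (fun th => cos (n%:~R * ang th)) = (n == 0)%:R.
Proof.
have cc := @cont_cosang n%:~R.
case: eqVneq => [->|n0].
  have d x : is_derive x 1 (fun th => ang th / 4) (cos (0%:~R * ang x) * sin x ^+ 2).
    have ? := is_derive_ang x.
    by apply: is_derive_eq; rewrite mul0r cos0 /GRing.scale /=; field.
  rewrite (sc_FTC (@cont_cosang _) d).
  by rewrite ang0 angpi mulr1n; move: (pi : R) pi_neq0 => q q0; field.
have nR : n%:~R != 0 :> R by rewrite intr_eq0.
have d x : is_derive x 1 (fun th => sin (n%:~R * ang th) / (4 * n%:~R))
    (cos (n%:~R * ang x) * sin x ^+ 2).
  have ? := is_derive_ang x.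
  by apply: is_derive_eq; rewrite /GRing.scale /=; field.
rewrite (sc_FTC cc d).
by rewrite ang0 angpi mulr0 sin0 sin_int mul0r subrr mulr0.
Qed.

Lemma sc_sinang (n : int) : sc (fun th => sin (n%:~R * ang th)) = 0.
Proof.
have cc := @cont_sinang n%:~R.
case: (eqVneq n 0) => [->|n0].
  rewrite (@sc_ext _ (fun th => 0 * cos (0 * ang th))); last by move=> th; rewrite !mul0r sin0.
  by rewrite scZ ?mul0r //; exact: cont_cosang.
have nR : n%:~R != 0 :> R by rewrite intr_eq0.
have d x : is_derive x 1 (fun th => - cos (n%:~R * ang th) / (4 * n%:~R))
    (sin (n%:~R * ang x) * sin x ^+ 2).
  have ? := is_derive_ang x.
  by apply: is_derive_eq; rewrite /GRing.scale /=; field.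
rewrite (sc_FTC cc d).
by rewrite ang0 angpi mulr0 cos0 cos_int subrr mulr0.
Qed.

(** The Chebyshev polynomials of the second kind at [cos th], so that
    [sin th * cheb n th = sin ((n+1) th)]; they are the orthogonal polynomials of
    the semicircle law. *)
Fixpoint cheb n th : R :=
  match n with
  | 0 => 1
  | 1 => 2 * cos th
  | (m.+1 as n').+1 => 2 * cos th * cheb n' th - cheb m th
  end.

Lemma chebSS n th : cheb n.+2 th = 2 * cos th * cheb n.+1 th - cheb n th.
Proof. by []. Qed.

Lemma cont_cheb n : continuous (cheb n).
Proof.
suff : continuous (cheb n) /\ continuous (cheb n.+1) by case.
have c2 : continuous (fun th : R => 2 * cos th).
  by move=> x; apply: cvgM; [exact: cvg_cst|exact: continuous_cos].
elim: n => [|n [IH1 IH2]]; first by split=> [x|//]; exact: cvg_cst.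
split=> // x; apply: cvgB; last exact: IH1.
by apply: cvgM; [exact: c2|exact: IH2].
Qed.

Lemma sin_cheb n th : sin th * cheb n th = sin (n.+1%:R * th).
Proof.
suff : sin th * cheb n th = sin (n.+1%:R * th) /\
  sin th * cheb n.+1 th = sin (n.+2%:R * th) by case.
elim: n => [|n [IH1 IH2]].
  by rewrite /= mulr1 mul1r sin2x; split=> //; ring.
split=> //; rewrite chebSS mulrBr mulrCA IH1 IH2.
have -> : n.+3%:R * th = n.+2%:R * th + th by rewrite -[n.+3%:R]natr1; ring.
have -> : n.+1%:R * th = n.+2%:R * th - th by rewrite -[n.+2%:R]natr1; ring.
by rewrite sinB sinD; ring.
Qed.

Lemma sin_pi (n : nat) : sin (n%:R * pi) = 0 :> R.
Proof.
elim: n => [|n IH]; first by rewrite mul0r sin0.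
by rewrite -natr1 mulrDl mul1r sinDpi IH oppr0.
Qed.

Lemma sc_cheb j k : sc (fun th => cheb j th * cheb k th) = (j == k)%:R.
Proof.
have ccc : continuous (fun th => cheb j th * cheb k th).
  by move=> x; apply: cvgM; exact: cont_cheb.
have E x : cheb j x * cheb k x * sin x ^+ 2 = sin (j.+1%:R * x) * sin (k.+1%:R * x).
  by rewrite -!sin_cheb; ring.
pose d : R := j%:R - k%:R; pose s : R := j%:R + k%:R + 2.
have dE x : d * x = j.+1%:R * x - k.+1%:R * x by rewrite /d -!natr1; ring.
have sE x : s * x = j.+1%:R * x + k.+1%:R * x by rewrite /s -!natr1; ring.
have s0 : s != 0 by rewrite gt_eqF // /s ltr_wpDl // addr_ge0.
have spi : sin (s * pi) = 0.
  by rewrite (_ : s = (j + k + 2)%N%:R) ?sin_pi // /s !natrD.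
case: eqVneq => [jk|jk].
  have dF x : is_derive x 1 (fun x => x / 2 - sin (s * x) / (2 * s))
      (cheb j x * cheb k x * sin x ^+ 2).
    have C : cos (s * x) = 1 - 2 * sin (k.+1%:R * x) ^+ 2.
      by rewrite -cos2; congr cos; rewrite sE jk; ring.
    by apply: is_derive_eq; rewrite E jk C /GRing.scale /=; field.
  rewrite (sc_FTC ccc dF).
  by rewrite spi mulr0 sin0 mulr1n !mul0r !subr0; move: (pi : R) pi_neq0 => q q0; field.
have d0 : d != 0 by rewrite /d subr_eq0 eqr_nat.
have dpi : sin (d * pi) = 0.
  rewrite /d; have [kj|jk'] := leqP k j.
    by rewrite -natrB // sin_pi.
  by rewrite -opprB mulNr sinN -natrB ?(ltnW jk') // sin_pi oppr0.
have dF x : is_derive x 1 (fun x => sin (d * x) / (2 * d) - sin (s * x) / (2 * s))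
    (cheb j x * cheb k x * sin x ^+ 2).
  apply: is_derive_eq; rewrite E dE sE cosB cosD /GRing.scale /=.
  by field; rewrite s0 d0.
rewrite (sc_FTC ccc dF).
by rewrite spi dpi !mulr0 sin0 !mul0r subrr mulr0.
Qed.

End SemicircleIntegral.

(** * The uniformly distributed angle *)

Section AngleApproximation.
Variable R : realType.
Implicit Types (th : R).

Lemma ang_lt th th' : 0 <= th <= pi -> 0 <= th' <= pi -> th < th' -> ang th < ang th'.
Proof.
move=> h h' hh.
have D (x : R) := is_derive_ang x.
have dA x : derivable (@ang R) x 1 by have [] := D x.
have dA0 x : x \in `]0, pi[%R -> 0 < ((@ang R)^`())%classic x.
  rewrite in_itv /= => x0; rewrite derive1E; have [_ ->] := D x.
  by rewrite mulr_gt0 ?ltr0n // exprn_gt0 // sin_gt0_pi.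
apply: (gtr0_derive1_lt_cc (fun x _ => dA x) dA0); rewrite ?in_itv //.
by apply: continuous_subspaceT; exact: continuous_ang.
Qed.

Lemma ang_inj th th' : 0 <= th <= pi -> 0 <= th' <= pi -> ang th = ang th' -> th = th'.
Proof.
move=> h h' e; case: (ltgtP th th') => // hh.
  by have := ang_lt h h' hh; rewrite e ltxx.
by have := ang_lt h' h hh; rewrite e ltxx.
Qed.

Lemma ang_bounds th : 0 <= th <= pi -> 0 <= ang th <= 2 * pi.
Proof.
have p0 := @pi_ge0 R.
move=> h; rewrite -angpi -[X in X <= _](ang0 R); case/andP: (h) => h0 h1; apply/andP; split.
  move: h0; rewrite le_eqVlt => /predU1P[->//|h0]; apply/ltW/ang_lt => //; by rewrite lexx.
move: h1; rewrite le_eqVlt => /predU1P[->//|h1]; apply/ltW/ang_lt => //; by rewrite lexx andbT.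
Qed.

Lemma pi_subr_bounds th : 0 <= th <= pi -> 0 <= pi - th <= pi.
Proof. by move=> /andP[h0 h1]; rewrite subr_ge0 h1 /= lerBlDr lerDl. Qed.

Lemma cos_eq_2pi (x y : R) : 0 <= x <= 2 * pi -> 0 <= y <= 2 * pi -> cos x = cos y ->
  x = y \/ x = 2 * pi - y.
Proof.
have p0 := @pi_gt0 R.
have red (z : R) : 0 <= z <= 2 * pi ->
    exists w, [/\ 0 <= w <= pi, cos w = cos z & w = z \/ w = 2 * pi - z].
  move=> /andP[z0 z1]; have [zp|pz] := leP z pi; first by exists z; rewrite z0 zp; split=> //; left.
  exists (2 * pi - z); split; last by right.
    by apply/andP; split; lra.
  by rewrite cosB cos_2pi sin_2pi mul1r mul0r addr0.
move=> hx hy e; have [w [hw cw wE]] := red x hx; have [w' [hw' cw' wE']] := red y hy.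
have ww : w = w' by apply: cos_inj; rewrite ?in_itv // cw cw'.
by case: wE; case: wE' => e1 e2; [left|right|right|left]; lra.
Qed.

Lemma ang_pihalf : ang (pi / 2) = pi :> R.
Proof. by rewrite /ang [2 * _]mulrC divfK // sinpi subr0. Qed.

(** The exponential of the angle takes the values 1 and -1 at [th = 0, pi/2, pi]
    only. *)
Lemma sin_ang_eq0 th : 0 <= th <= pi -> sin (ang th) = 0 -> cos th * sin th = 0.
Proof.
have p0 := @pi_gt0 R.
move=> h s0; have hA := ang_bounds h.
have b0 : 0 <= (0 : R) <= pi by rewrite lexx ltW.
have bp : 0 <= (pi : R) <= pi by rewrite lexx ltW.
have bh : 0 <= (pi / 2 : R) <= pi by apply/andP; split; lra.
have c2 : (cos (ang th) - 1) * (cos (ang th) + 1) = 0.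
  by have := cos2Dsin2 (ang th); rewrite s0; lra.
move/eqP: c2; rewrite mulf_eq0 subr_eq0 addr_eq0 => /orP[/eqP c|/eqP c].
  have [|||e|e] := @cos_eq_2pi (ang th) 0; rewrite ?cos0 //.
  - by rewrite lexx mulr_ge0 ?ltW.
  - by rewrite (ang_inj h b0) ?sin0 ?mulr0 // e ang0.
  - by rewrite (ang_inj h bp) ?sinpi ?mulr0 // e angpi subr0.
have [|||e|e] := @cos_eq_2pi (ang th) pi; rewrite ?cospi //.
- by rewrite ltW //=; lra.
- by rewrite (ang_inj h bh) ?cos_pihalf ?mul0r // e ang_pihalf.
- rewrite (ang_inj h bh) ?cos_pihalf ?mul0r // e ang_pihalf; lra.
Qed.

(** As a function of the angle on the circle, [cos th] jumps at the point 1, which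
    corresponds to [th = 0] and [th = pi]; but the weight [sin th] vanishes there,
    and the approximation is only weighted.  The symmetry [th |-> pi - th] negates
    [cos th] and [sin (ang th)] and fixes [cos (ang th)].  So the quotient
    [cos th / sin (ang th)] is a function of [cos (ang th)]; it is regularised to
    [m] before polynomial approximation.  The error [d / (sin^2 (ang th) + d)] of
    the regularisation is small except near the zeros of [sin (ang th)], where
    [cos th sin th] is small by [sin_ang_eq0]. *)
Lemma cos_approx (eps : R) : 0 < eps -> exists p : {poly R}, forall th, 0 <= th <= pi ->
  `|cos th - sin (ang th) * p.[(1 + cos (ang th)) / 2]| * sin th <= eps.
Proof.
move=> e0; have p0 := @pi_gt0 R.
have ca := @continuous_ang R.
pose et := eps / 2; have et0 : 0 < et by rewrite divr_gt0.
have csa : continuous (fun th => sin (ang th)).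
  by move=> x; apply: continuous_comp; [exact: ca|exact: continuous_sin].
have cca : continuous (fun th => cos (ang th)).
  by move=> x; apply: continuous_comp; [exact: ca|exact: continuous_cos].
have csa2 : continuous (fun th => sin (ang th) ^+ 2).
  have -> : (fun th => sin (ang th) ^+ 2) = (fun th => sin (ang th) * sin (ang th)).
    by apply: funext => x; rewrite expr2.
  by move=> x; apply: cvgM; exact: csa.
pose a th : R := `|cos th| * sin th.
have ca' : continuous a.
  by move=> x; apply: cvgM; [apply: cvg_norm; exact: continuous_cos|exact: continuous_sin].
(* The minimum of [F] bounds [sin (ang th)^2] from below where [a th > et]. *)
pose F th : R := sin (ang th) ^+ 2 + (et - a th + `|et - a th|).
have cF : continuous F.
  move=> x; apply: cvgD; first exact: csa2.
  have ce : (et - a y) @[y --> x] --> et - a x by apply: cvgB; [exact: cvg_cst|exact: ca'].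
  by apply: cvgD; [exact: ce|apply: cvg_norm; exact: ce].
have [x0 x0I Fmin] := @EVT_min R F 0 pi (ltW p0) (continuous_subspaceT cF).
have tt0 (t : R) : 0 <= t + `|t| by have := ler_norm (- t); rewrite normrN; lra.
set mu := F x0 in Fmin.
have mu0 : 0 < mu.
  rewrite lt_neqAle eq_sym /mu addr_ge0 ?sqr_ge0 // andbT; apply/negP => /eqP F0.
  move: x0I; rewrite in_itv /= => h.
  have s2 : sin (ang x0) ^+ 2 = 0.
    by apply/eqP; rewrite eq_le sqr_ge0 andbT -F0 lerDl.
  have s0 : sin (ang x0) = 0 by move/eqP: s2; rewrite sqrf_eq0 => /eqP.
  have a0 : a x0 = 0.
    have /eqP := sin_ang_eq0 h s0; rewrite mulf_eq0 /a => /orP[/eqP->|/eqP->].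
      by rewrite normr0 mul0r.
    by rewrite mulr0.
  move: F0; rewrite /F s2 a0 add0r subr0 ger0_norm ?ltW //; lra.
pose d := et * mu; have d0 : 0 < d by rewrite mulr_gt0.
have den th : 0 < sin (ang th) ^+ 2 + d by rewrite ltr_wpDl // sqr_ge0.
pose m th : R := cos th * sin (ang th) / (sin (ang th) ^+ 2 + d).
have cm : continuous m.
  move=> x; apply: cvgM.
    by apply: cvgM; [exact: continuous_cos|exact: csa].
  apply: cvgV; first by rewrite gt_eqF.
  by apply: cvgD; [exact: csa2|exact: cvg_cst].
pose c th : R := (1 + cos (ang th)) / 2.
have cc : continuous c.
  move=> x; apply: cvgM; last exact: cvg_cst.
  by apply: cvgD; [exact: cvg_cst|exact: cca].
have [|||p Hp] := @weierstrass R 0 pi m c et et0 (ltW p0) cm cc.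
- move=> th _; have := cos_le1 (ang th); have := cos_geN1 (ang th).
  by rewrite /c => ? ?; apply/andP; split; lra.
- move=> x /andP[hx0 hx1].
  have [|||th thI cth] := @IVT R c 0 (pi / 2) x.
  + by rewrite divr_ge0 ?ltW.
  + exact: continuous_subspaceT.
  + rewrite /c ang0 ang_pihalf cos0 cospi.
    have -> : (1 + 1) / 2 = 1 :> R by lra.
    have -> : (1 - 1) / 2 = 0 :> R by lra.
    by rewrite min_r ?max_l ?ler01 // hx0.
  exists th => //; move: thI; rewrite in_itv /= => /andP[? ?]; apply/andP; split; lra.
- move=> th th' h h'; rewrite /c => /(mulIf _) e.
  have {}e : cos (ang th) = cos (ang th').
    by apply: (addrI 1); apply: e; rewrite invr_eq0 pnatr_eq0.
  have [e1|e1] := cos_eq_2pi (ang_bounds h) (ang_bounds h') e.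
    by rewrite (ang_inj h h' e1).
  rewrite -ang_sym in e1.
  rewrite (ang_inj h (pi_subr_bounds h') e1) /m ang_sym sinB cosB cospi sinpi cos_2pi sin_2pi.
  by rewrite !mul0r addr0 sub0r mul1r mulN1r mulrNN sqrrN.
exists p => th h; have s0 : 0 <= sin th by exact: sin_ge0_pi.
have := Hp th h; rewrite -/(c th); set q := p.[c th] => Hq.
have sle : `|sin (ang th)| <= 1.
  by rewrite ler_norml sin_le1 sin_geN1.
have sle' : sin th <= 1 by exact: sin_le1.
have -> : cos th - sin (ang th) * q = cos th * (d / (sin (ang th) ^+ 2 + d)) + sin (ang th) * (m th - q).
  by rewrite /m; field; rewrite gt_eqF.
apply: le_trans (_ : (`|cos th| * (d / (sin (ang th) ^+ 2 + d)) + et) * sin th <= _).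
  rewrite ler_wpM2r //; apply: le_trans (ler_normD _ _) _; apply: lerD.
    by rewrite normrM (ger0_norm (divr_ge0 (ltW d0) (ltW (den _)))).
  rewrite normrM -[et]mul1r; apply: ler_pM => //.
rewrite mulrDl mulrAC -/(a th).
have e2 : et * sin th <= et by rewrite ler_piMr // ltW.
suff : a th * (d / (sin (ang th) ^+ 2 + d)) <= et by rewrite /et in e2 *; lra.
have a1 : 0 <= a th by rewrite mulr_ge0.
have r1 : d / (sin (ang th) ^+ 2 + d) <= 1.
  by rewrite ler_pdivrMr ?den // mul1r lerDr sqr_ge0.
have [al|al] := leP (a th) et.
  by apply: le_trans al; rewrite ler_piMr.
have a1' : a th <= 1.
  have : `|cos th| <= 1 by rewrite ler_norml cos_le1 cos_geN1.
  rewrite /a; have := normr_ge0 (cos th); nra.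
have ms : mu <= sin (ang th) ^+ 2.
  have := Fmin th; rewrite in_itv /= => /(_ h); rewrite /F.
  by rewrite ltr0_norm ?subr_lt0 //; lra.
apply: le_trans (_ : d / (sin (ang th) ^+ 2 + d) <= _).
  by rewrite ler_piMl // divr_ge0 ?ltW ?den.
rewrite ler_pdivrMr ?den // /d; nra.
Qed.

End AngleApproximation.

(** * The Jacobi operator and the Chebyshev basis *)

Section JacobiOperator.
Variable R : realType.

Lemma shift_subproof (x y : nat) :
  (if x is x'.+1 then Some x' else None) = Some y <-> Some y.+1 = Some x.
Proof. by case: x => [|x]; split=> // -[->]. Qed.

(** The sum of the unilateral shift and its adjoint. *)
Definition jacobi : bop R nat :=
  pull R (phi_inj shift_subproof) + pull R (psi_inj shift_subproof).

Lemma jacobi0 f : jacobi f 0%N = f 1%N.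
Proof. by rewrite bopDE l2DE !pullE add0r. Qed.

Lemma jacobiS f n : jacobi f n.+1 = f n + f n.+2.
Proof. by rewrite bopDE l2DE !pullE. Qed.

Lemma jacobi_adjoint : is_adjoint jacobi jacobi.
Proof.
have a := pull_adjoint (R := R) shift_subproof.
by rewrite /jacobi {2}addrC; apply: is_adjointD => //; exact: is_adjoint_sym.
Qed.

Lemma jacobi_delta0 : jacobi (delta R 0%N) = delta R 1%N.
Proof.
by apply: l2P => -[|n]; rewrite ?jacobi0 ?jacobiS /= ?add0r ?addr0 // !eqSS; case: n.
Qed.

Lemma jacobi_deltaS n : jacobi (delta R n.+1) = delta R n.+2 + delta R n.
Proof.
apply: l2P => -[|k]; rewrite [LHS](jacobi0, jacobiS) l2DE /= ?eqSS ?add0r //.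
Qed.

End JacobiOperator.

Section ChebyshevTransform.
Variable R : realType.
Implicit Types (f g h : R -> R) (th : R).
Local Notation jac := (jacobi R).

Definition chebcoef f k := sc (fun th => f th * cheb k th).

Lemma contM f g : continuous f -> continuous g -> continuous (fun th => f th * g th).
Proof. by move=> cf cg x; apply: cvgM; [exact: cf|exact: cg]. Qed.
Lemma contD f g : continuous f -> continuous g -> continuous (fun th => f th + g th).
Proof. by move=> cf cg x; apply: cvgD; [exact: cf|exact: cg]. Qed.
Lemma contB f g : continuous f -> continuous g -> continuous (fun th => f th - g th).
Proof. by move=> cf cg x; apply: cvgB; [exact: cf|exact: cg]. Qed.
Lemma contZ (c : R) f : continuous f -> continuous (fun th => c * f th).
Proof. by move=> cf x; apply: cvgM; [exact: cvg_cst|exact: cf]. Qed.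
Lemma cont_cst (c : R) : continuous (fun _ : R => c).
Proof. by move=> x; exact: cvg_cst. Qed.

Lemma scB f g : continuous f -> continuous g -> sc (fun th => f th - g th) = sc f - sc g.
Proof.
move=> cf cg; rewrite (@sc_ext _ _ (fun th => f th + -1 * g th)); last by move=> th; rewrite mulN1r.
by rewrite scD ?scZ ?mulN1r //; exact: contZ.
Qed.

Lemma sc_ge0 f : continuous f -> (forall th, 0 <= f th) -> 0 <= sc f.
Proof.
move=> cf f0; have <- : sc (fun th => 0 * f th) = 0 by rewrite scZ ?mul0r.
apply: sc_le => // [|th _]; first exact: contZ.
by rewrite !mul0r mulr_ge0 ?sqr_ge0.
Qed.

Lemma cheb_bessel f (s : seq nat) : continuous f -> uniq s ->
  \sum_(k <- s) chebcoef f k ^+ 2 <= sc (fun th => f th * f th).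
Proof.
move=> cf us; pose g th := \sum_(k <- s) chebcoef f k * cheb k th.
have gE (t : seq nat) h : continuous h ->
    continuous (fun th => \sum_(k <- t) chebcoef f k * cheb k th) /\
    sc (fun th => h th * \sum_(k <- t) chebcoef f k * cheb k th) =
      \sum_(k <- t) chebcoef f k * chebcoef h k.
  move=> ch; elim: t => [|k t [IH1 IH2]].
    rewrite big_nil (_ : (fun th => _) = fun=> 0); last by apply: funext => x; rewrite big_nil.
    split; first exact: cont_cst.
    rewrite (@sc_ext _ _ (fun th => 0 * h th)); last by move=> th; rewrite big_nil mulr0 mul0r.
    by rewrite scZ ?mul0r.
  have E h' : (fun th => h' th * \sum_(j <- k :: t) chebcoef f j * cheb j th) =
      fun th => chebcoef f k * (h' th * cheb k th) + h' th * \sum_(j <- t) chebcoef f j * cheb j th.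
    by apply: funext => th; rewrite big_cons; ring.
  split.
    have -> : (fun th => \sum_(j <- k :: t) chebcoef f j * cheb j th) =
      fun th => chebcoef f k * cheb k th + \sum_(j <- t) chebcoef f j * cheb j th.
      by apply: funext => th; rewrite big_cons.
    by apply: contD => //; apply: contZ; exact: cont_cheb.
  rewrite E scD; [|by apply: contZ; apply: contM => //; exact: cont_cheb|exact: contM].
  by rewrite scZ ?IH2 ?big_cons //; apply: contM => //; exact: cont_cheb.
have [cg fg] := gE s f cf.
have gk k : k \in s -> chebcoef g k = chebcoef f k.
  move=> ks; rewrite /chebcoef -/(chebcoef f k).
  rewrite (@sc_ext _ _ (fun th => cheb k th * g th)); last by move=> th; rewrite mulrC.
  have [_ ->] := gE s (cheb k) (@cont_cheb R k).
  rewrite (bigD1_seq k) //= /(chebcoef (cheb k)) sc_cheb eqxx mulr1 big1 ?addr0 // => i ik.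
  by rewrite sc_cheb eq_sym (negPf ik) mulr0.
have gg : sc (fun th => g th * g th) = \sum_(k <- s) chebcoef f k ^+ 2.
  have [_ ->] := gE s g cg; apply: eq_big_seq => k ks; by rewrite gk // expr2.
have := @sc_ge0 (fun th => (f th - g th) * (f th - g th)).
rewrite (@sc_ext _ _ (fun th => f th * f th - 2 * (f th * g th) + g th * g th)); last first.
  by move=> th; ring.
have cfg := contM cf cg; have cff := contM cf cf; have cgg := contM cg cg.
rewrite scD ?scB ?scZ //; do ?[exact: contZ|by apply: contB => //; exact: contZ].
rewrite fg gg => H.
have {}H : 0 <= sc (fun th => f th * f th) - 2 * \sum_(k <- s) chebcoef f k * chebcoef f k +
    \sum_(k <- s) chebcoef f k ^+ 2.
  by apply: H => [|th]; [apply: contM; exact: contB|rewrite -expr2 sqr_ge0].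
by move: H; under [X in 2 * X]eq_bigr do rewrite -expr2; lra.
Qed.

Lemma tf_summable f : continuous f ->
  (fun k => (chebcoef f k)%:C%C) \in @square_summable R nat.
Proof.
move=> cf; apply/asboolP; apply: le_lt_trans (ltry (sc (fun th => f th * f th))).
apply: fin_sqsum_le => s us; apply: le_trans (cheb_bessel cf us).
by apply: ler_sum => k _; rewrite normc_real real_normK ?num_real.
Qed.

(** The coordinates of [f] in the orthonormal family of Chebyshev polynomials. *)
Definition tf f : l2 R nat :=
  if pselect (continuous f) is left cf then L2 (tf_summable cf) else 0.

Lemma tfE f k : continuous f -> tf f k = (chebcoef f k)%:C%C.
Proof. by move=> cf; rewrite /tf; case: pselect. Qed.

Lemma tf_norm f : continuous f -> l2norm (tf f) ^+ 2 <= sc (fun th => f th * f th).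
Proof.
move=> cf; rewrite -lee_fin l2norm_sq; apply: fin_sqsum_le => s us.
apply: le_trans (cheb_bessel cf us).
by apply: ler_sum => k _; rewrite tfE // normc_real real_normK ?num_real.
Qed.

Lemma tf_ext f g : f =1 g -> tf f = tf g.
Proof. by move=> fg; congr tf; exact: funext. Qed.

Lemma tfD f g : continuous f -> continuous g -> tf (fun th => f th + g th) = tf f + tf g.
Proof.
move=> cf cg; apply: l2P => k; rewrite l2DE !tfE //; last exact: contD.
rewrite -rmorphD; congr (_%:C)%C; rewrite /chebcoef -scD; do ?[by apply: contM => //; exact: cont_cheb].
by apply: sc_ext => th; rewrite mulrDl.
Qed.

Lemma tfZ (c : R) f : continuous f -> tf (fun th => c * f th) = c%:C%C *: tf f.
Proof.
move=> cf; apply: l2P => k; rewrite l2ZE !tfE //; last exact: contZ.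
rewrite -rmorphM; congr (_%:C)%C; rewrite /chebcoef -scZ; last by apply: contM => //; exact: cont_cheb.
by apply: sc_ext => th; rewrite mulrA.
Qed.

Lemma tfB f g : continuous f -> continuous g -> tf (fun th => f th - g th) = tf f - tf g.
Proof.
move=> cf cg; rewrite (@tf_ext _ (fun th => f th + -1 * g th)); last by move=> th; rewrite mulN1r.
by rewrite tfD ?tfZ ?rmorphN1 ?scaleN1r //; exact: contZ.
Qed.

Lemma tf_cheb k : tf (cheb k) = delta R k.
Proof.
apply: l2P => j; rewrite tfE; last exact: cont_cheb.
by rewrite /chebcoef sc_cheb /= eq_sym; case: eqP.
Qed.

Definition twocos th : R := 2 * cos th.

Lemma cont_twocos : continuous twocos.
Proof. by apply: contZ; exact: continuous_cos. Qed.

(** The three-term recurrence of the Chebyshev polynomials. *)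
Lemma tf_twocos f : continuous f -> tf (fun th => twocos th * f th) = jac (tf f).
Proof.
move=> cf; have c2f := contM cont_twocos cf.
have cfc k : continuous (fun th => f th * cheb k th) by apply: contM => //; exact: cont_cheb.
apply: l2P => -[|k]; rewrite ?jacobi0 ?jacobiS !tfE //.
  by congr (_%:C)%C; apply: sc_ext => th; rewrite /= /twocos; ring.
rewrite -rmorphD; congr (_%:C)%C; rewrite /chebcoef -scD //.
by apply: sc_ext => th; rewrite chebSS /twocos; ring.
Qed.

(** A class of functions stable under sums, scalar multiples and multiplication by
    [c] is stable under multiplication by polynomials in [c]. *)
Lemma poly_comp_ind (P : (R -> R) -> Prop) (c : R -> R) :
  (forall f, P f -> P (fun th => c th * f th)) ->
  (forall f g, P f -> P g -> P (fun th => f th + g th)) ->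
  (forall (a : R) f, P f -> P (fun th => a * f th)) ->
  forall (p : {poly R}) f, P f -> P (fun th => p.[c th] * f th).
Proof.
move=> Pc PD PZ p f Pf; elim/poly_ind: p => [|p a IH].
  rewrite (_ : (fun th => _) = fun th => 0 * f th); first exact: PZ.
  by apply: funext => th; rewrite horner0.
rewrite (_ : (fun th => _) = fun th => c th * (p.[c th] * f th) + a * f th).
  by apply: PD; [exact: Pc|exact: PZ].
by apply: funext => th; rewrite hornerMXaddC mulrDl [c th * _]mulrCA mulrA.
Qed.

(** [tf] is isometric on all continuous functions; this predicate is the form of
    that statement which can be proved first for polynomials in [cos th], by
    moving factors [2 cos th] across the inner product, and then by density. *)
Definition tf_isometric f := continuous f /\ forall g, continuous g ->
  l2dot (tf f) (tf g) = (sc (fun th => f th * g th))%:C%C.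

Lemma tf_isometric1 : tf_isometric (fun=> 1).
Proof.
split=> [|g cg]; first exact: cont_cst.
rewrite (_ : tf _ = delta R 0%N); last exact: (tf_cheb 0).
rewrite l2dot_delta_l tfE // conjc_real; congr (_%:C)%C.
by apply: sc_ext => th; rewrite /= mulrC.
Qed.

Lemma tf_isometric_twocos f : tf_isometric f -> tf_isometric (fun th => twocos th * f th).
Proof.
move=> [cf If]; split=> [|g cg]; first by apply: contM => //; exact: cont_twocos.
rewrite tf_twocos // jacobi_adjoint -tf_twocos // If; last by apply: contM => //; exact: cont_twocos.
by congr (_%:C)%C; apply: sc_ext => th; ring.
Qed.

Lemma tf_isometricD f g : tf_isometric f -> tf_isometric g -> tf_isometric (fun th => f th + g th).
Proof.
move=> [cf If] [cg Ig]; split=> [|h ch]; first exact: contD.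
rewrite tfD // l2dotDl If // Ig // -rmorphD -scD; do ?[exact: contM].
by congr (_%:C)%C; apply: sc_ext => th; rewrite mulrDl.
Qed.

Lemma tf_isometricZ (a : R) f : tf_isometric f -> tf_isometric (fun th => a * f th).
Proof.
move=> [cf If]; split=> [|h ch]; first exact: contZ.
rewrite tfZ // l2dotZl If // -rmorphM -scZ; do ?[exact: contM].
by congr (_%:C)%C; apply: sc_ext => th; rewrite mulrA.
Qed.

Lemma half_cos_range th : 0 <= (1 + cos th) / 2 <= 1.
Proof.
by have := cos_le1 th; have := cos_geN1 th => ? ?; apply/andP; split; lra.
Qed.

Lemma sc1 : sc (fun=> 1) = 1 :> R.
Proof. by have := @sc_cheb R 0 0; rewrite (@sc_ext _ _ (fun=> 1)) // => th /=; rewrite mulr1. Qed.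

Lemma tf_isometric_dense (f : R -> R) (eps : R) : continuous f -> 0 < eps ->
  exists2 p, tf_isometric p & sc (fun th => (f th - p th) * (f th - p th)) <= eps ^+ 2.
Proof.
move=> cf e0; have p0 := @pi_gt0 R.
pose c th : R := (1 + cos th) / 2.
have cc : continuous c.
  by move=> x; apply: cvgM; [apply: cvgD; [exact: cvg_cst|exact: continuous_cos]|exact: cvg_cst].
have [|||p Hp] := @weierstrass R 0 pi f c eps e0 (ltW p0) cf cc.
- by move=> th _; exact: half_cos_range.
- move=> x /andP[hx0 hx1].
  have [||th thI cth] := @IVT R c 0 pi x (ltW p0).
  + exact: continuous_subspaceT.
  + rewrite /c cos0 cospi.
    have -> : (1 + 1) / 2 = 1 :> R by lra.
    have -> : (1 - 1) / 2 = 0 :> R by lra.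
    by rewrite min_r ?max_l ?ler01 // hx0.
  by exists th => //; move: thI; rewrite in_itv.
- move=> th th' h h' e; congr f; apply: cos_inj; rewrite ?in_itv //.
  by move: e; rewrite /c; lra.
have Ip : tf_isometric (fun th => p.[c th] * 1).
  apply: (poly_comp_ind (P := tf_isometric)); 
    [|exact: tf_isometricD|exact: tf_isometricZ|exact: tf_isometric1].
  move=> g Ig; have := tf_isometricD (tf_isometricZ 2^-1 Ig) (tf_isometricZ 4^-1 (tf_isometric_twocos Ig)).
  by congr tf_isometric; apply: funext => th; rewrite /c /twocos; field.
exists (fun th => p.[c th] * 1) => //.
have cp := Ip.1; have cd := contB cf cp.
have -> : eps ^+ 2 = sc (fun=> eps ^+ 2 * 1) by rewrite scZ ?sc1 ?mulr1 //; exact: cont_cst.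
apply: sc_le => [||th h]; [exact: contM|exact: cont_cst|].
apply: ler_wpM2r; first exact: sqr_ge0.
by have := Hp th h; rewrite ler_norml !mulr1 => /andP[? ?]; nra.
Qed.

End ChebyshevTransform.

(** * A Haar unitary with the commutant of the Jacobi operator *)

Section HaarBasis.
Variable R : realType.
Implicit Types (f g h w v u : R -> R) (th : R) (n m : int).
Local Notation jac := (jacobi R).

(** The Cauchy-Schwarz inequality in the additive form that follows by
    integrating [0 <= (f - eps g)^2]. *)
Lemma sc_mul_le f g (eps : R) : continuous f -> continuous g -> 0 < eps ->
  sc (fun th => f th * f th) <= eps ^+ 2 ->
  2 * sc (fun th => f th * g th) <= eps * (1 + sc (fun th => g th * g th)).
Proof.
move=> cf cg e0 fe; have := @sc_ge0 R (fun th => (f th - eps * g th) * (f th - eps * g th)).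
rewrite (@sc_ext _ _ (fun th =>
  f th * f th - 2 * eps * (f th * g th) + eps ^+ 2 * (g th * g th))); last first.
  by move=> th; ring.
have cfg := contM cf cg; have cff := contM cf cf; have cgg := contM cg cg.
have ce := contZ (c := eps) cg.
have c1 := contZ (c := 2 * eps) cfg.
rewrite scD; [|exact: contB|exact: contZ].
rewrite scB // !scZ // => H.
have {}H : 0 <= sc (fun th => f th * f th) - 2 * eps * sc (fun th => f th * g th) +
    eps ^+ 2 * sc (fun th => g th * g th).
  by apply: H => [|th]; [apply: contM; exact: contB|rewrite -expr2 sqr_ge0].
rewrite -(ler_pM2l e0) [leRHS]mulrA -expr2 mulrDr mulr1 mulrA [eps * 2]mulrC; lra.
Qed.

Lemma tf_dot f g : continuous f -> continuous g ->
  l2dot (tf f) (tf g) = (sc (fun th => f th * g th))%:C%C.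
Proof.
move=> cf cg; apply/eqP; rewrite -subr_eq0; apply/eqP.
set G := sc (fun th => g th * g th).
have G0 : 0 <= G by apply: sc_ge0 => [|th]; [exact: contM|rewrite -expr2 sqr_ge0].
apply: (@eps_eq0 _ _ (l2norm (tf g) + (1 + G))) => e e0.
have [p [cp Ip] Hp] := tf_isometric_dense cf e0.
pose h th := f th - p th; have ch : continuous h by exact: contB.
have -> : l2dot (tf f) (tf g) - (sc (fun th => f th * g th))%:C%C =
   l2dot (tf h) (tf g) - (sc (fun th => h th * g th))%:C%C.
  rewrite /h tfB // l2dotBl Ip //.
  rewrite (@sc_ext _ (fun th => (f th - p th) * g th) (fun th => f th * g th - p th * g th)).
    by rewrite scB ?rmorphB; [ring|exact: contM|exact: contM].
  by move=> th; ring.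
apply: le_trans (le_normcD _ _) _; rewrite normcN normc_real mulrDl; apply: lerD.
  have hN : l2norm (tf h) <= e.
    rewrite -ler_sqr ?nnegrE ?l2norm_ge0 ?(ltW e0) //.
    by apply: le_trans (tf_norm ch) _; exact: Hp.
  apply: le_trans (cauchy_schwarz _ _) _; rewrite [leRHS]mulrC.
  by apply: ler_wpM2r; first exact: l2norm_ge0.
have H1 := sc_mul_le ch cg e0 Hp; rewrite -/G in H1.
have cN : continuous (fun th => - 1 * g th) by exact: contZ.
have H2 := sc_mul_le ch cN e0 Hp.
rewrite (@sc_ext _ (fun th => -1 * g th * (-1 * g th)) (fun th => g th * g th)) in H2; last by move=> th; ring.
rewrite (@sc_ext _ (fun th => h th * (-1 * g th)) (fun th => -1 * (h th * g th))) in H2; last by move=> th; ring.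
rewrite scZ -/G in H2; last exact: contM.
have eG : 0 <= e * (1 + G) by apply: mulr_ge0; [exact: ltW|exact: addr_ge0].
by rewrite ler_norml [(1 + G) * e]mulrC; apply/andP; split; lra.
Qed.

Definition cosn n th : R := cos (n%:~R * ang th).
Definition sinn n th : R := sin (n%:~R * ang th).

Lemma cont_cosn n : continuous (cosn n). Proof. exact: cont_cosang. Qed.
Lemma cont_sinn n : continuous (sinn n). Proof. exact: cont_sinang. Qed.

Lemma cosnD n m th : cosn (n + m) th = cosn n th * cosn m th - sinn n th * sinn m th.
Proof. by rewrite /cosn rmorphD /= mulrDl cosD. Qed.
Lemma sinnD n m th : sinn (n + m) th = sinn n th * cosn m th + cosn n th * sinn m th.
Proof. by rewrite /sinn rmorphD /= mulrDl sinD. Qed.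
Lemma cosnN n th : cosn (- n) th = cosn n th.
Proof. by rewrite /cosn rmorphN /= mulNr cosN. Qed.
Lemma sinnN n th : sinn (- n) th = - sinn n th.
Proof. by rewrite /sinn rmorphN /= mulNr sinN. Qed.

(** The coordinates of [w u^n], where [u th = exp (i ang th)] and [w] is real. *)
Definition wexp w n : l2 R nat :=
  tf (fun th => w th * cosn n th) + (Complex 0 1) *: tf (fun th => w th * sinn n th).

(** The integral of [w u^n] against the semicircle law. *)
Definition wmom w n : R[i] :=
  Complex (sc (fun th => w th * cosn n th)) (sc (fun th => w th * sinn n th)).

Lemma wexp_dot w v n m : continuous w -> continuous v ->
  l2dot (wexp w n) (wexp v m) = wmom (fun th => w th * v th) (n - m).
Proof.
move=> cw cv.
have cc (u : R -> R) k : continuous u -> continuous (fun th => u th * cosn k th).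
  by move=> cu; apply: contM => //; exact: cont_cosn.
have cs (u : R -> R) k : continuous u -> continuous (fun th => u th * sinn k th).
  by move=> cu; apply: contM => //; exact: cont_sinn.
have [w1 w2 v1 v2] : [/\ continuous (fun th => w th * cosn n th),
  continuous (fun th => w th * sinn n th), continuous (fun th => v th * cosn m th) &
  continuous (fun th => v th * sinn m th)] by split; do ?[exact: cc|exact: cs].
rewrite /wexp l2dotDl !l2dotDr !l2dotZl !l2dotZr !tf_dot // /wmom.
rewrite (@sc_ext _ (fun th => w th * v th * cosn (n - m) th) (fun th =>
   w th * cosn n th * (v th * cosn m th) + w th * sinn n th * (v th * sinn m th))); last first.
  by move=> th; rewrite cosnD cosnN sinnN; ring.
rewrite (@sc_ext _ (fun th => w th * v th * sinn (n - m) th) (fun th =>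
   w th * sinn n th * (v th * cosn m th) - w th * cosn n th * (v th * sinn m th))); last first.
  by move=> th; rewrite sinnD cosnN sinnN; ring.
rewrite scD ?scB; do ?[exact: contM].
by apply/eqP; rewrite eq_complex /=; apply/andP; split; apply/eqP; ring.
Qed.

Definition uexp n := wexp (fun=> 1) n.

Lemma wmom1 n : wmom (fun=> 1) n = (n == 0)%:R.
Proof.
rewrite /wmom (@sc_ext _ _ (cosn n)); last by move=> th; rewrite mul1r.
rewrite (@sc_ext _ (fun th => 1 * sinn n th) (sinn n)); last by move=> th; rewrite mul1r.
by rewrite sc_cosang sc_sinang; case: eqP.
Qed.

Lemma uexp_orthonormal : orthonormal uexp.
Proof.
move=> n m; rewrite wexp_dot; do ?exact: cont_cst.
by rewrite (_ : (fun _ => _) = fun=> 1) ?wmom1 ?subr_eq0 //; apply: funext => th; rewrite mulr1.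
Qed.

Lemma uexp0 : uexp 0 = delta R 0%N.
Proof.
rewrite /uexp /wexp (@tf_ext _ _ (cheb 0)); last by move=> th; rewrite /cosn mul0r cos0 mulr1.
rewrite (@tf_ext _ (fun th => 1 * sinn 0 th) (fun th => 0 * cheb 0 th)).
  by rewrite tfZ ?scale0r ?scaler0 ?addr0 ?tf_cheb //; exact: cont_cheb.
by move=> th; rewrite /sinn !mul0r sin0 mulr0.
Qed.

Lemma jac_uexp n : jac (uexp n) = wexp (@twocos R) n.
Proof.
have c1 : continuous (fun _ : R => 1 : R) by exact: cont_cst.
rewrite /uexp /wexp [X in jac X]addrC (bop_linear jac) [LHS]addrC -!tf_twocos; last first.
- by apply: contM => //; exact: cont_cosn.
- by apply: contM => //; exact: cont_sinn.
by congr (_ + _ *: _); apply: tf_ext => th; rewrite mul1r.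
Qed.

(** In the family [uexp] the Jacobi operator has a Toeplitz matrix, which means
    that it commutes with the shift [u]. *)
Lemma jac_uexp_dot n m : l2dot (jac (uexp n)) (uexp m) = wmom (@twocos R) (n - m).
Proof.
rewrite jac_uexp wexp_dot; [|exact: cont_twocos|exact: cont_cst].
by congr wmom; apply: funext => th; rewrite mulr1.
Qed.

(** The projection onto the closed span of the powers of [u], eventually shown to
    be the identity. *)
Definition uproj (x : l2 R nat) := synth uexp_orthonormal (coords uexp_orthonormal x).

Lemma uproj_linear : linear uproj.
Proof. by move=> c f g; rewrite /uproj coords_linear synth_linear. Qed.

Lemma uproj_uexp n : uproj (uexp n) = uexp n.
Proof. by rewrite /uproj coordsb synth_delta. Qed.

Lemma uproj_closed (x : l2 R nat) :
  (forall e : R, 0 < e -> exists2 y, uproj y = y & l2norm (x - y) <= e) -> uproj x = x.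
Proof.
move=> H; have [M M0 HM] := synth_bnd uexp_orthonormal.
apply/eqP; rewrite -subr_eq0; apply/eqP/l2norm_eq0/eqP.
rewrite eq_le l2norm_ge0 andbT; apply/ler_addgt0Pr => e e0; rewrite add0r.
have M1 : 0 < M + 1 by rewrite ltr_wpDl.
have [y Qy xy] := H (e / (M + 1)) (divr_gt0 e0 M1).
have -> : uproj x - x = uproj (x - y) - (x - y).
  have -> : uproj (x - y) = uproj x - uproj y by rewrite addrC -scaleN1r uproj_linear scaleN1r addrC.
  by rewrite Qy opprB addrA subrK.
apply: le_trans (l2normB _ _) _.
apply: le_trans (_ : (M + 1) * l2norm (x - y) <= e).
  rewrite mulrDl mul1r lerD2r; apply: le_trans (HM _) _.
  by apply: ler_wpM2l => //; exact: coords_le.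
by rewrite mulrC -ler_pdivlMr.
Qed.

(** The real and imaginary parts of [f u^n] lie in the closed span of the powers
    of [u], for every [n].  Allowing all [n] makes the class stable under
    multiplication by the real and imaginary parts of [u]. *)
Definition trig f := continuous f /\ forall n,
  uproj (tf (fun th => f th * cosn n th)) = tf (fun th => f th * cosn n th) /\
  uproj (tf (fun th => f th * sinn n th)) = tf (fun th => f th * sinn n th).

Lemma uprojD x y : uproj x = x -> uproj y = y -> uproj (x + y) = x + y.
Proof. by move=> Qx Qy; rewrite -[x]scale1r uproj_linear Qx Qy. Qed.
Lemma uproj0 : uproj 0 = 0.
Proof. by have := uproj_linear (-1) 0 0; rewrite scaler0 addr0 scaleN1r addNr. Qed.
Lemma uprojZ (c : R[i]) x : uproj x = x -> uproj (c *: x) = c *: x.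
Proof. by move=> Qx; rewrite -[c *: x]addr0 uproj_linear Qx uproj0. Qed.

Lemma mul_imNim : (Complex 0 1 : R[i]) * (Complex 0 (-1)) = 1.
Proof. by apply/eqP; rewrite eq_complex /=; apply/andP; split; apply/eqP; ring. Qed.

Lemma trig1 : trig (fun=> 1).
Proof.
split=> [|n]; first exact: cont_cst.
set C := tf _; set S := tf (fun th => _ * sinn n th).
have E1 : uexp n = C + Complex 0 1 *: S by [].
have E2 : uexp (- n) = C - Complex 0 1 *: S.
  rewrite /uexp /wexp; congr (_ + _).
    by apply: tf_ext => th; rewrite cosnN.
  rewrite (@tf_ext _ _ (fun th => -1 * (1 * sinn n th))); last by move=> th; rewrite sinnN; ring.
  rewrite tfZ; last by apply: contM; [exact: cont_cst|exact: cont_sinn].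
  by rewrite rmorphN1 scaleN1r scalerN.
have F1 : C = 2^-1 *: (uexp n + uexp (- n)).
  by rewrite E1 E2 addrACA subrr addr0 -mulr2n -[C *+ 2]scaler_nat scalerA mulVf ?scale1r ?pnatr_eq0.
have D : uexp n + -1 *: uexp (- n) = (2%:R * Complex 0 1) *: S.
  by rewrite E1 E2 scaleN1r opprB addrC subrKA -mulr2n -[_ *: S *+ 2]scaler_nat scalerA.
have F2 : S = (2%:R^-1 * Complex 0 (-1)) *: (uexp n + -1 *: uexp (- n)).
  by rewrite D scalerA mulrACA mulVf ?pnatr_eq0 // [Complex 0 (-1) * _]mulrC mul_imNim mulr1 scale1r.
split; [rewrite F1|rewrite F2]; apply: uprojZ; apply: uprojD; rewrite ?uproj_uexp //.
by apply: uprojZ; exact: uproj_uexp.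
Qed.

Lemma trigD f g : trig f -> trig g -> trig (fun th => f th + g th).
Proof.
move=> [cf Tf] [cg Tg]; split=> [|n]; first exact: contD.
have [f1 f2] := Tf n; have [g1 g2] := Tg n.
have cc := @cont_cosn n; have cs := @cont_sinn n.
split.
  rewrite (@tf_ext _ _ (fun th => f th * cosn n th + g th * cosn n th)); last by move=> th; ring.
  by rewrite tfD ?uprojD //; exact: contM.
rewrite (@tf_ext _ _ (fun th => f th * sinn n th + g th * sinn n th)); last by move=> th; ring.
by rewrite tfD ?uprojD //; exact: contM.
Qed.

Lemma trigZ (a : R) f : trig f -> trig (fun th => a * f th).
Proof.
move=> [cf Tf]; split=> [|n]; first exact: contZ.
have [f1 f2] := Tf n.
have cc := @cont_cosn n; have cs := @cont_sinn n.
split.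
  rewrite (@tf_ext _ _ (fun th => a * (f th * cosn n th))); last by move=> th; ring.
  by rewrite tfZ ?uprojZ //; exact: contM.
rewrite (@tf_ext _ _ (fun th => a * (f th * sinn n th))); last by move=> th; ring.
by rewrite tfZ ?uprojZ //; exact: contM.
Qed.

Lemma trig_comb (a b : R) f g : continuous f -> continuous g ->
  uproj (tf f) = tf f -> uproj (tf g) = tf g ->
  uproj (tf (fun th => a * f th + b * g th)) = tf (fun th => a * f th + b * g th).
Proof.
move=> cf cg Qf Qg; rewrite tfD ?tfZ //; do ?exact: contZ.
by apply: uprojD; apply: uprojZ.
Qed.

Lemma trig_cos f : trig f -> trig (fun th => cosn 1 th * f th).
Proof.
move=> [cf Tf]; split=> [|n]; first by apply: contM => //; exact: cont_cosn.
have cc k : continuous (fun th => f th * cosn k th) by apply: contM => //; exact: cont_cosn.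
have cs k : continuous (fun th => f th * sinn k th) by apply: contM => //; exact: cont_sinn.
have [f1 f2] := Tf (n + 1); have [f3 f4] := Tf (n - 1).
split.
  rewrite (@tf_ext _ _ (fun th => 2^-1 * (f th * cosn (n + 1) th) + 2^-1 * (f th * cosn (n - 1) th))).
    exact: trig_comb.
  by move=> th; rewrite !cosnD cosnN sinnN; field.
rewrite (@tf_ext _ _ (fun th => 2^-1 * (f th * sinn (n + 1) th) + 2^-1 * (f th * sinn (n - 1) th))).
  exact: trig_comb.
by move=> th; rewrite !sinnD cosnN sinnN; field.
Qed.

Lemma trig_sin f : trig f -> trig (fun th => sinn 1 th * f th).
Proof.
move=> [cf Tf]; split=> [|n]; first by apply: contM => //; exact: cont_sinn.
have cc k : continuous (fun th => f th * cosn k th) by apply: contM => //; exact: cont_cosn.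
have cs k : continuous (fun th => f th * sinn k th) by apply: contM => //; exact: cont_sinn.
have [f1 f2] := Tf (n + 1); have [f3 f4] := Tf (n - 1).
split.
  rewrite (@tf_ext _ _ (fun th => 2^-1 * (f th * sinn (n + 1) th) + - 2^-1 * (f th * sinn (n - 1) th))).
    exact: trig_comb.
  by move=> th; rewrite !sinnD cosnN sinnN; field.
rewrite (@tf_ext _ _ (fun th => - 2^-1 * (f th * cosn (n + 1) th) + 2^-1 * (f th * cosn (n - 1) th))).
  exact: trig_comb.
by move=> th; rewrite !cosnD cosnN sinnN; field.
Qed.

(** Multiplication by [cosn n] and [sinn n] is contractive in mean square. *)
Lemma trig_lim f : continuous f -> (forall e : R, 0 < e ->
  exists2 q, trig q & sc (fun th => (f th - q th) * (f th - q th)) <= e ^+ 2) -> trig f.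
Proof.
move=> cf H; split=> // n.
have main (c : R -> R) : continuous c -> (forall th, c th * c th <= 1) ->
    (forall q, trig q -> uproj (tf (fun th => q th * c th)) = tf (fun th => q th * c th)) ->
    uproj (tf (fun th => f th * c th)) = tf (fun th => f th * c th).
  move=> cc c1 Qc; apply: uproj_closed => e e0.
  have [q Tq Hq] := H e e0; exists (tf (fun th => q th * c th)); first exact: Qc.
  have cq := Tq.1; have cfq := contB cf cq.
  rewrite -tfB; do ?exact: contM.
  rewrite (@tf_ext _ _ (fun th => (f th - q th) * c th)); last by move=> th; ring.
  rewrite -ler_sqr ?nnegrE ?l2norm_ge0 ?(ltW e0) //.
  apply: le_trans (tf_norm _) _; first exact: contM.
  apply: le_trans Hq; apply: sc_le => [||th _]; do ?[by apply: contM; exact: contM|exact: contM].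
  apply: ler_wpM2r; first exact: sqr_ge0.
  have := c1 th; have : 0 <= (f th - q th) * (f th - q th) by rewrite -expr2 sqr_ge0.
  by nra.
have n1 (x : R) : cos x * cos x <= 1 /\ sin x * sin x <= 1.
  have := cos2Dsin2 x; have := sqr_ge0 (cos x); have := sqr_ge0 (sin x); rewrite !expr2; split; lra.
split; apply: main => [|th|q [_ Tq]]; do ?exact: cont_cosn; do ?exact: cont_sinn.
- by case: (n1 (n%:~R * ang th)).
- by case: (Tq n).
- by case: (n1 (n%:~R * ang th)).
- by case: (Tq n).
Qed.

(** [cos th] is approximated by [sin (ang th)] times polynomials in
    [cos (ang th)], in the norm weighted by [sin th]; this is the norm of the
    semicircle law. *)
Lemma trig_twocos f : trig f -> trig (fun th => twocos th * f th).
Proof.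
move=> Tf; have cf := Tf.1; have p0 := @pi_gt0 R.
have cff : continuous (fun th => `|f th|) by move=> x; apply: cvg_norm; exact: cf.
have [xm xmI fmax] := @EVT_max R (fun th => `|f th|) 0 pi (ltW p0) (continuous_subspaceT cff).
set F := `|f xm| in fmax; have F0 : 0 <= F by exact: normr_ge0.
apply: trig_lim => [|e e0]; first by apply: contM => //; exact: cont_twocos.
have F1 : 0 < F + 1 by rewrite ltr_wpDl.
have K0 : 0 < 4 * (F + 1) by rewrite mulr_gt0.
have [p Hp] := cos_approx (divr_gt0 e0 K0).
(* The error in mean square is at most [2 (2 eta F)^2], by [sc_le_cst]. *)
set eta := e / (4 * (F + 1)) in Hp.
have eE : e = eta * (4 * (F + 1)) by rewrite divfK // gt_eqF.
have eta0 : 0 < eta by rewrite divr_gt0.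
pose c th : R := (1 + cos (ang th)) / 2.
pose q th := p.[c th] * (sinn 1 th * (2 * f th)).
have Tq : trig q.
  apply: (poly_comp_ind (P := trig)); [|exact: trigD|exact: trigZ|].
    move=> g Tg; have := trigD (trigZ 2^-1 Tg) (trigZ 2^-1 (trig_cos Tg)).
    by congr trig; apply: funext => th; rewrite /c /cosn mul1r; field.
  by apply: trig_sin; exact: trigZ.
exists q => //; have cq := Tq.1.
have cd : continuous (fun th => twocos th * f th - q th).
  by apply: contB => //; apply: contM => //; exact: cont_twocos.
apply: le_trans (_ : 2 * (2 * eta * F) ^+ 2 <= _); last first.
  rewrite eE; have : 0 <= eta * F by apply: mulr_ge0 => //; exact: ltW.
  have : 0 <= eta by exact: ltW.
  move=> h1 h2; rewrite !mulrDr mulr1; nra.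
apply: sc_le_cst; first exact: contM.
move=> th h; have s0 : 0 <= sin th by exact: sin_ge0_pi.
pose z := (cos th - sin (ang th) * p.[c th]) * sin th.
have Hz : `|z| <= eta by rewrite normrM (ger0_norm s0); exact: Hp th h.
have -> : (twocos th * f th - q th) * (twocos th * f th - q th) * sin th ^+ 2 = (2 * (z * f th)) ^+ 2.
  by rewrite /z /q /twocos /sinn mul1r; ring.
have zf : `|z * f th| <= eta * F.
  by rewrite normrM; apply: ler_pM => //; apply: fmax; rewrite in_itv.
rewrite exprMn -[(z * f th) ^+ 2]real_normK ?num_real // -mulrA exprMn.
apply: ler_wpM2l; first exact: sqr_ge0.
by rewrite ler_sqr ?nnegrE ?normr_ge0 // (le_trans (normr_ge0 (z * f th))).
Qed.

Lemma trigB f g : trig f -> trig g -> trig (fun th => f th - g th).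
Proof.
move=> Tf Tg; have := trigD Tf (trigZ (-1) Tg); congr trig; apply: funext => th.
by rewrite mulN1r.
Qed.

Lemma trig_cheb k : trig (cheb k).
Proof.
suff : trig (cheb k) /\ trig (cheb k.+1) by case.
elim: k => [|k [IH1 IH2]].
  split; first exact: trig1.
  by have := trig_twocos trig1; congr trig; apply: funext => th; rewrite /twocos mulr1.
by split=> //; exact: (trigB (trig_twocos IH2) IH1).
Qed.

Lemma uproj_delta k : uproj (delta R k) = delta R k.
Proof.
have [_ /(_ 0) [+ _]] := trig_cheb k.
rewrite (@tf_ext _ _ (cheb k)) ?tf_cheb // => th.
by rewrite /cosn mul0r cos0 mulr1.
Qed.

(** The Chebyshev polynomials are obtained from 1 by multiplications by
    [2 cos th], so all basis vectors are in the closed span of the powers of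
    [u]. *)
Lemma uexp_total x : synth uexp_orthonormal (coords uexp_orthonormal x) = x.
Proof.
have a : adj uproj uproj.
  move=> f g; rewrite /uproj (adj_sym (coords_synth_adj uexp_orthonormal)).
  by rewrite (coords_synth_adj uexp_orthonormal).
have a1 : adj (id : l2 R nat -> l2 R nat) id by [].
exact: (adj_eq_delta a a1 uproj_delta).
Qed.

End HaarBasis.

Section HaarUnitary.
Variable R : realType.
Local Notation jac := (jacobi R).
Local Notation B := (bop R nat).
Local Notation Om := (delta R 0%N).
Local Notation uexp := (@uexp R).
Local Notation ob := (@uexp_orthonormal R).

Lemma subspace_orbit (X : choiceType) (A : set (bop R X)) (v : l2 R X) : A 1 ->
  subspace [set a v | a in alg_gen A].
Proof.
move=> A1; split.
- by exists ((0 : R[i]) *: (1 : bop R X)); [apply: alg_genZ; exact: sub_alg_gen|rewrite bopZE scale0r].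
- by move=> _ _ [a Aa <-] [b Ab <-]; exists (a + b); [exact: alg_genD|].
- by move=> c _ [a Aa <-]; exists (c *: a); [exact: alg_genZ|].
Qed.

Lemma uexp_ext (S T : B) : (forall n, S (uexp n) = T (uexp n)) -> S = T.
Proof.
move=> ST; have [S' SS] := bop_adjoint S; have [T' TT] := bop_adjoint T.
have comp_adj (V V' : B) : is_adjoint V V' -> adj (fun g => V (synth ob g)) (fun f => coords ob (V' f)).
  by move=> VV f g; rewrite VV (adj_sym (coords_synth_adj ob)).
apply: bopP => f; rewrite -[f](uexp_total f).
apply: (adj_eq_delta (comp_adj _ _ SS) (comp_adj _ _ TT)) => n.
by rewrite synth_delta ST.
Qed.

Lemma uexp_inj (x y : l2 R nat) : (forall m, l2dot x (uexp m) = l2dot y (uexp m)) -> x = y.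
Proof.
move=> xy; rewrite -[x]uexp_total -[y]uexp_total; congr synth.
by apply: l2P => m; exact: xy.
Qed.

Lemma uexp_shift_orthonormal : orthonormal (fun n : int => uexp (n + 1)).
Proof. by move=> n m; rewrite ob (inj_eq (addIr 1)). Qed.
Local Notation ob' := uexp_shift_orthonormal.

(** The bilateral shift of the basis [uexp]. *)
Lemma haar_exists : exists u u' : B,
  [/\ is_adjoint u u', forall n, u (uexp n) = uexp (n + 1) & forall n, u' (uexp n) = uexp (n - 1)].
Proof.
have comp_bop (b b' : int -> l2 R nat) (o : orthonormal b) (o' : orthonormal b') :
    exists v : B, forall f, v f = synth o' (coords o f).
  have l : linear (fun f => synth o' (coords o f)).
    by move=> c f g; rewrite coords_linear synth_linear.
  have bb : bnd (fun f => synth o' (coords o f)).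
    have [M M0 HM] := synth_bnd o'; exists M => // f.
    by apply: le_trans (HM _) _; apply: ler_wpM2l => //; exact: coords_le.
  by have [v Hv] := mk_bop l bb; exists v.
have [u Hu] := comp_bop _ _ ob ob'; have [u' Hu'] := comp_bop _ _ ob' ob.
exists u, u'; split=> [f g|n|n].
- by rewrite Hu Hu' (adj_sym (coords_synth_adj ob')) (coords_synth_adj ob).
- by rewrite Hu coordsb synth_delta.
- rewrite Hu' (_ : uexp n = (fun k : int => uexp (k + 1)) (n - 1)); last by rewrite /= subrK.
  by rewrite coordsb synth_delta.
Qed.

Lemma jacobi_cyclic f : cl [set a Om | a in alg_gen [set 1; jac]] f.
Proof.
have sC : subspace [set a Om | a in alg_gen [set 1; jac]] by apply: subspace_orbit; left.
have A1 : alg_gen [set 1; jac] 1 by apply: sub_alg_gen; left.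
have Aj : alg_gen [set 1; jac] jac by apply: sub_alg_gen; right.
apply: (@cl_delta _ _ _ _ id) => //; first by exists 1 => // g; rewrite mul1r.
move=> k; apply: sub_cl.
suff : (exists2 a, alg_gen [set 1; jac] a & a Om = delta R k) /\
   (exists2 a, alg_gen [set 1; jac] a & a Om = delta R k.+1) by case.
elim: k => [|k [[a Aa aE] [b Ab bE]]].
  by split; [exists 1|exists jac => //; exact: jacobi_delta0].
split; first by exists b.
exists (jac * b + (-1) *: a).
  by apply: alg_genD; [exact: alg_genM|exact: alg_genZ].
by rewrite bopDE bopME bopZE bE aE jacobi_deltaS scaleN1r addrK.
Qed.

(** The vacuum condition gives freeness, and the equality of commutants makes the
    unitary generate the same von Neumann algebra as the Jacobi operator.  For the
    latter, the commutants of the two operators are commutative and contain both. *)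
Theorem haar_unitary : exists u u' : B,
  [/\ is_adjoint u u', u * u' = 1 /\ u' * u = 1,
      forall k, (u ^+ k.+1) Om 0%N = 0 /\ (u' ^+ k.+1) Om 0%N = 0 &
      forall S : B, S * jac = jac * S <-> S * u = u * S].
Proof.
have [u [u' [uu' ue u'e]]] := haar_exists.
have uu : u * u' = 1 by apply: uexp_ext => n; rewrite bopME u'e ue subrK.
have u'u : u' * u = 1 by apply: uexp_ext => n; rewrite bopME ue u'e addrK.
have uX k : (u ^+ k) Om = uexp k%:Z.
  elim: k => [|k IH]; first by rewrite expr0 -uexp0.
  by rewrite exprS bopME IH ue -PoszD addn1.
have u'X k : (u' ^+ k) Om = uexp (- k%:Z).
  elim: k => [|k IH]; first by rewrite expr0 oppr0 -uexp0.
  by rewrite exprS bopME IH u'e -opprD -PoszD addn1.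
have uj : u * jac = jac * u.
  apply: uexp_ext => n; rewrite !bopME ue; apply: uexp_inj => m.
  by rewrite uu' u'e !jac_uexp_dot; congr wmom; rewrite opprB addrA addrAC.
have u'j : u' * jac = jac * u'.
  by rewrite -[LHS]mulr1 -uu mulrA -[u' * jac * u]mulrA -uj mulrA u'u mul1r.
exists u, u'; split=> //.
  have e0 (n : int) : n != 0 -> uexp n 0%N = 0.
    by move=> n0; rewrite -l2dot_delta -uexp0 ob (negPf n0).
  by move=> k; rewrite uX u'X; split; apply: e0; rewrite ?oppr_eq0.
have cyc_u f : cl [set a Om | a in alg_gen [set 1; u; u']] f.
  have A1 : [set 1; u; u'] 1 by left; left.
  have AX k : alg_gen [set 1; u; u'] (u ^+ k).
    elim: k => [|k IH]; first exact: sub_alg_gen.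
    by rewrite exprS; apply: alg_genM => //; apply: sub_alg_gen; left; right.
  have AX' k : alg_gen [set 1; u; u'] (u' ^+ k).
    elim: k => [|k IH]; first exact: sub_alg_gen.
    by rewrite exprS; apply: alg_genM => //; apply: sub_alg_gen; right.
  rewrite -[f]uexp_total.
  apply: (cl_delta (subspace_orbit Om A1) (synth_linear ob) (synth_bnd ob)) => n.
  rewrite synth_delta; apply: sub_cl; case: n => k; first by exists (u ^+ k).
  by rewrite NegzE; exists (u' ^+ k.+1).
have star_u a : [set 1; u; u'] a -> exists2 a', [set 1; u; u'] a' & is_adjoint a a'.
  case=> [[->|->]|->]; first by exists 1 => //; left; left.
    by exists u' => //; right.
  by exists u; [left; right|exact: is_adjoint_sym].
have comm_u a b : [set 1; u; u'] a -> [set 1; u; u'] b -> a * b = b * a.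
  by move=> [[->|->]|->] [[->|->]|->]; rewrite ?mulr1 ?mul1r ?uu ?u'u.
have star_j a : [set 1; jac] a -> exists2 a', [set 1; jac] a' & is_adjoint a a'.
  by case=> ->; [exists 1 => //; left|exists jac; [right|exact: jacobi_adjoint]].
have comm_j a b : [set 1; jac] a -> [set 1; jac] b -> a * b = b * a.
  by move=> [->|->] [->|->]; rewrite ?mulr1 ?mul1r.
move=> S; split=> HS.
  apply: (abelian_commutant comm_j star_j jacobi_cyclic) => a [->|->]; rewrite ?mulr1 ?mul1r //.
apply: (abelian_commutant comm_u star_u cyc_u) => a [[->|->]|->]; rewrite ?mulr1 ?mul1r //.
by rewrite -[LHS]mul1r -u'u -mulrA (mulrA u) -HS -mulrA uu mulr1.
Qed.

End HaarUnitary.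

(** * Compression to the span of an orthonormal family *)

Section Compression.
Variables (R : realType) (X Y : choiceType) (b : Y -> l2 R X).
Hypothesis ob : orthonormal b.
Local Notation C := (coords ob).
Local Notation D := (synth ob).

Lemma compress_exists (T : bop R X) : exists S : bop R Y, forall f, S f = C (T (D f)).
Proof.
have l : linear (fun f => C (T (D f))).
  by move=> c f g; rewrite synth_linear linearP coords_linear.
have bb : bnd (fun f => C (T (D f))).
  have [M M0 HM] := synth_bnd ob; have [K K0 HK] := bop_bnd T.
  exists (K * M) => [|f]; first exact: mulr_ge0.
  apply: le_trans (coords_le ob _) _; apply: le_trans (HK _) _.
  by rewrite -mulrA; apply: ler_wpM2l => //; exact: HM.
by have [S HS] := mk_bop l bb; exists S.
Qed.

Definition compress T : bop R Y := projT1 (cid (compress_exists T)).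

Lemma compressE T f : compress T f = C (T (D f)).
Proof. by rewrite /compress; case: cid => S /= ->. Qed.

Lemma inflate_exists (S : bop R Y) : exists T : bop R X, forall f, T f = D (S (C f)).
Proof.
have l : linear (fun f => D (S (C f))).
  by move=> c f g; rewrite coords_linear linearP synth_linear.
have bb : bnd (fun f => D (S (C f))).
  have [M M0 HM] := synth_bnd ob; have [K K0 HK] := bop_bnd S.
  exists (M * K) => [|f]; first exact: mulr_ge0.
  apply: le_trans (HM _) _; rewrite -mulrA; apply: ler_wpM2l => //.
  by apply: le_trans (HK _) _; apply: ler_wpM2l => //; exact: coords_le.
by have [T HT] := mk_bop l bb; exists T.
Qed.

Definition inflate S : bop R X := projT1 (cid (inflate_exists S)).

Lemma inflateE S f : inflate S f = D (S (C f)).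
Proof. by rewrite /inflate; case: cid => T /= ->. Qed.

Lemma compress_adjoint S T : is_adjoint S T -> is_adjoint (compress S) (compress T).
Proof.
move=> ST f g; rewrite !compressE (coords_synth_adj ob) ST.
by rewrite (adj_sym (coords_synth_adj ob)).
Qed.

End Compression.

Section Unblock.
Variables (R : realType) (X Y Z : choiceType) (em : Y -> X -> Z).
Hypothesis em_inj : forall y x y' x', em y x = em y' x' -> y = y' /\ x = x'.
Local Notation E := (embed em_inj).
Local Notation F := (slice em_inj).

Lemma unblock_exists y y' (T : bop R X) : exists U : bop R Z, forall f, U f = E y (T (F y' f)).
Proof.
have l : linear (fun f => E y (T (F y' f))).
  by move=> c f g; rewrite /slice coords_linear linearP /embed synth_linear.
have bb : bnd (fun f => E y (T (F y' f))).
  have [M M0 HM] := synth_bnd (orthonormal_em R em_inj y); have [K K0 HK] := bop_bnd T.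
  exists (M * K) => [|f]; first exact: mulr_ge0.
  apply: le_trans (HM _) _; rewrite -mulrA; apply: ler_wpM2l => //.
  by apply: le_trans (HK _) _; apply: ler_wpM2l => //; exact: coords_le.
by have [U HU] := mk_bop l bb; exists U.
Qed.

(** The operator whose only nonzero block is [T], in position [(y, y')]; with
    [T = 1] it moves the slice [y'] onto the slice [y]. *)
Definition unblock y y' T : bop R Z := projT1 (cid (unblock_exists y y' T)).

Lemma unblockE y y' T f : unblock y y' T f = E y (T (F y' f)).
Proof. by rewrite /unblock; case: cid => U /= ->. Qed.

Lemma unblock_comm y y' (S T : bop R X) : S * T = T * S ->
  unblock y y' S * amp em_inj T = amp em_inj T * unblock y y' S.
Proof.
move=> ST; apply: bopP => f; rewrite !bopME !unblockE slice_amp amp_embed.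
by rewrite (commE ST).
Qed.

Lemma unblock_delta y y' T x : unblock y y' T (delta R (em y' x)) = E y (T (delta R x)).
Proof. by rewrite unblockE -(embed_delta R em_inj) slice_embed eqxx. Qed.

Lemma unblock_off y y' T z : (forall x, em y' x <> z) -> unblock y y' T (delta R z) = 0.
Proof.
move=> n; rewrite unblockE (_ : F y' _ = 0) ?bop0.
  by rewrite -(bop0 (unblock y y' T)) unblockE /slice (_ : coords _ 0 = 0) ?bop0 //;
     apply: l2P => x; rewrite /= l2dot0l.
by apply: l2P => x; rewrite sliceE /=; case: eqP => // /n.
Qed.

End Unblock.

(** * Paths from the base vertex *)

Section LoopPaths.
Variables (R : realType) (G : digraph) (N : nat) (v0 : vertex G).
Variable ell : 'I_N -> edge G.
Hypothesis ell_inj : injective ell.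
Hypothesis ellP : forall e, loops v0 e <-> exists i, e = ell i.
Local Notation B := (bop R (gpath G)).
Implicit Types (s t : seq (edge G)) (f : l2 R (gpath G)) (i : 'I_N).

Definition isloop (e : edge G) := (esrc e == v0) && (erng e == v0).

Lemma ell_src i : esrc (ell i) = v0.
Proof. by have [] : loops v0 (ell i) by apply/ellP; exists i. Qed.
Lemma ell_rng i : erng (ell i) = v0.
Proof. by have [] : loops v0 (ell i) by apply/ellP; exists i. Qed.
Lemma isloopP e : reflect (exists i, e = ell i) (isloop e).
Proof.
apply: (iffP andP) => [[/eqP a /eqP b]|[i ->]]; first by apply/ellP.
by rewrite ell_src ell_rng.
Qed.

Definition path_from s : gpath G := insubd (vpath v0) (v0, s).

Lemma path_fromE s : admissible v0 s -> gpair (path_from s) = (v0, s).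
Proof. by move=> a; rewrite /path_from insubdK. Qed.
Lemma psrc_path_from s : psrc (path_from s) = v0.
Proof. by rewrite /psrc /path_from val_insubd; case: ifP. Qed.
Lemma pedges_path_from s : admissible v0 s -> pedges (path_from s) = s.
Proof. by move=> a; rewrite /pedges path_fromE. Qed.
Lemma path_from_pedges z : psrc z = v0 -> path_from (pedges z) = z.
Proof.
move=> zv; have a : admissible v0 (pedges z) by rewrite -zv; exact: gpairP z.
by apply: gpathP; rewrite ?psrc_path_from ?pedges_path_from.
Qed.
Lemma path_from_adm z : psrc z = v0 -> admissible v0 (pedges z).
Proof. by move=> <-; exact: gpairP z. Qed.
Lemma path_from_inj s t : admissible v0 s -> admissible v0 t -> path_from s = path_from t -> s = t.
Proof. by move=> /pedges_path_from {2}<- /pedges_path_from {2}<- ->. Qed.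
Lemma path_from_nil : path_from [::] = vpath v0.
Proof. by apply: gpathP; rewrite ?psrc_path_from ?pedges_path_from. Qed.
Lemma adm_ell i s : admissible v0 (ell i :: s) = admissible v0 s.
Proof. by rewrite /= ell_src eqxx ell_rng. Qed.

Definition vproj : B := creation R (vpath v0).
Definition semi i : B := creation R (epath (ell i)) + annihilation R (epath (ell i)).
Local Notation Om := (delta R (vpath v0)).

Lemma vprojE f z : vproj f z = if psrc z == v0 then f z else 0.
Proof.
rewrite /vproj /creation pullE; case e: (lquo _ z) => [h|].
  move/lquoP/pmulP: e => [vk hv eh]; rewrite hv eqxx.
  by congr (f _); apply: gpathP => //; rewrite hv -vk.
case: eqP => // vh; suff: lquo (vpath v0) z = Some z by rewrite e.
by apply/lquoP/pmulP; rewrite vh.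
Qed.

Lemma prng_ell i : prng (epath (ell i)) = v0. Proof. exact: ell_rng. Qed.

Lemma semi_off i f z : psrc z != v0 -> semi i f z = 0.
Proof.
move=> zv; rewrite /semi bopDE l2DE /creation /annihilation !pullE.
case e: (lquo _ z) => [h|].
  by move/lquoP/pmulP: e => [_ zs _]; move: zv; rewrite zs /psrc /= ell_src eqxx.
case e': (pmul _ z) => [h|]; last by rewrite addr0.
by move/pmulP: e' => [zs _ _]; move: zv; rewrite -zs prng_ell eqxx.
Qed.

Lemma pmul_ell i s : admissible v0 s ->
  pmul (epath (ell i)) (path_from s) = Some (path_from (ell i :: s)).
Proof.
move=> a; apply/pmulP; rewrite prng_ell !psrc_path_from !pedges_path_from ?adm_ell //.
by split=> //; rewrite /psrc /= ell_src.
Qed.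

Lemma lquo_ell i s : admissible v0 s -> lquo (epath (ell i)) (path_from s) =
  if s is e :: s' then if e == ell i then Some (path_from s') else None else None.
Proof.
move=> a; case e: (lquo _ _) => [h|].
  move/lquoP/pmulP: e => [hs _]; rewrite pedges_path_from // => sE.
  by rewrite sE /= eqxx path_from_pedges // -hs prng_ell.
case: s a e => // e s a; case: eqP => // el; rewrite el.
move: a; rewrite el adm_ell => /(pmul_ell i) /lquoP -> //.
Qed.

Lemma semiE i f s : admissible v0 s -> semi i f (path_from s) =
  (if s is e :: s' then if e == ell i then f (path_from s') else 0 else 0) +
  f (path_from (ell i :: s)).
Proof.
move=> a; rewrite /semi bopDE l2DE /creation /annihilation !pullE lquo_ell // pmul_ell //.
by congr (_ + _); case: s a => // e s _; case: eqP.
Qed.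

(** A semicircular element lengthens the path by its loop, and also removes that
    loop when the path begins with it. *)
Lemma semi_delta i s : admissible v0 s -> semi i (delta R (path_from s)) =
  delta R (path_from (ell i :: s)) +
  (if s is e :: s' then if e == ell i then delta R (path_from s') else 0 else 0).
Proof.
move=> a; rewrite /semi bopDE creation_delta annihilation_delta pmul_ell // lquo_ell //.
by congr (_ + _); case: s a => // e s _; case: eqP.
Qed.

Lemma vproj_adjoint : is_adjoint vproj vproj.
Proof.
suff E : annihilation R (vpath v0) = vproj by rewrite -{2}E; exact: creation_adjoint.
apply: bopP => f; apply: l2P => z; rewrite vprojE /annihilation pullE.
case e: (pmul _ z) => [h|].
  move/pmulP: e => [zs hs hz]; rewrite -zs eqxx; congr (f _).
  by apply: gpathP => //; rewrite hs -zs.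
case: eqP => // zs; suff: pmul (vpath v0) z = Some z by rewrite e.
by apply/pmulP; split.
Qed.

Lemma semi_adjoint i : is_adjoint (semi i) (semi i).
Proof.
rewrite /semi {2}addrC; apply: is_adjointD; last by apply: is_adjoint_sym; exact: creation_adjoint.
exact: creation_adjoint.
Qed.

Lemma vproj_semi i : vproj * semi i = semi i.
Proof.
apply: bopP => f; apply: l2P => z; rewrite bopME vprojE; case: eqP => // /eqP zv.
by rewrite semi_off.
Qed.

Lemma semi_vproj i : semi i * vproj = semi i.
Proof.
apply: (is_adjoint_inj (S := semi i)); last exact: semi_adjoint.
by rewrite -{1}(vproj_semi i); apply: is_adjointM; [exact: vproj_adjoint|exact: semi_adjoint].
Qed.

Lemma vproj_idem : vproj * vproj = vproj.
Proof. by apply: bopP => f; apply: l2P => z; rewrite bopME !vprojE; case: eqP. Qed.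

(** Every path from [v0] is [l^n t] for one [n] and one path [t] that does not
    begin with the loop [l]. *)
Definition pow_tail i := {s : seq (edge G) | admissible v0 s && (ohead s != Some (ell i))}.
Definition powpath i (y : pow_tail i) (n : nat) : gpath G := path_from (nseq n (ell i) ++ val y).

Lemma adm_nseq i n s : admissible v0 (nseq n (ell i) ++ s) = admissible v0 s.
Proof. by elim: n => //= n IH; rewrite ell_src eqxx ell_rng. Qed.

Lemma powpath_inj i (y : pow_tail i) n y' n' : powpath y n = powpath y' n' -> y = y' /\ n = n'.
Proof.
case: y y' => [t /= Ht] [t' /= Ht']; rewrite /powpath /=.
case/andP: (Ht) => at1 ht; case/andP: (Ht') => at2 ht'.
move/path_from_inj; rewrite !adm_nseq => /(_ at1 at2) e.
suff [tt nn] : t = t' /\ n = n' by split=> //; apply: val_inj.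
elim: n n' e {Ht Ht'} => [|n IH] [|n'] //=.
- by move=> e; move: ht; rewrite e eqxx.
- by move=> e; move: ht'; rewrite -e eqxx.
- by case=> /IH[-> ->].
Qed.

Lemma powpath_cover i z : psrc z = v0 -> exists (y : pow_tail i) n, z = powpath y n.
Proof.
move=> zv; rewrite -(path_from_pedges zv); move: (path_from_adm zv) => a.
have [n [t [e ht]]] : exists n t, pedges z = nseq n (ell i) ++ t /\ ohead t != Some (ell i).
  elim: (pedges z) => [|e s [n [t [-> ht]]]]; first by exists 0%N, [::].
  have [->|ne] := eqVneq e (ell i); first by exists n.+1, t.
  by exists 0%N, (e :: nseq n (ell i) ++ t); split=> //=; apply: contraNneq ne => -[->].
have Ht : admissible v0 t && (ohead t != Some (ell i)).
  by rewrite ht andbT -(adm_nseq i n) -e.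
by exists (exist _ t Ht), n; rewrite /powpath e.
Qed.

Lemma powpath_off i z : psrc z != v0 -> forall (y : pow_tail i) n, powpath y n <> z.
Proof. by move=> zv y n zE; move: zv; rewrite -zE psrc_path_from eqxx. Qed.

Lemma amp_pow_vproj i : amp (@powpath_inj i) 1 = vproj.
Proof.
apply: bopP => f; apply: l2P => z; rewrite vprojE; case: eqP => [zv|/eqP zv].
  by have [y [n ->]] := powpath_cover i zv; rewrite ampE bop_1E sliceE.
by rewrite amp_off //; exact: powpath_off.
Qed.

(** Only the number of leading loops changes, by one up or down. *)
Lemma amp_pow_jacobi i : amp (@powpath_inj i) (jacobi R) = semi i.
Proof.
apply: bopP => f; apply: l2P => z; case: (eqVneq (psrc z) v0) => [zv|zv]; last first.
  by rewrite semi_off // amp_off //; exact: powpath_off.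
have [y [n ->]] := powpath_cover i zv; rewrite ampE.
have /andP[ay hy] := valP y.
case: n => [|n]; rewrite /powpath semiE ?adm_nseq //.
  rewrite jacobi0 sliceE /powpath [X in _ = X + _](_ : _ = 0) ?add0r //.
  by case: (val y) hy => //= e s he; case: eqP => // ee; rewrite ee eqxx in he.
by rewrite jacobiS !sliceE /powpath /= eqxx.
Qed.

(** Every path from [v0] is also, uniquely, a word in the loops followed by a path
    that does not begin with a loop. *)
Definition loopword := {s : seq (edge G) | all isloop s}.
Definition word_tail := {s : seq (edge G) | admissible v0 s && ~~ oapp isloop false (ohead s)}.
Definition wordpath (k : word_tail) (w : loopword) : gpath G := path_from (val w ++ val k).

Lemma adm_loops s t : all isloop s -> admissible v0 (s ++ t) = admissible v0 t.
Proof. by elim: s => //= e s IH /andP[/andP[-> /eqP->]] /IH ->. Qed.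

Lemma wordpath_inj k w k' w' : wordpath k w = wordpath k' w' -> k = k' /\ w = w'.
Proof.
case: k k' w w' => [t /= Ht] [t' /= Ht'] [s Hs] [s' Hs']; rewrite /wordpath /=.
case/andP: (Ht) => at1 ht; case/andP: (Ht') => at2 ht'.
move/path_from_inj; rewrite !adm_loops // => /(_ at1 at2) e.
suff [tt ss] : t = t' /\ s = s' by split; apply: val_inj.
move: Hs Hs'; elim: s s' e {Ht Ht'} => [|e s IH] [|e' s'] //=.
- by move=> e; move: ht; rewrite e /= => /negP ht _ /andP[].
- by move=> e1; move: ht'; rewrite -e1 /= => /negP ht' /andP[].
- by case=> -> /IH H /andP[_ a] /andP[_ a']; have [-> ->] := H a a'.
Qed.

Lemma wordpath_cover z : psrc z = v0 -> exists k w, z = wordpath k w.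
Proof.
move=> zv; rewrite -(path_from_pedges zv); move: (path_from_adm zv) => a.
have [s [t [e Hs ht]]] : exists s t, [/\ pedges z = s ++ t, all isloop s & ~~ oapp isloop false (ohead t)].
  elim: (pedges z) => [|e s [s' [t [-> Hs ht]]]]; first by exists [::], [::].
  have [le|nle] := boolP (isloop e); first by exists (e :: s'), t; rewrite /= le.
  by exists [::], (e :: s' ++ t).
have Ht : admissible v0 t && ~~ oapp isloop false (ohead t).
  by rewrite ht andbT -(adm_loops _ Hs) -e.
by exists (exist _ t Ht), (exist _ s Hs); rewrite /wordpath e.
Qed.

Lemma wordpath_off z : psrc z != v0 -> forall k w, wordpath k w <> z.
Proof. by move=> zv k w zE; move: zv; rewrite -zE psrc_path_from eqxx. Qed.

Lemma amp_word_vproj : amp wordpath_inj 1 = vproj.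
Proof.
apply: bopP => f; apply: l2P => z; rewrite vprojE; case: eqP => [zv|/eqP zv].
  by have [k [w ->]] := wordpath_cover zv; rewrite ampE bop_1E sliceE.
by rewrite amp_off //; exact: wordpath_off.
Qed.

Lemma no_tail_subproof : admissible v0 [::] && ~~ oapp isloop false (ohead ([::] : seq (edge G))).
Proof. by []. Qed.
Definition no_tail : word_tail := exist _ [::] no_tail_subproof.

Lemma empty_word_subproof : all isloop ([::] : seq (edge G)). Proof. by []. Qed.
Definition empty_word : loopword := exist _ [::] empty_word_subproof.

Lemma wordpath_no_tail w : wordpath no_tail w = path_from (val w).
Proof. by rewrite /wordpath cats0. Qed.

Lemma wordpath_vertex : wordpath no_tail empty_word = vpath v0. Proof. exact: path_from_nil. Qed.

(** A loop added to, or removed from, the beginning of a path never touches the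
    tail that follows the loop word. *)
Lemma semi_amp_word i : exists s : bop R loopword, semi i = amp wordpath_inj s.
Proof.
exists (block wordpath_inj (semi i) no_tail no_tail).
apply: bopP => f; apply: l2P => z; case: (eqVneq (psrc z) v0) => [zv|zv]; last first.
  by rewrite semi_off // amp_off //; exact: wordpath_off.
have [k [w ->]] := wordpath_cover zv; rewrite ampE blockE sliceE.
have /andP[ak hk] := valP k.
have Hl j w' : all isloop (val (w' : loopword)) -> all isloop (ell j :: val w').
  by move=> /= ->; rewrite andbT; apply/isloopP; exists j.
have key (k1 : word_tail) (w1 : loopword) g : semi i g (wordpath k1 w1) =
  (if val w1 is e :: s' then if e == ell i then g (path_from (s' ++ val k1)) else 0 else 0) +
  g (path_from (ell i :: val w1 ++ val k1)).
  case: k1 => t Ht; case: w1 => s Hs; case/andP: (Ht) => a1 h1.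
  rewrite /wordpath semiE ?adm_loops //; congr (_ + _).
  case: s Hs => [|e s] Hs //; case: t Ht h1 a1 => [|e s] Ht h1 a1 //=.
  by case: eqP => // ee; case/negP: h1; apply/isloopP; exists i.
rewrite !key.
have slice_k (s : seq (edge G)) : all isloop s ->
   f (path_from (s ++ val k)) =
     embed wordpath_inj no_tail (slice wordpath_inj k f) (path_from (s ++ val no_tail)).
  move=> Hs; have := embedE wordpath_inj no_tail (slice wordpath_inj k f) no_tail (exist _ s Hs).
  by rewrite eqxx sliceE /wordpath /= => ->.
congr (_ + _); last exact: (slice_k (ell i :: val w) (Hl i w (valP w))).
have := valP w; case: (val w) => //= e s /andP[_ Hs].
by case: eqP => // _; exact: slice_k.
Qed.

End LoopPaths.

(** * Freeness and the isomorphism *)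

Section Freeness.
Variables (R : realType) (G : digraph) (N : nat) (v0 : vertex G).
Variable ell : 'I_N -> edge G.
Hypothesis ell_inj : injective ell.
Hypothesis ellP : forall e, loops v0 e <-> exists i, e = ell i.
Local Notation B := (bop R (gpath G)).
Local Notation Om := (delta R (vpath v0)).
Local Notation vproj := (vproj R v0).
Local Notation semi := (semi R ell).
Local Notation pow i := (powpath (ell := ell) (v0 := v0) (i := i)).
Local Notation powinj i := (powpath_inj ellP (i := i)).
Implicit Types (f : l2 R (gpath G)) (i : 'I_N) (a b : letter N) (s t : seq (letter N)).

Variables u u' : bop R nat.
Hypothesis uu' : is_adjoint u u'.
Hypothesis uK : u * u' = 1.
Hypothesis u'K : u' * u = 1.
Hypothesis u0 : forall k, (u ^+ k.+1) (delta R 0%N) 0%N = 0 /\ (u' ^+ k.+1) (delta R 0%N) 0%N = 0.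
Hypothesis u_jacobi : forall S : bop R nat, S * jacobi R = jacobi R * S <-> S * u = u * S.

Definition hu (x : bool) := if x then u' else u.
(** The Haar unitary of the corner of [vproj] that generates the same von Neumann
    algebra as the semicircular element [semi a.1], or its inverse according to the
    sign of the letter. *)
Definition U a : B := amp (powinj a.1) (hu a.2).

Lemma hu_adj x : is_adjoint (hu x) (hu (~~ x)).
Proof. by case: x => //=; exact: is_adjoint_sym. Qed.

Lemma U_adj a : is_adjoint (U a) (U (linv a)).
Proof. by apply: is_adjoint_amp; exact: hu_adj. Qed.

Lemma UK a : U a * U (linv a) = vproj.
Proof.
rewrite /U /linv /= -ampM (_ : hu a.2 * hu (~~ a.2) = 1) ?amp_pow_vproj //.
by case: a.2.
Qed.

Lemma vproj_U a : vproj * U a = U a.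
Proof. by rewrite /U -(amp_pow_vproj R ellP a.1) -ampM mul1r. Qed.

(** Together with [comm_U_semi], this says that the semicircular elements and the
    unitaries [U] have the same commutant in the presence of [vproj]. *)
Lemma comm_semi_U (S : B) : S * vproj = vproj * S -> (forall i, S * semi i = semi i * S) ->
  forall a, S * U a = U a * S.
Proof.
move=> Sp Ss a.
have H : S * amp (powinj a.1) u = amp (powinj a.1) u * S.
  apply: (@amp_bicomm _ _ _ _ _ (powinj a.1) (jacobi R)); first by move=> V /u_jacobi.
    by rewrite amp_pow_vproj.
  by rewrite amp_pow_jacobi.
rewrite /U /hu; case: (a.2) => //.
apply: (@amp_bicomm _ _ _ _ _ (powinj a.1) u) => //; last by rewrite amp_pow_vproj.
move=> V Vu; rewrite -[LHS]mul1r -u'K -mulrA (mulrA u) -Vu -mulrA uK mulr1 //.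
Qed.

Lemma comm_U_semi (S : B) : S * vproj = vproj * S -> (forall a, S * U a = U a * S) ->
  forall i, S * semi i = semi i * S.
Proof.
move=> Sp SU i; rewrite -(amp_pow_jacobi R ellP i).
apply: (@amp_bicomm _ _ _ _ _ (powinj i) u); first by move=> V /u_jacobi.
  by rewrite amp_pow_vproj.
exact: SU (i, false).
Qed.

Definition uvec s := foldr (fun a f => U a f) Om s.

Lemma vproj_Om : vproj Om = Om.
Proof.
by apply: l2P => z; rewrite vprojE; case: eqP => // zv /=; case: eqP => // zE; rewrite zE in zv.
Qed.

Lemma vproj_uvec s : vproj (uvec s) = uvec s.
Proof.
by case: s => [|a s]; [exact: vproj_Om|exact: (congr1 (fun T : B => T (uvec s)) (vproj_U a))].
Qed.

Lemma uvec_push a s : U a (uvec s) = uvec (push a s).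
Proof.
case: s => [|b s] //=; case: eqP => [->|] //.
by rewrite -[RHS]vproj_uvec; exact: (congr1 (fun T : B => T (uvec s)) (UK a)).
Qed.

Lemma uvec_mul s t : foldr (fun a f => U a f) (uvec t) s = uvec (word_mul s t).
Proof. by elim: s => //= a s ->; rewrite uvec_push. Qed.

Lemma U_foldr_adj s f g : l2dot (foldr (fun a f => U a f) f s) g =
  l2dot f (foldr (fun a f => U a f) g (word_inv s)).
Proof.
elim: s g => //= a s IH g; rewrite U_adj IH /word_inv /= rev_cons -cats1 foldr_cat //.
Qed.

Definition starts i (z : gpath G) := ohead (pedges z) == Some (ell i).

Lemma starts_powpath i y n : starts i (pow i y n.+1).
Proof.
have /andP[ay _] := valP y.
by rewrite /starts /powpath pedges_path_from ?adm_nseq //= eqxx.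
Qed.

Lemma slice_nostart i y f : (forall z, starts i z -> f z = 0) ->
  slice (powinj i) y f = f (pow i y 0%N) *: delta R 0%N.
Proof.
move=> f0; apply: l2P => -[|n]; rewrite sliceE l2ZE /= ?mulr1 //.
by rewrite mulr0; apply: f0; exact: starts_powpath.
Qed.

(** Freeness, by induction on the word.  If the second letter belongs to
    the same loop, it is the same letter since the word is reduced, and the
    exponent increases.  If it belongs to another loop, the remaining vector has
    no component at paths beginning with the loop of [a], so its slice is a
    multiple of [xi_0].  That support property is the induction hypothesis at
    paths with no leading loop, where the coefficient is a vacuum coefficient of
    a nonzero power of the Haar unitary. *)
Lemma uvec_slice a s : reduced (a :: s) -> forall y, exists c m,
  slice (powinj a.1) y (uvec (a :: s)) = c *: (hu a.2 ^+ m.+1) (delta R 0%N).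
Proof.
have support b t y' : (forall y, exists c m,
    slice (powinj b.1) y (uvec (b :: t)) = c *: (hu b.2 ^+ m.+1) (delta R 0%N)) ->
    ~~ starts b.1 y' -> uvec (b :: t) y' = 0.
  move=> H ns; case: (eqVneq (psrc y') v0) => [yv|yv]; last first.
    by rewrite -vproj_uvec vprojE (negPf yv).
  have [y [n yE]] := powpath_cover ellP b.1 yv.
  case: n yE => [|n] yE; last by move: ns; rewrite yE starts_powpath.
  have [c [m /(congr1 (fun g : l2 R nat => g 0%N))]] := H y.
  rewrite sliceE yE l2ZE => ->; have [z0 z1] := u0 m.
  by rewrite /hu; case: b.2; rewrite ?z0 ?z1 mulr0.
elim: s a => [|b s IH] a rs y.
  exists (Om (pow a.1 y 0%N)), 0%N; rewrite expr1 /= slice_amp slice_nostart ?linearZ //.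
  by move=> z sz /=; case: eqP => // zE; rewrite zE in sz.
rewrite [uvec (a :: b :: s)]/(U a (uvec (b :: s))) slice_amp.
have /= /andP[ba rs'] := rs.
have [ab|ab] := eqVneq b.1 a.1.
  case: a b ab ba IH rs y rs' => [i ax] [j bx] /= ji; subst j => ba IH rs y rs'.
  have -> : ax = bx.
    by move: ba; rewrite /linv /= xpair_eqE eqxx /=; case: (ax); case: (bx).
  have [c [m /= ->]] := IH (i, bx) rs' y.
  by exists c, m.+1; rewrite linearZ (exprS _ m.+1).
rewrite slice_nostart; first by exists (uvec (b :: s) (pow a.1 y 0%N)), 0%N; rewrite expr1 linearZ.
move=> z sz; apply: support; first exact: IH rs'.
rewrite /starts (eqP sz); apply: contraNneq ab => -[/ell_inj ->] //.
Qed.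

Lemma uvec_vacuum s : reduced s -> uvec s (vpath v0) = (s == [::])%:R.
Proof.
case: s => [|a s] rs; first by rewrite /= eqxx.
have [y [n vE]] := powpath_cover ellP a.1 (erefl (psrc (vpath v0))).
case: n vE => [|n] vE; last first.
  by have := starts_powpath y n; rewrite /starts -vE.
have [c [m /(congr1 (fun g : l2 R nat => g 0%N))]] := uvec_slice rs y.
rewrite sliceE -vE l2ZE => ->; have [z0 z1] := u0 m.
by rewrite /hu; case: a.2; rewrite ?z0 ?z1 mulr0.
Qed.

Definition gvec (g : free_group N) := uvec (fword g).

(** [<U_g Om, U_h Om> = <Om, U_(g^-1 h) Om>], a vacuum coefficient. *)
Lemma gvec_orthonormal : orthonormal gvec.
Proof.
move=> g h; rewrite /gvec {1}/uvec U_foldr_adj uvec_mul l2dot_delta_l.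
have -> : word_mul (word_inv (fword g)) (fword h) = fword (g^-1 * h)%g by [].
rewrite uvec_vacuum; last exact: fwordP.
have -> : (fword (g^-1 * h)%g == [::]) = (g == h).
  rewrite -[[::]]/(fword (1%g : free_group N)) (inj_eq val_inj).
  by apply/eqP/eqP => [e|->]; [rewrite -[h](mulVKg g) e mulg1|rewrite mulVg].
by case: eqP => _; rewrite ?conjc1 ?conjc0.
Qed.
Local Notation og := gvec_orthonormal.
Local Notation C := (coords og).
Local Notation D := (synth og).

Lemma gletter_subproof a : reduced [:: a]. Proof. by []. Qed.
Definition gletter a : free_group N := FreeWord (gletter_subproof a).

Lemma ltrans_adj (g : free_group N) : is_adjoint (ltrans R g) (ltrans R g^-1%g).
Proof.
have -> : ltrans R (g^-1)%g = pull R (psi_inj (ltrans_subproof g)).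
  by apply: bopP => f; apply: l2P => h; rewrite /ltrans !pullE invgK.
exact: pull_adjoint.
Qed.

Lemma gletter_inv a : ((gletter a)^-1)%g = gletter (linv a). Proof. exact: val_inj. Qed.

(** The isometry [D] intertwines the left translations and the unitaries [U]. *)
Lemma D_ltrans a h : D (ltrans R (gletter a) h) = U a (D h).
Proof.
have a1 : adj (fun h => D (ltrans R (gletter a) h)) (fun f => ltrans R (gletter a)^-1%g (C f)).
  by move=> x y; rewrite (adj_sym (coords_synth_adj og)) ltrans_adj.
have a2 : adj (fun h => U a (D h)) (fun f => C (U (linv a) f)).
  by move=> x y; rewrite U_adj (adj_sym (coords_synth_adj og)).
apply: (adj_eq_delta a1 a2) => k.
by rewrite ltrans_delta !synth_delta /gvec uvec_push.
Qed.

Lemma C_U a f : C (U a f) = ltrans R (gletter a) (C f).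
Proof.
apply: l2dot_inj => h.
rewrite (coords_synth_adj og) U_adj -D_ltrans -gletter_inv.
by rewrite -(coords_synth_adj og) ltrans_adj.
Qed.

Lemma vproj_D h : vproj (D h) = D h.
Proof.
have a1 : adj (fun h => vproj (D h)) (fun f => C (vproj f)).
  by move=> x y; rewrite vproj_adjoint (adj_sym (coords_synth_adj og)).
apply: (adj_eq_delta a1 (adj_sym (coords_synth_adj og))) => k.
by rewrite !synth_delta /gvec vproj_uvec.
Qed.

Lemma C_vproj f : C (vproj f) = C f.
Proof.
by apply: l2dot_inj => h; rewrite !(coords_synth_adj og) vproj_adjoint vproj_D.
Qed.

Lemma ltransM (g h : free_group N) : ltrans R (g * h)%g = ltrans R g * ltrans R h.
Proof. by apply: bop_eq_delta => k; rewrite bopME !ltrans_delta mulgA. Qed.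

Lemma ltrans1 : ltrans R (1%g : free_group N) = 1.
Proof. by apply: bop_eq_delta => k; rewrite ltrans_delta mul1g. Qed.

Lemma ltrans_comm (S : bop R (free_group N)) :
  (forall a, S * ltrans R (gletter a) = ltrans R (gletter a) * S) ->
  forall g, S * ltrans R g = ltrans R g * S.
Proof.
move=> Sa [s rs]; elim: s rs => [|a s IH] rs.
  by rewrite (_ : FreeWord rs = 1%g) ?ltrans1 ?mulr1 ?mul1r //; exact: val_inj.
have rs' : reduced s by exact: path_sorted rs.
have -> : FreeWord rs = (gletter a * FreeWord rs')%g.
  by apply: val_inj => /=; case: s rs {IH rs'} => [|b s] //= /andP[/negPf -> _].
by rewrite ltransM [LHS]mulrA Sa -[LHS]mulrA IH mulrA.
Qed.

(** [S |-> D S D^*] maps the commutant of the left translations into the commutant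
    of the loop algebra, and [compress_comm] is the converse passage. *)
Lemma inflate_comm (S : bop R (free_group N)) :
  (forall g, S * ltrans R g = ltrans R g * S) ->
  inflate og S * vproj = vproj * inflate og S /\
  forall i, inflate og S * semi i = semi i * inflate og S.
Proof.
move=> SL; have Ip : inflate og S * vproj = vproj * inflate og S.
  by apply: bopP => f; rewrite !bopME !inflateE vproj_D C_vproj.
split=> //; apply: comm_U_semi => // a; apply: bopP => f.
by rewrite !bopME !inflateE C_U (commE (SL _)) D_ltrans.
Qed.

Lemma compress_comm (W : B) : W * vproj = vproj * W -> (forall i, W * semi i = semi i * W) ->
  forall g, compress og W * ltrans R g = ltrans R g * compress og W.
Proof.
move=> Wp Ws; apply: ltrans_comm => a; apply: bopP => h.
by rewrite !bopME !compressE D_ltrans (commE (comm_semi_U Wp Ws a)) C_U.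
Qed.

(** The semicircular element as an operator on loop words alone. *)
Definition semi_word i : bop R (loopword v0) := projT1 (cid (semi_amp_word R ellP i)).
Lemma semi_wordE i : semi i = amp (wordpath_inj (v0 := v0)) (semi_word i).
Proof. by rewrite /semi_word; case: cid. Qed.
Local Notation wordpath := (wordpath (v0 := v0)).
Local Notation wordinj := (wordpath_inj (v0 := v0)).
Local Notation no_tail := (no_tail v0).
Local Notation E := (embed (R := R) wordinj).
Local Notation F := (slice (R := R) wordinj).

Lemma unblock_word_comm k k' (T : bop R (loopword v0)) :
  (forall i, T * semi_word i = semi_word i * T) ->
  unblock wordinj k k' T * vproj = vproj * unblock wordinj k k' T /\
  forall i, unblock wordinj k k' T * semi i = semi i * unblock wordinj k k' T.
Proof.
move=> Ts; split=> [|i]; last by rewrite semi_wordE; exact: unblock_comm.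
by rewrite -amp_word_vproj; apply: unblock_comm; rewrite mulr1 mul1r.
Qed.

(** The projection onto the span of the loop words, as opposed to [ran_proj],
    the projection onto the range of [D]; the two are equal. *)
Definition word_proj : B := unblock wordinj no_tail no_tail 1.

Lemma word_proj_comm : word_proj * vproj = vproj * word_proj /\
  forall i, word_proj * semi i = semi i * word_proj.
Proof. by apply: unblock_word_comm => i; rewrite mulr1 mul1r. Qed.

Lemma word_projE f : word_proj f = E no_tail (F no_tail f).
Proof. by rewrite /word_proj unblockE. Qed.

Lemma unblock_word_delta k k' w :
  unblock wordinj k k' 1 (delta R (wordpath k' w)) = delta R (wordpath k w).
Proof. by rewrite unblock_delta (bop_1E (delta R w)) embed_delta. Qed.

Lemma word_proj_delta w : word_proj (delta R (wordpath no_tail w)) = delta R (wordpath no_tail w).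
Proof. exact: unblock_word_delta. Qed.

Lemma word_proj_Om : word_proj Om = Om.
Proof. by rewrite -(wordpath_vertex v0) word_proj_delta. Qed.

Lemma word_proj_uvec s : word_proj (uvec s) = uvec s.
Proof.
have [Pp Ps] := word_proj_comm.
elim: s => [|a s IH]; first exact: word_proj_Om.
by rewrite /= (commE (comm_semi_U Pp Ps a)) IH.
Qed.

(** [Om] is fixed by [word_proj], which commutes with the unitaries [U]. *)
Lemma uvec_off s z : (forall w, wordpath no_tail w <> z) -> uvec s z = 0.
Proof.
move=> zo; rewrite -word_proj_uvec word_projE; case: (em_invP wordpath z) => [[k [w zE]]|[_ n]].
  rewrite zE embedE; case: eqP => // kE; by case: (zo w); rewrite zE kE.
exact: embed_off.
Qed.

Definition ran_proj : B := inflate og 1.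
Lemma ran_projE f : ran_proj f = D (C f). Proof. by rewrite /ran_proj inflateE. Qed.

Lemma ran_proj_comm : ran_proj * vproj = vproj * ran_proj /\
  forall i, ran_proj * semi i = semi i * ran_proj.
Proof. by apply: inflate_comm => g; rewrite mulr1 mul1r. Qed.

(** By induction on the length: [semi i] maps the word [w] to [l_i w] plus a
    shorter word, and [ran_proj] commutes with [semi i]. *)
Lemma ran_proj_loop (s : seq (edge G)) : all (isloop v0) s ->
  ran_proj (delta R (path_from v0 s)) = delta R (path_from v0 s).
Proof.
have [n] := ubnP (size s); elim: n s => // n IH [|e s] /=.
  move=> _ _; have gO : gvec 1%g = delta R (path_from v0 [::]) by rewrite path_from_nil.
  by rewrite -gO ran_projE coordsb synth_delta.
rewrite ltnS => sn /andP[/(isloopP ellP) [i ->] ls].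
have as_ : admissible v0 s by rewrite -[s]cats0 adm_loops.
have [_ Qs] := ran_proj_comm.
have := commE (Qs i) (delta R (path_from v0 s)); rewrite IH // (semi_delta R ellP i as_) linearD.
set x := (X in _ + ran_proj X = _).
suff -> : ran_proj x = x by move/addIr.
rewrite /x; case: s sn ls {as_ x} => [|e' s] sn ls; first by rewrite bop0.
case: eqP => _; last by rewrite bop0.
by apply: IH; [exact: ltnW|case/andP: ls].
Qed.

Lemma ran_proj_off z : (forall w, wordpath no_tail w <> z) -> ran_proj (delta R z) = 0.
Proof.
move=> zo; rewrite ran_projE; have -> : C (delta R z) = 0.
  apply: l2P => g; transitivity (l2dot (delta R z) (gvec g)); first by [].
  by rewrite l2dot_delta_l uvec_off // conjc0.
have := synth_linear og (-1) 0 0.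
by rewrite scaler0 addr0 scaleN1r addNr.
Qed.

Lemma ran_proj_word : ran_proj = word_proj.
Proof.
apply: bop_eq_delta => z; case: (pselect (exists w, wordpath no_tail w = z)) => [[w <-]|zn].
  rewrite word_proj_delta wordpath_no_tail; apply: ran_proj_loop; exact: (valP w).
have zo w : wordpath no_tail w <> z by move=> e; apply: zn; exists w.
by rewrite ran_proj_off // /word_proj unblock_off.
Qed.

Definition loop_set : set B := creation R (vpath v0) |` loop_gen R v0.

Let isqrt2 : R[i] := ((Num.sqrt (2 : R))^-1)%:C%C.
Let isqrt2_neq0 : isqrt2 != 0.
Proof.
apply/eqP => /complexI /eqP; rewrite invr_eq0 sqrtr_eq0 => h.
by have := lt_le_trans (ltr0Sn R 1) h; rewrite ltxx.
Qed.

Lemma loop_setP (S : B) : (forall a : B, loop_set a -> S * a = a * S) <->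
  (S * vproj = vproj * S /\ forall i, S * semi i = semi i * S).
Proof.
split=> [H|[Sp Ss] _ [->|[e el <-]]] //.
  split=> [|i]; first by apply: H; left.
  have : S * (isqrt2 *: semi i) = (isqrt2 *: semi i) * S.
    apply: H; right; exists (ell i) => //; apply/ellP; by exists i.
  rewrite bopMZr bopMZl => /(congr1 (fun T => isqrt2^-1 *: T)).
  by rewrite !scalerA mulVf // !scale1r.
have /ellP[i ->] := el; rewrite bopMZr bopMZl; congr (_ *: _); exact: Ss.
Qed.

Lemma loop_set_unit (a : B) : loop_set a -> vproj * a = a /\ a * vproj = a.
Proof.
case=> [->|[e /ellP[i ->] <-]]; first by split; exact: vproj_idem.
by rewrite bopMZr bopMZl; split; congr (_ *: _); [exact: vproj_semi|exact: semi_vproj].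
Qed.

Lemma loop_set_star (a : B) : loop_set a -> exists2 a', loop_set a' & is_adjoint a a'.
Proof.
case=> [->|[e el <-]]; first by exists vproj; [left|exact: vproj_adjoint].
have /ellP[i eE] := el; exists (isqrt2 *: semi i); first by right; exists e; rewrite // eE.
have isqrt2J : isqrt2^*%C = isqrt2 by rewrite /isqrt2 conjc_real.
have : is_adjoint (isqrt2 *: semi i) (isqrt2^*%C *: semi i) by apply: is_adjointZ; exact: semi_adjoint.
by rewrite isqrt2J eE.
Qed.

Lemma loop_alg_comm (a S : B) : loop_alg R v0 a -> S * vproj = vproj * S ->
  (forall i, S * semi i = semi i * S) -> S * a = a * S.
Proof.
by move=> La Sp Ss; apply: (wot_comm (A := loop_set)) => //; apply/loop_setP.
Qed.

(** The double commutant theorem, in the form in which elements of the loop algebra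
    are produced. *)
Lemma loop_alg_bicomm (T : B) : T * vproj = T ->
  (forall S : B, S * vproj = vproj * S -> (forall i, S * semi i = semi i * S) -> S * T = T * S) ->
  loop_alg R v0 T.
Proof.
move=> Tp TS; apply: (bicommutant (A := loop_set) (e := vproj)) => //.
- by left.
- exact: loop_set_unit.
- exact: loop_set_star.
- by move=> S /loop_setP[]; exact: TS.
Qed.

Lemma group_vN_comm (b S : bop R (free_group N)) : group_vN R (free_group N) b ->
  (forall g, S * ltrans R g = ltrans R g * S) -> S * b = b * S.
Proof.
move=> Gb SL.
by apply: (wot_comm (A := range (ltrans R (Gamma := free_group N)))) => // _ [g _ <-].
Qed.

Lemma group_vN_bicomm (T : bop R (free_group N)) :
  (forall S : bop R (free_group N), (forall g, S * ltrans R g = ltrans R g * S) -> S * T = T * S) ->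
  group_vN R (free_group N) T.
Proof.
move=> TS; apply: (bicommutant (A := range (ltrans R (Gamma := free_group N))) (e := 1)).
- by exists 1%g => //; exact: ltrans1.
- by move=> a _; rewrite mulr1 mul1r.
- by move=> _ [g _ <-]; exists (ltrans R g^-1%g); [exists g^-1%g|exact: ltrans_adj].
- by rewrite mulr1.
- by move=> S SL; apply: TS => g; apply: SL; exists g.
Qed.

Lemma loop_alg_vproj (a : B) : loop_alg R v0 a -> vproj * a = a /\ a * vproj = a.
Proof.
move=> La; split.
  by apply: (wot_unitl (A := loop_set)) La => x /loop_set_unit[].
by apply: (wot_unitr (A := loop_set)) La => x /loop_set_unit[].
Qed.

Lemma loop_alg_ran_proj (a : B) : loop_alg R v0 a -> ran_proj * a = a * ran_proj.
Proof. by have [? ?] := ran_proj_comm; move=> La; apply: loop_alg_comm. Qed.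

(** If [S] commutes with the left translations, then [D S D^*] commutes with [a];
    compressing this identity shows that [S] commutes with [D^* a D]. *)
Lemma compress_group_vN (a : B) : loop_alg R v0 a -> group_vN R (free_group N) (compress og a).
Proof.
move=> La; apply: group_vN_bicomm => S SL; have [Ip Is] := inflate_comm SL.
have := loop_alg_comm La Ip Is => Ia.
apply: bopP => h; rewrite !bopME !compressE.
have := congr1 C (commE Ia (D h)); rewrite !inflateE !synthK //.
Qed.

(** The compression determines [a] on loop words.  The operator that appends a
    given tail to loop words commutes with [a] and so determines [a] on all paths
    from [v0]. *)
Lemma compress_inj (a b : B) : loop_alg R v0 a -> loop_alg R v0 b ->
  compress og a = compress og b -> a = b.
Proof.
move=> La Lb ab.
have aQ : a * ran_proj = b * ran_proj.
  have key x : loop_alg R v0 x -> x * ran_proj = inflate og (compress og x).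
    move=> Lx; apply: bopP => f; rewrite inflateE compressE -!ran_projE bopME.
    by rewrite (commE (loop_alg_ran_proj Lx)) !ran_projE synthK.
  by rewrite !key // ab.
apply: bop_eq_delta => z; case: (eqVneq (psrc z) v0) => [zv|zv]; last first.
  have pz : vproj (delta R z) = 0.
    apply: l2P => z'; rewrite vprojE /=; case: eqP => // zv'; case: eqP => // zz.
    by rewrite -zz zv' eqxx in zv.
  have [_ <-] := loop_alg_vproj La; have [_ <-] := loop_alg_vproj Lb.
  by rewrite !bopME pz !bop0.
have [k [w ->]] := wordpath_cover zv.
have Rk : delta R (wordpath k w) = unblock wordinj k no_tail 1 (delta R (wordpath no_tail w)).
  by rewrite unblock_word_delta.
have [|Rp Rs] := @unblock_word_comm k no_tail 1; first by move=> i; rewrite mulr1 mul1r.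
rewrite Rk -(commE (loop_alg_comm La Rp Rs)) -(commE (loop_alg_comm Lb Rp Rs)); congr (unblock _ _ _ _ _).
have <- : ran_proj (delta R (wordpath no_tail w)) = delta R (wordpath no_tail w).
  by rewrite ran_proj_word word_proj_delta.
exact: (congr1 (fun T : B => T (delta R (wordpath no_tail w))) aQ).
Qed.

(** The preimage of [b] is [D b D^*], viewed on loop words and amplified over all
    tails.  Let [S] commute with the loop algebra and let [V] be one of its blocks
    with respect to tails.  Then [V] placed on the loop words without tail commutes
    with the loop algebra, so its compression commutes with [b], and [V] commutes
    with [D b D^*].  Hence [S] commutes with the amplification. *)
Lemma compress_surj (b : bop R (free_group N)) : group_vN R (free_group N) b ->
  exists2 a, loop_alg R v0 a & compress og a = b.
Proof.
move=> Gb; pose T := inflate og b; pose Bw := block wordinj T no_tail no_tail.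
have BwE g : Bw g = F no_tail (T (E no_tail g)) by rewrite /Bw blockE.
have EF f : E no_tail (F no_tail f) = ran_proj f by rewrite ran_proj_word word_projE.
have FE g : F no_tail (E no_tail g) = g by rewrite slice_embed eqxx.
have QT f : ran_proj (T f) = T f by rewrite ran_projE /T inflateE synthK.
have QD h : ran_proj (D h) = D h by rewrite ran_projE synthK.
exists (amp wordinj Bw); last first.
  apply: bopP => h; rewrite compressE -QD -EF amp_embed BwE !EF QT QD.
  by rewrite /T inflateE !synthK.
apply: loop_alg_bicomm; first by rewrite -amp_word_vproj -ampM mulr1.
move=> S Sp Ss; apply: comm_block; first by rewrite amp_word_vproj.
move=> k k'; set V := block wordinj S k k'.
have Vs i : V * semi_word i = semi_word i * V by apply: block_comm; rewrite -semi_wordE.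
pose W := unblock wordinj no_tail no_tail V.
have [Wp Ws] := unblock_word_comm no_tail no_tail Vs.
have WE f : W f = E no_tail (V (F no_tail f)) by rewrite /W unblockE.
have bW := commE (group_vN_comm Gb (compress_comm Wp Ws)).
have QW f : ran_proj (W f) = W f by rewrite WE -EF FE.
have WQ f : W (ran_proj f) = W f by rewrite !WE -EF FE.
have TW f : W (T f) = T (W f).
  rewrite -[LHS]QW ran_projE /T !inflateE.
  have := bW (C f); rewrite !compressE -/W => ->.
  by rewrite -ran_projE WQ.
apply: bopP => g.
have e : V (F no_tail (T (E no_tail g))) = F no_tail (T (E no_tail (V g))).
  have := congr1 (F no_tail) (TW (E no_tail g)).
  by rewrite (WE (T (E no_tail g))) (WE (E no_tail g)) (FE g) FE.
exact: etrans (congr1 V (BwE g)) (etrans e (esym (BwE (V g)))).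
Qed.

(** As [D xi_1 = Om], the trace of the compression is the coefficient of [a] at
    [v0]; the other diagonal coefficients vanish because [p a = a]. *)
Lemma compress_trace (a : B) : loop_alg R v0 a ->
  cond_exp a = group_trace (compress og a) *: creation R (vpath v0).
Proof.
move=> La; apply: bopP => f; apply: l2P => z; rewrite bopZE l2ZE -/vproj vprojE.
transitivity (vcoef a (psrc z) * f z); first by [].
have tr : group_trace (compress og a) = vcoef a v0.
  rewrite /group_trace compressE synth_delta /= -[LHS]/(l2dot _ _) l2dot_delta //.
case: (eqVneq (psrc z) v0) => [->|zv]; first by rewrite tr.
have [pa _] := loop_alg_vproj La.
have -> : vcoef a (psrc z) = 0 by rewrite /vcoef -pa bopME vprojE ifN.
by rewrite mul0r mulr0.
Qed.

Lemma compress_star_isomorphism :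
  star_isomorphism (loop_alg R v0) (group_vN R (free_group N)) (compress og).
Proof.
split.
- split; first by move=> a; exact: compress_group_vN.
    by move=> a b /set_mem La /set_mem Lb; exact: compress_inj.
  by move=> b Gb; have [a La <-] := compress_surj Gb; exists a.
- move=> a b _ _; apply: bopP => h; rewrite bopDE !compressE bopDE.
  by apply: l2P => g; rewrite /= l2dotDl.
- move=> c a _; apply: bopP => h; rewrite bopZE !compressE bopZE.
  by apply: l2P => g; rewrite /= l2dotZl.
(* The projection [D D^*] commutes with [b], so it may be inserted before [D]. *)
- move=> a b _ Lb; apply: bopP => h; rewrite bopME !compressE bopME -ran_projE.
  by rewrite (commE (loop_alg_ran_proj Lb)) ran_projE synthK.
- move=> a b _ _ ab; exact: (compress_adjoint og ab).
Qed.

End Freeness.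

Lemma loops_enum (G : digraph) (N : nat) (v0 : vertex G) : (loops v0 #= `I_N)%card ->
  exists2 ell : 'I_N -> edge G, injective ell &
    forall e, loops v0 e <-> exists i, e = ell i.
Proof.
case/card_set_bijP => f [fN finj fsurj].
have pre (i : 'I_N) : exists e, loops v0 e /\ f e = i.
  by have [e Le <-] := fsurj _ (ltn_ord i); exists e.
exists (fun i => sval (cid (pre i))) => [i j ij|e].
  by apply: val_inj; rewrite /= -(svalP (cid (pre i))).2 ij (svalP (cid (pre j))).2.
split=> [Le|[i ->]]; last exact: (svalP (cid (pre i))).1.
have fe := fN _ Le; exists (Ordinal fe).
have [Le' fe'] := svalP (cid (pre (Ordinal fe))).
by apply: finj; rewrite ?inE.
Qed.

Theorem corollary4p2 (R : realType) (G : digraph) (N : nat) (v0 : vertex G)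
    (loopsN : (loops v0 #= `I_N)%card) :
  exists Phi : bop R (gpath G) -> bop R (free_group N),
    star_isomorphism (loop_alg R v0) (group_vN R (free_group N)) Phi /\
    forall a, loop_alg R v0 a ->
      cond_exp a = group_trace (Phi a) *: creation R (vpath v0).
Proof.
have [ell ell_inj ellP] := loops_enum loopsN.
have [u [u' [uu' [uK u'K] u0 uj]]] := haar_unitary R.
exists (compress (gvec_orthonormal ell_inj ellP uu' uK u'K u0)); split.
  exact: compress_star_isomorphism.
by move=> a; exact: compress_trace.
Qed.
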